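(* Let $m \ge 4$ be an even integer and let $t$ be a positive integer. There exists a cyclic $m$-cycle system of $K_{mt}-I$ if and only if all of the following hold: (1) if $m \equiv 0 \pmod 8$, then $t \equiv 0$ or $2 \pmod 4$; (2) if $m \equiv 2 \pmod 8$, then $t \equiv 0$ or $1 \pmod 4$, and moreover $t > 1$ if $m = 2p^{\alpha}$ for some prime $p$ and some integer $\alpha \ge 1$; (3) if $m \equiv 4 \pmod 8$, then $t \ge 1$ (that is, there is no further restriction on $t$); (4) if $m \equiv 6 \pmod 8$, then $t \equiv 0$ or $3 \pmod 4$.
   Context: For an even integer $n$, $K_n - I$ denotes the complete graph on $n$ vertices with the edges of a 1-factor $I$ (a 1-regular spanning subgraph) removed. Here the vertex set is $\mathbb{Z}_n$ and $I$ consists of the edges $\{i, i+n/2\}$ for $i = 0, 1, \ldots, (n-2)/2$, so two distinct vertices $i,j \in \mathbb{Z}_n$ are adjacent in $K_n - I$ exactly when $j \neq i + n/2$ in $\mathbb{Z}_n$. An $m$-cycle $(v_1, v_2, \ldots, v_m)$ ($m \ge 3$) is a graph cycle with $m$ distinct vertices and edges $\{v_1,v_2\}, \{v_2,v_3\}, \ldots, \{v_{m-1},v_m\}, \{v_m,v_1\}$. An $m$-cycle system of a graph $G$ is a set $\mathcal{C}$ of $m$-cycles in $G$ whose edge sets partition the edge set of $G$. Let $\rho = (0\ 1\ \ldots\ n-1)$, i.e. $\rho(v) = v+1$ on $\mathbb{Z}_n$. An $m$-cycle system $\mathcal{C}$ of a graph $G$ with vertex set $\mathbb{Z}_n$ is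 cyclic if for every $m$-cycle $C = (v_1, \ldots, v_m) \in \mathcal{C}$, the $m$-cycle $\rho(C) = (\rho(v_1), \ldots, \rho(v_m))$ is also in $\mathcal{C}$. In the claim, $n = mt$. *)

(* Defs.v *)
From mathcomp Require Import all_boot all_algebra.

Set Implicit Arguments.
Unset Strict Implicit.
Unset Printing Implicit Defensive.

Import GRing.Theory.

Definition edge_set (T : finType) (e : rel T) : {set {set T}} :=
  [set [set p.1; p.2] | p : T * T & e p.1 p.2].

(* The cycle (v_1, ..., v_m) as a graph: a cycle is identified with its set of
   edges {v_1, v_2}, ..., {v_m, v_1}, so that rotations and reversals of the
   sequence denote the same cycle. *)
Definition cycle_graph (T : finType) (v : seq T) : {set {set T}} :=
  [set [set x; next v x] | x in v].

Definition is_cycle_seq (T : finType) (e : rel T) (m : nat) (v : seq T) : Prop :=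
  [/\ 3 <= m, size v = m, uniq v & cycle e v].

Definition cycle_system (T : finType) (e : rel T) (m : nat)
    (C : {set {set {set T}}}) : Prop :=
  (forall E, E \in C -> exists2 v, is_cycle_seq e m v & E = cycle_graph v)
  /\ partition C (edge_set e).

(* 'Z_n is Z/nZ only for n > 1; below, n is even and at least 4. *)
Definition rho (n : nat) (v : 'Z_n) : 'Z_n := (v + 1)%R.

Definition cyclic_cycle_system (n : nat) (e : rel 'Z_n) (m : nat)
    (C : {set {set {set 'Z_n}}}) : Prop :=
  cycle_system e m C /\
  forall v : seq 'Z_n, is_cycle_seq e m v -> cycle_graph v \in C ->
    cycle_graph (map (@rho n) v) \in C.

(* Adjacency in K_n - I, for n even; I = { {i, i + n/2} }. *)
Definition complete_minus_I (n : nat) : rel 'Z_n :=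
  fun i j => (i != j) && (j != i + (n./2)%:R)%R.

(* Main.v *)
From mathcomp Require Import fingroup perm.
Require Import Defs.
From mathcomp Require Import all_boot all_order all_algebra.
From mathcomp Require Import zify ring.

(** Let n = m t.  An edge of K_n - I has a length in 1, ..., n/2 - 1, its distance on
the circle Z_n.

Sufficiency is a difference method.  Take a path of r edges in the integers,
r dividing m, whose vertices are distinct mod t r and whose end is u t r from its start
with u coprime to m/r.  Repeated m/r times it becomes an m-cycle of Z_n
that is invariant under translation by t r.  If the steps of a family of such
starters have every length exactly once, then the translates of their
cycles form a cyclic system ([cyclic_system_of_family]).  It remains to
distribute the lengths over starters.

Sort the differences by their residue c mod t, up to sign.  For 0 < c < t/2 the
m differences in the class of c can be the steps of one closed path that alternates
between t Z and c + t Z if 4 divides m ([zigzag_class]).  If m = 2 mod 4 a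
parity argument forbids this, but two classes can be taken together
([class_pair]), and one class can be taken together with multiples of t
([mixed_class], [quarter_class]).  The multiples of t and, for even t, the odd
multiples of t/2 are covered by short paths that wind around the circle
([quarter_turn], [half_turn] and so on).  The gaps are filled by starters with two
edges, which cover lengths x and x + 2 t ([pair_run]).  What is left is t = 1 and
m = 2 mod 8, where there are no classes to work with.  If m/2 is not a
prime power, write m/2 = p q with p < q coprime: then there are paths that wind
around the circle with base paths of p, q or 2 q edges ([p_turn], [q_turn],
[block_pair]), and the lengths are sorted by their quotient by 2 q and their parity.

Necessity counts the odd edges, those that join vertices of different parity.  If the
stabiliser of a cycle under translations has order s, then 2 s divides the number of
its odd edges plus n ([odd_steps_invariant]).  Summed over the rho-orbits, this
says that the number n floor(n/4) of all odd edges plus n times the number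
t (n/2 - 1) of cycles is a multiple of 2 n; so floor(n/4) + t (n/2 - 1) is even
([parity_condition]), which is exactly the condition on t mod 4.  For t = 1 and
m = 2 p^a, the cycle through an edge of difference 2 p^(a-1) has to be
invariant under translation by this difference, which makes it a
p-cycle ([no_hamiltonian_prime_power]). *)

Set Implicit Arguments.
Unset Strict Implicit.
Unset Printing Implicit Defensive.
Import Order.TTheory GRing.Theory Num.Theory.

(** * Cycles and edge sets of graphs *)

Lemma next_mkseq (T : eqType) (f : nat -> T) (m k : nat) :
  uniq (mkseq f m) -> f m = f 0 -> k < m -> next (mkseq f m) (f k) = f k.+1.
Proof.
move=> Uf fm km.
have m0: 0 < m by apply: leq_ltn_trans km.
have sz: size (mkseq f m) = m by rewrite size_mkseq.
rewrite next_nth (_ : f k = nth (f 0) (mkseq f m) k); last by rewrite nth_mkseq.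
rewrite mem_nth ?sz // index_uniq ?sz //.
case: m m0 fm km {Uf sz} => // m _ fm km.
rewrite /mkseq /= -[X in nth _ X]/(behead (map f (iota 0 m.+1))) nth_behead.
case: (ltnP k.+1 m.+1) => h; first by rewrite (nth_map 0) ?size_iota // nth_iota.
rewrite nth_default ?size_map ?size_iota //.
by have -> : k.+1 = m.+1 by apply/eqP; rewrite eqn_leq km h.
Qed.

Lemma cycle_graph_mkseq (T : finType) (f : nat -> T) (m : nat) :
  uniq (mkseq f m) -> f m = f 0 ->
  cycle_graph (mkseq f m) = [set [set f k; f k.+1] | k : 'I_m].
Proof.
move=> Uf fm; apply/setP=> E; apply/imsetP/imsetP.
  case=> x /mapP[k]; rewrite mem_iota /= add0n => km -> ->.
  by exists (Ordinal km); rewrite //= next_mkseq.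
case=> k _ ->; exists (f k); last by rewrite next_mkseq.
by apply/mapP; exists (k : nat); rewrite // mem_iota /= add0n.
Qed.

Lemma cycle_mkseqP (T : eqType) (e : rel T) (f : nat -> T) (m : nat) :
  uniq (mkseq f m) -> f m = f 0 ->
  cycle e (mkseq f m) <-> (forall k, k < m -> e (f k) (f k.+1)).
Proof.
move=> Uf fm; split=> [C k km | H].
  rewrite -(next_mkseq Uf fm km); apply: next_cycle C _.
  by apply/mapP; exists k; rewrite // mem_iota add0n.
apply: cycle_from_next => // x /mapP[k]; rewrite mem_iota add0n /= => km ->.
by rewrite next_mkseq // H.
Qed.

(** A cycle given as a list becomes a periodic function on [nat], so that
indices need no wrap-around at the end of the list. *)
Lemma mkseq_nth_mod (T : Type) (x0 : T) (v : seq T) :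
  mkseq (fun i => nth x0 v (i %% size v)) (size v) = v.
Proof.
rewrite -[RHS](mkseq_nth x0); apply/eq_in_map => i.
by rewrite mem_iota /= add0n => h; rewrite modn_small.
Qed.

Lemma cycle_graph_map (T : finType) (f : T -> T) (v : seq T) :
  injective f -> uniq v ->
  cycle_graph (map f v) = [set f @: E | E : {set T} in cycle_graph v].
Proof.
move=> fI Uv.
have img a b : f @: [set a; b] = [set f a; f b] by rewrite imsetU1 imset_set1.
apply/setP => E; apply/imsetP/imsetP.
  case=> _ /mapP[x xv ->] ->; exists [set x; next v x]; last by rewrite img next_map.
  by apply/imsetP; exists x.
case=> _ /imsetP[x xv ->] ->; exists (f x); first exact: map_f.
by rewrite img next_map.
Qed.

(** An edge determines its ends up to order; every comparison of two edges below
splits into these two orientations. *)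
Lemma set2_eqP (T : finType) (a b c d : T) :
  [set a; b] = [set c; d] -> (a = c /\ b = d) \/ (a = d /\ b = c).
Proof.
move=> E; have := set21 a b; have := set22 a b; rewrite E !inE.
case/orP=> /eqP e1; case/orP=> /eqP e2; subst.
- by left; split=> //; move: (set22 c d); rewrite -E !inE orbb => /eqP.
- by right.
- by left.
- by right; split=> //; move: (set21 c d); rewrite -E !inE orbb => /eqP.
Qed.

Lemma mem_edge_set (T : finType) (e : rel T) x y :
  symmetric e -> ([set x; y] \in edge_set e) = e x y.
Proof.
move=> sym; apply/imsetP/idP => [[[a b]]|xy]; last by exists (x, y); rewrite ?inE.
by rewrite inE /= => ab /set2_eqP[[-> ->]|[-> ->]] //; rewrite sym.
Qed.

(** * Residues mod n and the graph *)

Lemma intr_Zp_eq (n : nat) (x y : int) : 1 < n ->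
  ((x%:~R == y%:~R :> 'Z_n) = (n%:Z %| x - y)%Z)%R.
Proof.
move=> n1; rewrite -subr_eq0 -rmorphB /=.
have H k : (k%:R == 0 :> 'Z_n)%R = (n %| k).
  rewrite -(Zp_nat_mod n1) ; apply/eqP/idP.
    move/(congr1 val); rewrite /= val_Zp_nat // modn_mod => /eqP; exact.
  by move/eqP => ->.
case: (x - y)%R => k; first by rewrite -pmulrn H dvdzE.
rewrite NegzE rmorphN /= oppr_eq0 -pmulrn H dvdzE abszN //.
Qed.

(** Since n is even, the parity of a residue mod n is meaningful and additive. *)
Lemma odd_addZ (n : nat) (n1 : 1 < n) (ne : ~~ odd n) (x : 'Z_n) (a : nat) : odd (x + a%:R : 'Z_n)%R = odd x (+) odd a.
Proof.
have nE := Zp_cast n1; rewrite /= val_Zp_nat // -oddD.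
have odd_mod k N : N = n -> odd (k %% N) = odd k.
  by move=> ->; rewrite {2}(divn_eq k n) oddD oddM (negbTE ne) andbF.
by rewrite odd_mod // oddD odd_mod // oddD.
Qed.

Lemma complete_minus_I_sym (n : nat) : 1 < n -> ~~ odd n ->
  symmetric (@complete_minus_I n).
Proof.
move=> n1 ne; suff h a b : complete_minus_I a b -> @complete_minus_I n b a.
  by move=> a b; apply/idP/idP; apply: h.
rewrite /complete_minus_I => /andP[ab bn]; rewrite eq_sym ab /=.
apply: contra bn => /eqP ->; rewrite -addrA -natrD addnn even_halfK //.
by rewrite pchar_Zp // addr0.
Qed.

Lemma map_inj_uniq_in (T1 T2 : eqType) (f : T1 -> T2) (s : seq T1) :
  uniq (map f s) -> {in s &, injective f}.
Proof.
elim: s => //= a s IH /andP[na us] x y; rewrite !inE.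
case/orP=> [/eqP->|xs]; case/orP=> [/eqP->|ys] // fxy.
- by case/negP: na; rewrite fxy map_f.
- by case/negP: na; rewrite -fxy map_f.
exact: IH.
Qed.

Local Open Scope ring_scope.

(** * Base paths and their repetition *)

(** A starter (r, v) is a base path v 0, ..., v r of integers. *)
Definition starter := (nat * (nat -> int))%type.

Definition step (s : starter) (i : nat) : int := s.2 i.+1 - s.2 i.

(** A base path for cycles of length m in Z_n, n = m t: it starts at 0, its
vertices before the last are distinct mod t r, and it ends at u t r with u
coprime to m / r.  Then the translates of the path by multiples of t r,
put end to end, go once through every residue mod n that lies over
v 0, ..., v (r - 1) mod t r; they form an m-cycle that is invariant under
translation by t r.  For r = m the path is itself closed mod n, and for r = 1
the cycle consists of the multiples of a generator of t Z_n. *)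
Definition is_starter (m t : nat) (s : starter) : Prop :=
  [/\ (0 < s.1)%N, (s.1 %| m)%N, s.2 0%N = 0,
      forall i j, (i < j < s.1)%N -> ~~ ((t * s.1)%:Z %| s.2 j - s.2 i)%Z
    & exists2 u : int, s.2 s.1 = u * (t * s.1)%:Z & coprimez u (m %/ s.1)%N%:Z].

(** Up to sign and modulo n, x is a step of s.  Signs do not matter, since an edge
{a, b} of Z_n has the two differences b - a and a - b. *)
Definition covers (n : nat) (s : starter) (x : int) : Prop :=
  exists2 i, (i < s.1)%N & (n%:Z %| step s i - x)%Z \/ (n%:Z %| step s i + x)%Z.

(** The base path repeated end to end, each copy starting where the previous one
ends. *)
Definition walk (s : starter) (k : nat) : int :=
  s.2 (k %% s.1)%N + (k %/ s.1)%:Z * s.2 s.1.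

Lemma walk_step m t s k : is_starter m t s ->
  walk s k.+1 - walk s k = step s (k %% s.1)%N.
Proof.
case=> r0 _ v0 _ _; rewrite /walk /step.
have E := divn_eq k s.1; have lt := ltn_pmod k r0.
set a := (k %/ s.1)%N in E *; set b := (k %% s.1)%N in E lt *.
case: (ltnP b.+1 s.1) => h.
  have -> : (k.+1 %% s.1 = b.+1)%N by rewrite E -addnS modnMDl modn_small.
  have -> : (k.+1 %/ s.1 = a)%N by rewrite E -addnS divnMDl // divn_small // addn0.
  ring.
have e : b.+1 = s.1 by apply/eqP; rewrite eqn_leq lt h.
have -> : (k.+1 %% s.1 = 0)%N by rewrite E -addnS e -mulSnr modnMl.
have -> : (k.+1 %/ s.1 = a.+1)%N by rewrite E -addnS e -mulSnr mulnK.
rewrite v0 e (_ : a.+1%:Z = a%:Z + 1); [ring | lia].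
Qed.

Lemma walk_add s k a : (0 < s.1)%N -> walk s (k + a * s.1)%N = walk s k + a%:Z * s.2 s.1.
Proof.
move=> r0; rewrite /walk addnC modnMDl divnMDl // PoszD; ring.
Qed.

(** Mod t r the walk repeats the base path, so equal vertices have the same
position in it; their distance is then a multiple of u t r, and u is invertible
mod m / r. *)
Lemma walk_inj m t s i j : (0 < t)%N -> is_starter m t s ->
  (i < m)%N -> (j < m)%N -> ((m * t)%N%:Z %| walk s j - walk s i)%Z -> i = j.
Proof.
move=> t0 [r0 rm v0 V [u D cu]] im jm dv.
have mE : m = (m %/ s.1 * s.1)%N by rewrite divnK.
set q := (m %/ s.1)%N in mE cu.
have trn : ((t * s.1)%N%:Z %| (m * t)%N%:Z)%Z.
  by rewrite dvdzE /= mE -mulnA (mulnC s.1) dvdn_mull.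
have sub k : walk s k = s.2 (k %% s.1)%N + (k %/ s.1)%:Z * u * (t * s.1)%:Z.
  by rewrite /walk D mulrA.
have eqm : (i %% s.1 = j %% s.1)%N.
  have d2 : ((t * s.1)%N%:Z %| s.2 (j %% s.1)%N - s.2 (i %% s.1)%N)%Z.
    have := dvdz_trans trn dv; rewrite !sub.
    set A := s.2 _; set B := s.2 _.
    rewrite (_ : _ - _ = A - B + ((j %/ s.1)%:Z - (i %/ s.1)%:Z) * u * (t * s.1)%:Z); last by ring.
    by rewrite rpredDr ?dvdz_mull ?dvdzz.
  case: (ltngtP (i %% s.1) (j %% s.1)) => // h.
    by have := V _ _ (introT andP (conj h (ltn_pmod j r0))); rewrite d2.
  have := V _ _ (introT andP (conj h (ltn_pmod i r0))).
  by rewrite -opprB rpredN d2.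
move: dv; rewrite !sub eqm.
set A := s.2 _.
rewrite (_ : _ - _ = ((j %/ s.1)%:Z - (i %/ s.1)%:Z) * u * (t * s.1)%:Z); last by ring.
have -> : (m * t)%N%:Z = q%:Z * (t * s.1)%:Z by rewrite {1}mE -PoszM; congr Posz; lia.
rewrite dvdz_mul2r; last by rewrite eqz_nat muln_eq0 negb_or -!lt0n t0 r0.
have cu' : coprimez q u by rewrite coprimez_sym.
rewrite Gauss_dvdzl // => dd.
have [iq jq] : (i %/ s.1 < q)%N /\ (j %/ s.1 < q)%N by rewrite !ltn_divLR // -mE.
have : (i %/ s.1 = j %/ s.1)%N.
  move: iq jq dd; move: (i %/ s.1)%N (j %/ s.1)%N => x y xq yq.
  rewrite -eqz_mod_dvd !modz_nat eqz_nat => /eqP.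
  by rewrite !modn_small.
by move=> e; rewrite (divn_eq i s.1) e eqm -divn_eq.
Qed.

(** * Development of a family of starters into a cyclic system *)

(** The distance from x to 0 on the circle Z_n, i.e. the length of an edge with
difference x. *)
Definition len (n : nat) (x : int) : nat :=
  let a := (x%:~R : 'Z_n)%R : nat in minn a (n - a).

Section Development.

Variables (m t : nat) (fam : seq starter).
Let n := (m * t)%N.
Let s0 : starter := (0%N, fun=> 0).
Hypotheses (m3 : (3 <= m)%N) (m_even : ~~ odd m) (t0 : (0 < t)%N).
Hypothesis famP : forall k, (k < size fam)%N -> is_starter m t (nth s0 fam k).
Hypothesis fam_size : (sumn [seq s.1 | s <- fam] <= n./2.-1)%N.
Hypothesis fam_cover : forall x : nat, (0 < x < n./2)%N ->
  exists2 k, (k < size fam)%N & covers n (nth s0 fam k) x%:Z.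

Let n1 : (1 < n)%N.
Proof. by rewrite /n; apply: (leq_trans (ltnW m3)); rewrite leq_pmulr. Qed.

Let n_even : n = (n./2 + n./2)%N.
Proof. by rewrite addnn even_halfK // oddM (negbTE m_even). Qed.

Let len_val (x : nat) : (x < n)%N -> nat_of_ord (x%:Z%:~R : 'Z_n) = x.
Proof. by move=> xn; rewrite -pmulrn val_Zp_nat // modn_small. Qed.

Let ltZ (z : 'Z_n) : (z < n)%N.
Proof. by case: z => /= z; rewrite Zp_cast. Qed.

Let oppZ (z : 'Z_n) : (0 < z)%N -> nat_of_ord (- z)%R = (n - z)%N.
Proof.
move=> z0; have zn := ltZ z; have h := Zp_cast n1.
by rewrite /= modn_small; lia.
Qed.

Let lenN x : len n (- x) = len n x.
Proof.
rewrite /len mulrNz; set z : 'Z_n := x%:~R.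
have [z0|z0] := posnP z.
  have -> : z = 0 by apply: val_inj; rewrite /= z0.
  by rewrite oppr0.
by have e := oppZ z0; have zn := ltZ z; rewrite e; lia.
Qed.

Let len_eq x y : (n%:Z %| x - y)%Z -> len n x = len n y.
Proof. by rewrite -intr_Zp_eq // /len => /eqP ->. Qed.

Let len_nat (x : nat) : (0 < x < n./2)%N -> len n x = x.
Proof. by move=> h; rewrite /len len_val; lia. Qed.

Let len_inv x y : len n x = len n y -> (n%:Z %| x - y)%Z \/ (n%:Z %| x + y)%Z.
Proof.
rewrite (_ : x + y = x - (- y)); last by rewrite opprK.
rewrite -!intr_Zp_eq // mulrNz /len.
move: (x%:~R : 'Z_n) (y%:~R : 'Z_n) => a b e.
have [an bn] := (ltZ a, ltZ b).
have [ab|ab] := eqVneq (a : nat) b; first by left; apply/eqP/val_inj.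
have [b0|b0] := posnP b; first by lia.
by right; apply/eqP/val_inj; rewrite [RHS]oppZ //=; lia.
Qed.

(* A slot (k, i) is the i-th step of the k-th starter. *)
Let slots := [seq (k, i) | k <- iota 0 (size fam), i <- iota 0 (nth s0 fam k).1].
Let slen (p : nat * nat) := len n (step (nth s0 fam p.1) p.2).

Let slotsP k i : (k < size fam)%N -> (i < (nth s0 fam k).1)%N -> (k, i) \in slots.
Proof.
by move=> hk hi; apply: allpairs_f_dep; rewrite mem_iota add0n.
Qed.

Let slots_size : (size slots <= n./2.-1)%N.
Proof.
rewrite size_allpairs_dep; apply: leq_trans fam_size; rewrite eq_leq //; congr sumn.
rewrite -[in RHS](mkseq_nth s0 fam) /mkseq -map_comp; apply/eq_map => k /=.
by rewrite size_iota.
Qed.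

(* Pigeonhole: there are at most n/2 - 1 slots and they realise the n/2 - 1
   lengths, so each length belongs to exactly one slot. *)
Let slot_lengths : uniq (map slen slots) /\ map slen slots =i iota 1 n./2.-1.
Proof.
have sub : {subset iota 1 n./2.-1 <= map slen slots}.
  move=> x; rewrite mem_iota => hx; have hx' : (0 < x < n./2)%N by lia.
  have [k hk [i hi hc]] := fam_cover hx'.
  apply/mapP; exists (k, i); first exact: slotsP.
  rewrite -[LHS](len_nat hx') /slen /=; case: hc => hc.
    by apply/esym/len_eq.
  by rewrite -lenN; apply/esym/len_eq; rewrite opprK.
have sz : (size (map slen slots) <= size (iota 1 n./2.-1))%N.
  by rewrite size_map size_iota slots_size.
split; first exact: leq_size_uniq (iota_uniq _ _) sub sz.
by move=> x; have [_ ->] := uniq_min_size (iota_uniq _ _) sub sz.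
Qed.

Let step_len k i : (k < size fam)%N -> (i < (nth s0 fam k).1)%N ->
  (0 < len n (step (nth s0 fam k) i) < n./2)%N.
Proof.
move=> hk hi; have : slen (k, i) \in map slen slots by apply/map_f/slotsP.
by rewrite (slot_lengths.2) mem_iota /slen /=; lia.
Qed.

Let slot_inj k i k' i' : (k < size fam)%N -> (i < (nth s0 fam k).1)%N ->
  (k' < size fam)%N -> (i' < (nth s0 fam k').1)%N ->
  len n (step (nth s0 fam k) i) = len n (step (nth s0 fam k') i') ->
  k = k' /\ i = i'.
Proof.
move=> h1 h2 h3 h4 e.
by have [-> ->] := map_inj_uniq_in slot_lengths.1 (slotsP h1 h2) (slotsP h3 h4) e.
Qed.

(* The walk of s translated by g, in Z_n; [cyc s g] is the resulting m-cycle. *)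
Let W (s : starter) (g : 'Z_n) (k : nat) : 'Z_n := (walk s k)%:~R + g.
Let cyc s g := mkseq (W s g) m.

Let m0 : (0 < m)%N. Proof. by apply: leq_trans m3. Qed.

Let Wadd s g k a : is_starter m t s -> W s g (k + a * s.1)%N = W s (g + (a%:Z * s.2 s.1)%:~R) k.
Proof. by case=> r0 *; rewrite /W walk_add // rmorphD /= -addrA (addrC g). Qed.

Let Wper s g k a : is_starter m t s -> W s g (k + a * m)%N = W s g k.
Proof.
move=> S; case: (S) => r0 rm v0 _ [u D _].
rewrite -{1}(divnK rm) mulnA Wadd // D.
suff -> : ((a * (m %/ s.1))%N%:Z * (u * (t * s.1)%:Z))%:~R = 0 :> 'Z_n by rewrite addr0.
apply/eqP; rewrite -[0]/(0%:~R) intr_Zp_eq // subr0.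
have -> : (a * (m %/ s.1))%N%:Z * (u * (t * s.1)%:Z) = a%:Z * u * n%:Z.
  by rewrite /n -{2}(divnK rm) !PoszM; ring.
exact: dvdz_mull.
Qed.

Let W0 s g : is_starter m t s -> W s g m = W s g 0.
Proof. by move=> S; rewrite -{1}(add0n m) -{1}(mul1n m) Wper. Qed.

Let Wuniq s g : is_starter m t s -> uniq (cyc s g).
Proof.
move=> S; apply/mkseq_uniqP => i j; rewrite !inE => im jm /addIr/eqP.
by rewrite eq_sym intr_Zp_eq // => /walk_inj -> //.
Qed.

Let Wstep s g k : is_starter m t s ->
  W s g k.+1 = W s g k + (step s (k %% s.1)%N)%:~R.
Proof.
move=> S; rewrite -(walk_step k S) /W rmorphB /=; ring.
Qed.

Let edgeP s g k : is_starter m t s -> [set W s g k; W s g k.+1] \in cycle_graph (cyc s g).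
Proof.
move=> S; rewrite cycle_graph_mkseq ?Wuniq ?W0 //; apply/imsetP.
exists (Ordinal (ltn_pmod k m0)) => //=.
by rewrite {1 2}(divn_eq k m) -addnS addnC (addnC _ _.+1) !Wper.
Qed.

Let edge_ex s g E : is_starter m t s -> E \in cycle_graph (cyc s g) ->
  exists k, E = [set W s g k; W s g k.+1].
Proof.
by move=> S; rewrite cycle_graph_mkseq ?Wuniq ?W0 // => /imsetP[k _ ->]; exists k.
Qed.

Let shift_sub s g a : is_starter m t s ->
  cycle_graph (cyc s (g + (a%:Z * s.2 s.1)%:~R)) \subset cycle_graph (cyc s g).
Proof.
move=> S; apply/subsetP => E /(edge_ex S)[k ->].
by rewrite -!Wadd // addSn edgeP.
Qed.

(* Translation by a multiple of the end of the base path turns the cycle along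
   itself. *)
Let shift s g a : is_starter m t s ->
  cycle_graph (cyc s (g + (a%:Z * s.2 s.1)%:~R)) = cycle_graph (cyc s g).
Proof.
move=> S; apply/eqP; rewrite eqEsubset shift_sub //=.
have {1}-> : g = g + (a%:Z * s.2 s.1)%:~R + ((a * m.-1)%N%:Z * s.2 s.1)%:~R.
  have E : g + ((a * m)%N%:Z * s.2 s.1)%:~R = g.
    by have := Wper g 0 (a * s.1) S; rewrite mulnAC Wadd // => /addrI.
  rewrite -addrA -rmorphD /= -mulrDl -PoszD.
  by rewrite (_ : (a + a * m.-1 = a * m)%N) ?E // -{1}(muln1 a) -mulnDr add1n prednK.
exact: shift_sub.
Qed.

Let e := @complete_minus_I n.

Let half_int : (n./2)%:R = (n./2%:Z)%:~R :> 'Z_n.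
Proof. by rewrite pmulrn. Qed.

Let e_int (x : 'Z_n) (d : int) : e x (x + d%:~R) = ~~ (n%:Z %| d)%Z && ~~ (n%:Z %| d - n./2%:Z)%Z.
Proof.
rewrite /e /complete_minus_I half_int.
rewrite -{1}(addr0 x) !(inj_eq (addrI x)) eq_sym -[0]/(0%:~R) !intr_Zp_eq //.
by rewrite subr0.
Qed.

Let len_adj d : (0 < len n d < n./2)%N -> ~~ (n%:Z %| d)%Z && ~~ (n%:Z %| d - n./2%:Z)%Z.
Proof.
move=> h; apply/andP; split; apply/negP => dv; move: h.
  have -> : len n d = len n 0 by apply: len_eq; rewrite subr0.
  by rewrite /len /=; lia.
rewrite (len_eq dv) /len len_val; lia.
Qed.

(* A step is never its own opposite, as n/2 is not a length in use; hence the
   orientation of an edge along its cycle is determined by the edge. *)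
Let step_noinv k i : (k < size fam)%N -> (i < (nth s0 fam k).1)%N ->
   ~~ (n%:Z %| step (nth s0 fam k) i + step (nth s0 fam k) i)%Z.
Proof.
move=> hk hi; have := step_len hk hi; set d := step _ _ => h; apply/negP.
rewrite -{2}(opprK d) -intr_Zp_eq // mulrNz => /eqP.
move: h; rewrite /len; move: (d%:~R : 'Z_n) => z h z2.
have z0 : (0 < z)%N by lia.
by have := oppZ z0; rewrite -z2; have := ltZ z; lia.
Qed.

Let C := [set cycle_graph (cyc (nth s0 fam p.1) p.2) | p : 'I_(size fam) * 'Z_n].

Let CP k g : (k < size fam)%N -> cycle_graph (cyc (nth s0 fam k) g) \in C.
Proof. by move=> hk; apply/imsetP; exists (Ordinal hk, g). Qed.

Let C_cycle k g : (k < size fam)%N -> is_cycle_seq e m (cyc (nth s0 fam k) g).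
Proof.
move=> hk; have S := famP hk; have U := Wuniq g S; split=> //; first by rewrite size_mkseq.
apply/cycle_mkseqP => //; first exact: W0.
move=> i im; rewrite Wstep // e_int len_adj // step_len //.
by rewrite ltn_pmod //; case: S.
Qed.

Let edge_in x y : ([set x; y] \in edge_set e) = e x y.
Proof. by apply: mem_edge_set; apply: complete_minus_I_sym; rewrite // oddM (negbTE m_even). Qed.

(* The length of a common edge determines the slot, its orientation is fixed, and
   so the two translates differ by a multiple of the end of the base path. *)
Let eqW k g k' g' i i' : (k < size fam)%N -> (k' < size fam)%N ->
  [set W (nth s0 fam k) g i; W (nth s0 fam k) g i.+1] =
  [set W (nth s0 fam k') g' i'; W (nth s0 fam k') g' i'.+1] ->
  cycle_graph (cyc (nth s0 fam k) g) = cycle_graph (cyc (nth s0 fam k') g').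
Proof.
move=> hk hk'; have [S S'] := (famP hk, famP hk').
have hi : (i %% (nth s0 fam k).1 < (nth s0 fam k).1)%N by case: S => r0 *; rewrite ltn_pmod.
have hi' : (i' %% (nth s0 fam k').1 < (nth s0 fam k').1)%N by case: S' => r0 *; rewrite ltn_pmod.
rewrite !Wstep // => E.
have [[Ea Eb]|[Ea Eb]] := set2_eqP E.
  have dd : (n%:Z %| step (nth s0 fam k) (i %% (nth s0 fam k).1)%N
                   - step (nth s0 fam k') (i' %% (nth s0 fam k').1)%N)%Z.
    by rewrite -intr_Zp_eq //; apply/eqP; move: Eb; rewrite Ea => /addrI.
  have [ek ei] := slot_inj hk hi hk' hi' (len_eq dd); subst k'.
  move: Ea; rewrite (divn_eq i (nth s0 fam k).1) (divn_eq i' (nth s0 fam k).1) ei.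
  rewrite addnC (addnC (_ * _)%N) !Wadd // => /addrI Ea.
  by rewrite -(shift g (i %/ (nth s0 fam k).1) S) Ea shift.
have dd : (n%:Z %| step (nth s0 fam k) (i %% (nth s0 fam k).1)%N
                   - (- step (nth s0 fam k') (i' %% (nth s0 fam k').1)%N))%Z.
  rewrite -intr_Zp_eq // mulrNz; apply/eqP; move: Eb; rewrite Ea -addrA.
  by rewrite -{2}(addr0 (W _ _ i')) => /addrI/eqP; rewrite addrC addr_eq0 => /eqP.
have [ek ei] := slot_inj hk hi hk' hi' (etrans (len_eq dd) (lenN _)); subst k'.
by move: dd; rewrite ei opprK (negbTE (step_noinv _ _)).
Qed.

(** The cycles are all translates of the walks of the starters, so the system is
invariant under rho.  An edge of length l lies on a translate of the walk that
has l as a step, and on no other cycle because the slot of length l is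
unique. *)
Lemma cyclic_system_of_starters :
  exists C : {set {set {set 'Z_n}}}, cyclic_cycle_system e m C.
Proof.
exists C; split; first split.
- move=> E /imsetP[[k g] _ ->] /=; exists (cyc (nth s0 fam k) g) => //.
  exact: C_cycle.
- apply/and3P; split.
  + rewrite eqEsubset; apply/andP; split; apply/subsetP => E.
      case/bigcupP => F /imsetP[[k g] _ ->] /=.
      have S := famP (ltn_ord k); have [_ _ U cy] := C_cycle g (ltn_ord k).
      case/(edge_ex S) => i ->; rewrite edge_in Wstep // e_int len_adj // step_len //.
      by rewrite ltn_pmod //; case: S.
    case/imsetP => [[a b]]; rewrite inE /= => ab ->.
    have [z hb] : {z : 'Z_n | b = a + z} by exists (b - a); rewrite addrC subrK.
    have zE : (z : nat)%:Z%:~R = z by rewrite -pmulrn natr_Zp.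
    have : (0 < len n (z : nat)%:Z < n./2)%N.
      rewrite /len zE.
      move: ab; rewrite /e /complete_minus_I hb => /andP[az zn].
      have zl := ltZ z.
      have z0 : (z != 0 :> nat)%N.
        apply: contraNneq az => z0; have -> : z = 0 by apply: val_inj; rewrite /= z0.
        by rewrite addr0.
      have z1 : (z != n./2 :> nat)%N.
        by apply: contraNneq zn => z1; rewrite -z1 natr_Zp.
      lia.
    set x := len _ _ => hx.
    have [k hk [i hi hc]] := fam_cover hx.
    set s := nth s0 fam k in hi hc *; have S : is_starter m t s by apply: famP.
    have : (n%:Z %| step s i - (z : nat)%:Z)%Z \/ (n%:Z %| step s i + (z : nat)%:Z)%Z.
      apply: len_inv; rewrite -/x -[RHS](len_nat hx); case: hc => hc.
        exact: len_eq.
      by rewrite -[RHS]lenN; apply: len_eq; rewrite opprK.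
    have imod : (i %% s.1 = i)%N by rewrite modn_small.
    case=> [|].
      rewrite -intr_Zp_eq // zE => /eqP st.
      apply/bigcupP; exists (cycle_graph (cyc s (a - (walk s i)%:~R))); first exact: CP.
      have := edgeP (a - (walk s i)%:~R) i S; rewrite Wstep // imod st /W.
      by rewrite [_ + (a - _)]addrC subrK -hb.
    rewrite -[X in _ + X]opprK -intr_Zp_eq // mulrNz zE => /eqP st.
    apply/bigcupP; exists (cycle_graph (cyc s (b - (walk s i)%:~R))); first exact: CP.
    have := edgeP (b - (walk s i)%:~R) i S; rewrite Wstep // imod st /W.
    by rewrite [_ + (b - _)]addrC subrK {2}hb addrK setUC.
  + apply/trivIsetP => A B /imsetP[[k g] _ ->] /imsetP[[k' g'] _ ->] /=.
    apply: contraR => /pred0Pn[E /= /andP[]].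
    case/(edge_ex (famP (ltn_ord k))) => i -> /(edge_ex (famP (ltn_ord k')))[i'] h.
    by apply/eqP; apply: eqW h.
  + apply/imsetP => [[[k g] _ E0]].
    have := edgeP g 0 (famP (ltn_ord k)); rewrite -E0 inE //.
move=> v [_ sv uv _] /imsetP[[k g] _ E] /=.
have S := famP (ltn_ord k).
have -> : cycle_graph [seq rho i | i <- v] = cycle_graph (cyc (nth s0 fam k) (g + 1)).
  have rI : injective (@rho n) by apply: addIr.
  rewrite cycle_graph_map // E -cycle_graph_map ?Wuniq // -map_comp.
  by congr cycle_graph; apply: eq_map => i /=; rewrite /rho /W addrA.
exact: CP.
Qed.

End Development.

(** * Families of starters and elementary paths *)

(** Steps as integers, before reduction mod n: the explicit paths are computed in
this form. *)
Definition has_step (s : starter) (d : int) : Prop :=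
  exists2 i, (i < s.1)%N & step s i = d \/ step s i = - d.

(** [List.In] rather than a boolean membership: starters contain functions, which
have no decidable equality. *)
Definition uses (n : nat) (fam : seq starter) (x : int) : Prop :=
  exists s d, [/\ List.In s fam, has_step s d & (n%:Z %| d - x)%Z].

Definition starters (m t : nat) (fam : seq starter) : Prop :=
  forall s, List.In s fam -> is_starter m t s.

(** The number of edge lengths that a family can cover. *)
Definition weight (fam : seq starter) : nat := sumn [seq s.1 | s <- fam].

Lemma usesN n fam x : uses n fam (- x) -> uses n fam x.
Proof.
case=> s [d [ins [i hi hd] dv]]; exists s, (- d); split=> //.
  by exists i => //; rewrite opprK; case: hd; [right | left].
by rewrite -opprD rpredN -(opprK x).
Qed.

Lemma uses_mod n fam x y : (n%:Z %| x - y)%Z -> uses n fam x -> uses n fam y.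
Proof.
move=> xy [s [d [ins hd dv]]]; exists s, d; split=> //.
have -> : d - y = d - x + (x - y) by ring.
exact: rpredD.
Qed.

Lemma uses_catl n f1 f2 x : uses n f1 x -> uses n (f1 ++ f2) x.
Proof. by case=> s [d [i h dv]]; exists s, d; split=> //; apply/List.in_app_iff; left. Qed.

Lemma uses_catr n f1 f2 x : uses n f2 x -> uses n (f1 ++ f2) x.
Proof. by case=> s [d [i h dv]]; exists s, d; split=> //; apply/List.in_app_iff; right. Qed.

Lemma uses_head n s f d : has_step s d -> uses n (s :: f) d.
Proof. by move=> h; exists s, d; split=> //; [left | rewrite subrr dvdz0]. Qed.

Lemma uses_cons n s f x : uses n f x -> uses n (s :: f) x.
Proof. exact: (@uses_catr n [:: s]). Qed.

Lemma uses_seq n (F : nat -> starter) a K k d :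
  (a <= k < a + K)%N -> has_step (F k) d -> uses n [seq F k | k <- iota a K] d.
Proof.
move=> kK h; exists (F k), d; split=> //; last by rewrite subrr dvdz0.
rewrite -(mem_iota a K k) in kK; elim: (iota a K) kK => //= b l IH.
by rewrite inE => /orP[/eqP ->|/IH ?]; [left | right].
Qed.

Lemma starters_cons m t s f : is_starter m t s -> starters m t f -> starters m t (s :: f).
Proof. by move=> h1 h2 s' [<-|/h2]. Qed.

Lemma starters_cat m t f1 f2 : starters m t f1 -> starters m t f2 -> starters m t (f1 ++ f2).
Proof. by move=> h1 h2 s /List.in_app_iff[/h1|/h2]. Qed.

Lemma starters_seq m t (F : nat -> starter) a K :
  (forall k, (a <= k < a + K)%N -> is_starter m t (F k)) ->
  starters m t [seq F k | k <- iota a K].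
Proof.
move=> h s; have : {subset iota a K <= iota a K} by [].
move: {1 3}(iota a K) => l; elim: l => //= b l IH sub [<-|].
  by apply: h; rewrite -mem_iota; apply: sub; rewrite mem_head.
by apply: IH => k kl; apply: sub; rewrite inE kl orbT.
Qed.

Lemma weight_cat f1 f2 : weight (f1 ++ f2) = (weight f1 + weight f2)%N.
Proof. by rewrite /weight map_cat sumn_cat. Qed.

Lemma weight_cons s f : weight (s :: f) = (s.1 + weight f)%N.
Proof. by []. Qed.

Lemma weight_seq (F : nat -> starter) a K r : (forall k, (F k).1 = r) ->
  weight [seq F k | k <- iota a K] = (K * r)%N.
Proof.
move=> h; rewrite /weight -map_comp (eq_map (g := fun=> r)) //.
by rewrite -[in RHS](size_iota a K); elim: (iota a K) => //= b l ->.
Qed.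

(** Disjointness of the lengths need not be checked: it follows from the weight
and the covering. *)
Lemma cyclic_system_of_family m t (fam : seq starter) :
  (3 <= m)%N -> ~~ odd m -> (0 < t)%N ->
  starters m t fam -> (weight fam <= ((m * t)./2).-1)%N ->
  (forall x : nat, (0 < x < (m * t)./2)%N -> uses (m * t) fam x) ->
  exists C : {set {set {set 'Z_(m * t)}}},
    cyclic_cycle_system (@complete_minus_I (m * t)) m C.
Proof.
move=> m3 me t0 st wt us.
have nthIn k : (k < size fam)%N -> List.In (nth (0%N, fun=> 0) fam k) fam.
  by elim: fam k {st wt us} => //= s f IH [|k] /= h; [left | right; apply: IH].
have inNth s : List.In s fam -> exists2 k, (k < size fam)%N & nth (0%N, fun=> 0) fam k = s.
  elim: fam {st wt us nthIn} => //= s' f IH [->|/IH[k kf e]]; first by exists 0%N.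
  by exists k.+1.
apply: (@cyclic_system_of_starters m t fam) => //.
  by move=> k kf; apply/st/nthIn.
move=> x hx; have [s [d [/inNth[k kf e] [i hi hd] dv]]] := us x hx.
exists k => //; rewrite e; exists i => //; case: hd => ->; first by left.
by right; rewrite (_ : - d + x%:Z = - (d - x%:Z)) ?rpredN // opprB addrC.
Qed.

Lemma ndvdz_small (r : nat) (d : int) : d <> 0 -> (`|d| < r)%N -> ~~ (r%:Z %| d)%Z.
Proof.
move=> d0 dr; have d1 : (0 < `|d|)%N by lia.
by apply/negP; rewrite dvdzE /= => /(dvdn_leq d1); lia.
Qed.

(** The path 0, x, x - y.  It is a starter when y - x is 2 t times a unit
mod m / 2, so it covers the two lengths x and y; these pairs fill the gaps
left by the long paths. *)
Definition spair (x y : int) : starter :=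
  (2%N, fun i => if i == 0%N then 0 else if i == 1%N then x else x - y).

(** The m-cycle of the multiples of x. *)
Definition ssingle (x : int) : starter := (1%N, fun i => if i == 0%N then 0 else x).

Lemma spairP m t (x u : int) : ~~ odd m -> (0 < t)%N ->
  ~~ ((t * 2)%N%:Z %| x)%Z -> coprimez u (m./2) ->
  is_starter m t (spair x (x + u * (t * 2)%N%:Z)).
Proof.
move=> me t0 nx cu; split=> //; first by rewrite dvdn2.
  move=> i j ij; have [-> ->] : i = 0%N /\ j = 1%N by move: ij => /=; lia.
  by rewrite /= subr0.
by exists (- u); rewrite ?coprimeNz ?divn2 //=; ring.
Qed.

Lemma spair_l x y : has_step (spair x y) x.
Proof. by exists 0%N => //; left; rewrite /step /= subr0. Qed.

Lemma spair_r x y : has_step (spair x y) y.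
Proof. by exists 1%N => //; right; rewrite /step /= ; ring. Qed.

Lemma ssingleP (m t : nat) (u : int) : coprimez u m -> is_starter m t (ssingle (u * t%:Z)).
Proof.
move=> cu; split=> //; first by move=> i j ij; move: ij => /=; lia.
by exists u; rewrite ?muln1 ?divn1.
Qed.

Lemma ssingle_has x : has_step (ssingle x) x.
Proof. by exists 0%N => //; left; rewrite /step /= subr0. Qed.

(** Vertex i lies in the coset g i + t Z, at height x i.  The paths below stay in
very few cosets, so the distinctness of their vertices reduces to that of small
heights. *)
Definition sided (t r : nat) (g x : nat -> int) : starter :=
  (r, fun i => g i + t%:Z * x i).

(** The modulus t r of the definition of a starter splits as d R, where d separates
the cosets and R the heights within a coset. *)
Lemma sidedP (m t d R r : nat) g x (u : int) :
  (d * R = t * r)%N -> (0 < d)%N -> (0 < r)%N -> (r %| m)%N ->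
  g 0%N = 0 -> x 0%N = 0 ->
  (forall i j, (i < j < r)%N -> g i <> g j -> ~~ (d%:Z %| g j - g i)%Z) ->
  (forall i j, (i < j < r)%N -> g i = g j -> ~~ (R%:Z %| x j - x i)%Z) ->
  g r = 0 -> x r = u * R%:Z -> coprimez u (m %/ r)%N%:Z ->
  is_starter m t (sided d r g x).
Proof.
move=> dR d0 r0 rm g0 x0 hg hx gr xr cu; split=> //=; first by rewrite g0 x0 mulr0.
  rewrite -dR PoszM => i j ij; have [gij|gij] := eqVneq (g i) (g j).
    rewrite gij (_ : _ - _ = d%:Z * (x j - x i)); last by ring.
    by rewrite dvdz_mul2l ?hx // eqz_nat -lt0n.
  apply: contra (hg i j ij (elimN eqP gij)) => h.
  have : (d%:Z %| g j + d%:Z * x j - (g i + d%:Z * x i))%Z.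
    by apply: dvdz_trans h; rewrite dvdz_mulr.
  rewrite (_ : _ - _ = g j - g i + d%:Z * (x j - x i)); last by ring.
  by rewrite rpredDr // dvdz_mulr.
by exists u => //; rewrite gr xr -dR PoszM; ring.
Qed.

(** A path inside d Z, for the lengths that are multiples of d. *)
Definition line (d r : nat) (x : nat -> int) : starter := (r, fun i => d%:Z * x i).

Lemma lineP (m t d R r : nat) x (u : int) :
  (d * R = t * r)%N -> (0 < d)%N -> (0 < r)%N -> (r %| m)%N -> x 0%N = 0 ->
  (forall i j, (i < j < r)%N -> ~~ (R%:Z %| x j - x i)%Z) ->
  x r = u * R%:Z -> coprimez u (m %/ r)%N%:Z ->
  is_starter m t (line d r x).
Proof.
move=> dR d0 r0 rm x0 hx xr cu; split=> //=; first by rewrite x0 mulr0.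
  move=> i j ij; rewrite -dR PoszM -mulrBr dvdz_mul2l ?hx //.
  by rewrite eqz_nat -lt0n.
by exists u => //; rewrite xr -dR PoszM; ring.
Qed.

Lemma line_has d r x i l : (i < r)%N ->
  x i.+1 - x i = l \/ x i.+1 - x i = - l -> has_step (line d r x) (d%:Z * l).
Proof.
move=> ir h; exists i => //; rewrite /step /= -mulrBr.
by case: h => ->; [left | right; rewrite mulrN].
Qed.

Lemma sided_has t r g x i c l : (i < r)%N ->
  (g i.+1 - g i = c /\ x i.+1 - x i = l) \/ (g i.+1 - g i = - c /\ x i.+1 - x i = - l) ->
  has_step (sided t r g x) (c + t%:Z * l).
Proof.
move=> ir h; exists i => //.
have -> : step (sided t r g x) i = (g i.+1 - g i) + t%:Z * (x i.+1 - x i).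
  by rewrite /step /sided /=; ring.
by case: h => [] [-> ->]; [left | right; ring].
Qed.

(** * The closed paths of a class of differences *)

Lemma double_or_doubleS (i : nat) : exists a, i = a.*2 \/ i = a.*2.+1.
Proof. by exists i./2; lia. Qed.

Lemma odd_doubleS a : odd a.*2.+1 = true.
Proof. by rewrite /= odd_double. Qed.

Lemma half_doubleS a : (a.*2.+1)./2 = a.
Proof. by rewrite /= uphalf_double. Qed.

Definition halfE := (odd_doubleS, half_doubleS, odd_double, doubleK).

(* The paths are given by cases on the parity of the index and on thresholds.
   After the substitution of 2 a or 2 a + 1 for the index and a case analysis on
   the conditions, everything is linear arithmetic. *)
Ltac parity i :=
  let a := fresh "a" in have [a [? | ?]] := double_or_doubleS i; subst i.

Ltac ifs :=
  repeat (match goal with |- context [if ?b then _ else _] => case: (boolP b) => ? end).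

Ltac unfold_walk i := parity i; rewrite ?halfE /= ?halfE /=.

Ltac at_step i := apply: (@sided_has _ _ _ _ i); first by lia.

(** The zigzag 0, 1, -1, 2, -2, ...: its first r terms are r consecutive
integers, and its steps 1, -2, 3, -4, ... have all absolute values once. *)
Definition zig (i : nat) : int := if odd i then (i./2)%:Z + 1 else - (i./2)%:Z.

Lemma zig_small i j r : (i < j < r)%N -> zig j - zig i <> 0 /\ (`|zig j - zig i| < r)%N.
Proof. by move=> ij; rewrite /zig; unfold_walk i; unfold_walk j; split; lia. Qed.

Lemma zig_step i : zig i.+1 - zig i = if odd i then - i.+1%:Z else i.+1%:Z.
Proof. by rewrite /zig; unfold_walk i; lia. Qed.

(** Differences of the first R terms of the zigzag are smaller than R in absolute
value, and a unit does not change divisibility by R. *)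
Lemma zig_ndvd (R i j : nat) (u : int) : coprimez u R -> (i < j < R)%N ->
  ~~ (R%:Z %| u * (zig j - zig i))%Z.
Proof.
move=> cu ij; have [h1 h2] := zig_small ij.
by rewrite Gauss_dvdzr ?ndvdz_small // coprimez_sym.
Qed.

Lemma class_mod m t (c x : int) : (0 < m)%N -> (t%:Z %| x - c)%Z ->
  exists2 l : nat, (l < m)%N & ((m * t)%N%:Z %| c + t%:Z * l%:Z - x)%Z.
Proof.
move=> m0 /dvdzP[q hq].
have hm : (m%:Z != 0 :> int) by rewrite eqz_nat -lt0n.
exists `|(q %% m%:Z)%Z|%N; first by have := ltz_pmod q (d := m%:Z); have := modz_ge0 q hm; lia.
rewrite gez0_abs ?modz_ge0 //; apply/dvdzP; exists (- (q %/ m%:Z)%Z).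
have {1}-> : x = c + q * t%:Z by rewrite -hq; ring.
by rewrite {2}(divz_eq q m%:Z) PoszM; ring.
Qed.

(** The lengths in the coset c + t Z are the m numbers c + t l, as x only matters
mod m t. *)
Lemma uses_class m t fam (c x : int) : (0 < m)%N -> (t%:Z %| x - c)%Z ->
  (forall l : nat, (l < m)%N -> uses (m * t) fam (c + t%:Z * l%:Z)) ->
  uses (m * t) fam x.
Proof.
by move=> m0 h u; have [l lm d] := class_mod m0 h; apply: uses_mod d _; apply: u.
Qed.

(** The case r = m: the path closes up, and distinct heights in an interval shorter
than m are distinct mod m. *)
Lemma sided_fullP (m t : nat) (g x : nat -> int) : (0 < t)%N -> (0 < m)%N ->
  g 0%N = 0 -> x 0%N = 0 -> g m = 0 -> x m = 0 ->
  (forall i j, (i < j < m)%N -> g i <> g j -> ~~ (t%:Z %| g j - g i)%Z) ->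
  (forall i j, (i < j < m)%N -> g i = g j -> x i <> x j /\ (`|x j - x i| < m)%N) ->
  is_starter m t (sided t m g x).
Proof.
move=> t0 m0 g0 x0 gm xm hg hx.
apply: (@sidedP _ _ _ m _ _ _ 0) => //; last by rewrite divnn m0.
by move=> i j ij gij; have [h1 h2] := hx i j ij gij; apply: ndvdz_small => //; lia.
Qed.

(** A closed path for m = 4 k, alternating between t Z and c + t Z, whose steps are
c + t l for all l < m.  The alternating sum of 0, ..., m - 1, with the value
2 k moved to the end, vanishes: step i has height i below 2 k and i + 1 from
there on, and the closing step has height 2 k. *)
Definition zigzag_class (k t c : nat) : starter :=
  sided t (4 * k) (fun i => if odd i then c%:Z else 0)
    (fun i => if (i < 4 * k)%N then
                (if odd i then (if (i < 2 * k)%N then (i./2)%:Z else (i./2)%:Z + 1)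
                 else - (i./2)%:Z)
              else 0).

Lemma zigzag_classP k t c : (0 < t)%N -> (0 < k)%N -> ~~ (t%:Z %| c%:Z)%Z ->
  is_starter (4 * k) t (zigzag_class k t c).
Proof.
move=> t0 k0 tc; have c0 : (0 < c)%N by case: c tc; rewrite ?dvdz0.
apply: sided_fullP => //=; try by ifs; lia.
- by move=> i j ij; ifs; rewrite ?sub0r ?subr0 ?rpredN.
- by move=> i j ij; unfold_walk i; unfold_walk j; ifs => h; split; lia.
Qed.

Lemma zigzag_class_has k t c l : (l < 4 * k)%N ->
  has_step (zigzag_class k t c) (c%:Z + t%:Z * l%:Z).
Proof.
move=> lm.
have [h | h] := ltnP l (2 * k).
  by at_step l; unfold_walk l; [left | right]; split; ifs; lia.
have [h' | h'] := ltnP l (2 * k).+1.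
  by at_step (4 * k - 1)%N; right; split; ifs; lia.
by at_step l.-1; rewrite (ltn_predK h'); unfold_walk l; [right | left]; split; ifs; lia.
Qed.

(** For m = 4 k + 2 a closed path with steps c + t l, l < m, up to sign, all of
them between t Z and c + t Z, cannot exist: the signed sum of 0, ..., m - 1
would be odd and divisible by m.  This path stops the zigzag two steps early
(l = 4 k and 4 k + 1 are left out) and returns to 0 through the class of c2. *)
Definition cross_class (k t c c2 : nat) : starter :=
  sided t (4 * k + 2)
    (fun i => if (i < 4 * k + 1)%N then (if odd i then c%:Z else 0)
              else if (i < 4 * k + 2)%N then c2%:Z else 0)
    (fun i => if (i < 4 * k)%N then
                (if odd i then (if (i.+1 < 2 * k)%N then (i./2)%:Z else (i./2)%:Z + 1)
                 else - (i./2)%:Z)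
              else if (i < 4 * k + 1)%N then 2
              else if (i < 4 * k + 2)%N then (4 * k + 1)%N%:Z else 0).

Lemma cross_classP k t c c2 : (0 < t)%N -> (0 < k)%N ->
  ~~ (t%:Z %| c%:Z)%Z -> ~~ (t%:Z %| c2%:Z)%Z -> ~~ (t%:Z %| c%:Z - c2%:Z)%Z ->
  is_starter (4 * k + 2) t (cross_class k t c c2).
Proof.
move=> t0 k0 tc tc2 tcc.
have c0 : (0 < c)%N by case: c tc {tcc}; rewrite ?dvdz0.
have c20 : (0 < c2)%N by case: c2 tc2 {tcc}; rewrite ?dvdz0.
have cc : c <> c2 by move=> e; rewrite e subrr dvdz0 in tcc.
have tcc' : ~~ (t%:Z %| c2%:Z - c%:Z)%Z by rewrite -opprB rpredN.
apply: sided_fullP => //=; try by ifs; lia.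
- by move=> i j ij; ifs; rewrite ?sub0r ?subr0 ?rpredN //; lia.
- clear tc tc2 tcc tcc' => i j ij.
  by unfold_walk i; unfold_walk j; ifs => h; try (by case: cc; lia); clear cc; split; lia.
Qed.

Lemma cross_class_has_c k t c c2 l : (0 < k)%N -> (l < 4 * k)%N ->
  has_step (cross_class k t c c2) (c%:Z + t%:Z * l%:Z).
Proof.
move=> k0 lm.
have [h | h] := ltnP l.+2 (2 * k).
  by at_step l; unfold_walk l; [left | right]; split; ifs; lia.
have [h' | h'] := ltnP l.+1 (2 * k).
  by at_step (4 * k - 1)%N; right; split; ifs; lia.
case: l lm h h' => [|l] lm h h'; first by lia.
by at_step l; unfold_walk l; [left | right]; split; ifs; lia.
Qed.

Lemma cross_class_has_c2 k t c c2 l : (0 < k)%N ->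
  l = (4 * k - 1)%N \/ l = (4 * k + 1)%N ->
  has_step (cross_class k t c c2) (c2%:Z + t%:Z * l%:Z).
Proof.
move=> k0 [] ->.
  by at_step (4 * k)%N; left; split; ifs; lia.
by at_step (4 * k + 1)%N; right; split; ifs; lia.
Qed.

(** The zigzag of class c without the two heights that [cross_class] has taken from
its class; it returns to 0 through the class of d, with the heights y - 1
and y.  With y = 4 k + 1 these are the two heights that [cross_class] leaves out of the
class it starts in; with d = 0 they are two multiples of t. *)
Definition return_class (k t c d y : nat) : starter :=
  sided t (4 * k + 2)
    (fun i => if (i < 4 * k + 1)%N then (if odd i then c%:Z else 0)
              else if (i < 4 * k + 2)%N then d%:Z else 0)
    (fun i => if (i < 4 * k - 1)%N then
                (if odd i then (if (i < 2 * k)%N then (i./2)%:Z else (i./2)%:Z + 1)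
                 else - (i./2)%:Z)
              else if (i < 4 * k)%N then (2 * k + 1)%N%:Z
              else if (i < 4 * k + 1)%N then 1 else if (i < 4 * k + 2)%N then y%:Z else 0).

Lemma return_classP k t c d y : (0 < t)%N -> (0 < k)%N ->
  ~~ (t%:Z %| c%:Z)%Z -> (y <= 4 * k + 1)%N ->
  (~~ (t%:Z %| d%:Z)%Z /\ ~~ (t%:Z %| c%:Z - d%:Z)%Z) \/ (d = 0 /\ y = 2 * k)%N ->
  is_starter (4 * k + 2) t (return_class k t c d y).
Proof.
move=> t0 k0 tc yk hd.
have c0 : (0 < c)%N by case: c tc {hd}; rewrite ?dvdz0.
have {hd} hd : [/\ (0 < d)%N, c <> d, ~~ (t%:Z %| d%:Z)%Z,
    ~~ (t%:Z %| c%:Z - d%:Z)%Z & ~~ (t%:Z %| d%:Z - c%:Z)%Z] \/ (d = 0 /\ y = 2 * k)%N.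
  case: hd => [[td tcd] | h]; [left | by right]; split=> //.
  - by case: d td {tcd}; rewrite ?dvdz0.
  - by move=> e; rewrite e subrr dvdz0 in tcd.
  - by rewrite -opprB rpredN.
apply: sided_fullP => //=; try by ifs; lia.
- move=> i j ij; case: hd => [[d0 cd td tcd tdc]|[-> _]].
    by ifs; rewrite ?sub0r ?subr0 ?rpredN //; lia.
  change (Posz 0) with (0 : int).
  by ifs; rewrite ?sub0r ?subr0 ?rpredN //; lia.
- clear tc; move=> i j ij; case: hd => [[d0 cd _ _ _]|[-> ->]].
    by unfold_walk i; unfold_walk j; ifs => h; try (by case: cd; lia); clear cd; split; lia.
  by unfold_walk i; unfold_walk j; ifs => h; split; lia.
Qed.

Lemma return_class_has_c k t c d y l : (0 < k)%N ->
  (l < 4 * k - 1)%N \/ l = (4 * k)%N ->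
  has_step (return_class k t c d y) (c%:Z + t%:Z * l%:Z).
Proof.
move=> k0 lm.
case: lm => [lm | ->]; last first.
  by at_step (4 * k - 2)%N; left; split; ifs; lia.
have [h | h] := ltnP l (2 * k).
  by at_step l; unfold_walk l; [left | right]; split; ifs; lia.
have [h' | h'] := ltnP l (2 * k).+1.
  by at_step (4 * k - 1)%N; right; split; ifs; lia.
case: l lm h h' => [|l] lm h h'; first by lia.
by at_step l; unfold_walk l; [left | right]; split; ifs; lia.
Qed.

Lemma return_class_has_d k t c d y l : (0 < k)%N -> (0 < y)%N -> l = y.-1 \/ l = y ->
  has_step (return_class k t c d y) (d%:Z + t%:Z * l%:Z).
Proof.
move=> k0 y0 [] ->.
  by at_step (4 * k)%N; left; split; ifs; lia.
by at_step (4 * k + 1)%N; right; split; ifs; lia.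
Qed.

(** For z = 2 e + b and m = 4 k + 2 with k = 2 z or 2 z - 1.  The first 2 z
vertices zigzag inside t Z, with steps 2 t a, 0 < a < 2 z; the path then
alternates between t Z and the class of c with the larger heights of this
class, and closes with the step t.  The odd multiples 3 t, ..., (4 z - 3) t and
the small heights of class c that remain come in pairs at distance 2 t. *)
Definition mixed_class (k z b t c : nat) : starter :=
  sided t (4 * k + 2)
    (fun i => if (i < 2 * z)%N then 0 else if (i < 4 * k + 1)%N then
                (if odd i then 0 else - c%:Z) else 0)
    (fun i => if (i < 2 * z)%N then (if odd i then i%:Z + 1 else - i%:Z)
              else if (i < 4 * k)%N then
                (if odd i then z%:Z + (i./2)%:Z + 1
                 else if (i + z < 2 * k + 2 + b)%N then b%:Z + z%:Z - (i./2)%:Z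
                 else b%:Z + z%:Z - (i./2)%:Z - 1)
              else if (i < 4 * k + 1)%N then z%:Z - 2 * k%:Z - 1
              else if (i < 4 * k + 2)%N then 1 else 0).

Lemma mixed_classP k e b t c : (0 < t)%N -> (b <= 1)%N -> (0 < 2 * e + b)%N ->
  (k = 2 * (2 * e + b) \/ k.+1 = 2 * (2 * e + b))%N ->
  ~~ (t%:Z %| c%:Z)%Z -> is_starter (4 * k + 2) t (mixed_class k (2 * e + b) b t c).
Proof.
move=> t0 b1 z0 hk tc; have c0 : (0 < c)%N by case: c tc; rewrite ?dvdz0.
have nc : ~~ (t%:Z %| - c%:Z)%Z by rewrite rpredN.
apply: sided_fullP => //=; try by clear tc nc; ifs; lia.
- by move=> i j ij; ifs; rewrite ?sub0r ?subr0 ?opprK.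
- clear tc nc => i j ij.
  by case: hk => hk; unfold_walk i; unfold_walk j; ifs => h; split; lia.
Qed.

Lemma mixed_class_has_even k e b t c a : (b <= 1)%N -> (0 < 2 * e + b)%N ->
  (k = 2 * (2 * e + b) \/ k.+1 = 2 * (2 * e + b))%N ->
  (0 < a < 2 * (2 * e + b))%N ->
  has_step (mixed_class k (2 * e + b) b t c) (0 + t%:Z * (2 * a)%N%:Z).
Proof.
move=> b1 z0 hk ha; case: a ha => [|a] ha; first by lia.
by at_step a; unfold_walk a; [left | right]; split; ifs; lia.
Qed.

Lemma mixed_class_has_unit k e b t c : (b <= 1)%N -> (0 < 2 * e + b)%N ->
  (k = 2 * (2 * e + b) \/ k.+1 = 2 * (2 * e + b))%N ->
  has_step (mixed_class k (2 * e + b) b t c) (0 + t%:Z * 1).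
Proof.
move=> b1 z0 hk; at_step (4 * k + 1)%N; right; split; ifs; lia.
Qed.

Lemma mixed_class_has_class k e b t c l : (b <= 1)%N -> (0 < 2 * e + b)%N ->
  (k = 2 * (2 * e + b) \/ k.+1 = 2 * (2 * e + b))%N ->
  (2 * (2 * e + b) <= l + b)%N -> (l < 4 * k \/ l = 4 * k /\ b = 0 \/ l = 4 * k + 1)%N ->
  has_step (mixed_class k (2 * e + b) b t c) (c%:Z + t%:Z * l%:Z).
Proof.
move=> b1 z0 hk hl lk.
have [h | h] := ltnP (l + (2 * e + b)) (2 * k + 2).
  have [i hi] : exists i, (i + 1 = l + b)%N by exists (l + b).-1; lia.
  by at_step i; unfold_walk i; [left | right]; split; ifs; lia.
have [h' | h'] := ltnP (l + (2 * e + b)) (2 * k + 3).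
  by at_step (4 * k)%N; left; split; ifs; lia.
have [h2 | h2] := ltnP l (4 * k + 1).
  have [i hi] : exists i, (i + 2 = l + b)%N by exists (l + b).-2; lia.
  by at_step i; unfold_walk i; [left | right]; split; ifs; lia.
by at_step (4 * k - 1)%N; right; split; ifs; lia.
Qed.

(** For t = 4 g the classes below t / 2 other than g pair up as c and 2 g - c.  This
path takes class g, except for two heights at distance 2 t, one odd multiple of
2 g, and t itself. *)
Definition quarter_class (k g : nat) : starter :=
  sided (4 * g) (4 * k + 2)
    (fun i => if (i < 4 * k)%N then (if odd i then g%:Z else 0)
              else if (i < 4 * k + 1)%N then 2 * g%:Z else 0)
    (fun i => if (i < 4 * k - 1)%N then (if odd i then (i./2)%:Z else - (i./2)%:Z)
              else if (i < 4 * k)%N then - (2 * k%:Z)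
              else if (i < 4 * k + 1)%N then - (2 * k%:Z) - 3
              else if (i < 4 * k + 2)%N then 1 else 0).

Lemma quarter_classP k g : (0 < g)%N -> (0 < k)%N ->
  is_starter (4 * k + 2) (4 * g) (quarter_class k g).
Proof.
move=> g0 k0; apply: sided_fullP => //=; try by ifs; lia.
- move=> i j ij; ifs => h; try (by case: h);
    by apply: ndvdz_small; [clear h | ]; lia.
- by move=> i j ij; unfold_walk i; unfold_walk j; ifs => h; split; lia.
Qed.

Lemma quarter_class_has_low k g l : (0 < k)%N -> (l < 4 * k - 2)%N ->
  has_step (quarter_class k g) (g%:Z + (4 * g)%:Z * l%:Z).
Proof.
by move=> k0 hl; at_step l; unfold_walk l; [left | right]; split; ifs; lia.
Qed.

Lemma quarter_class_has_neg k g (l : int) : (0 < k)%N -> l = - 1 \/ l = - 3 ->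
  has_step (quarter_class k g) (g%:Z + (4 * g)%:Z * l).
Proof.
move=> k0 [] ->.
  by at_step (4 * k - 2)%N; left; split; ifs; lia.
by at_step (4 * k - 1)%N; left; split; ifs; lia.
Qed.

Lemma quarter_class_has_half k g : (0 < k)%N ->
  has_step (quarter_class k g) (2 * g%:Z + (4 * g)%:Z * (- (2 * k%:Z) - 4)).
Proof. by move=> k0; at_step (4 * k)%N; right; split; ifs; lia. Qed.

Lemma quarter_class_has_unit k g : (0 < k)%N ->
  has_step (quarter_class k g) (0 + (4 * g)%:Z * 1).
Proof. by move=> k0; at_step (4 * k + 1)%N; right; split; ifs; lia. Qed.

(** A path of m / 2 vertices inside 2 g Z, where t = 4 g.  The zigzag starts with
step 4, since 2 g * 2 = t is a step of [quarter_class]; its last two steps are odd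
multiples of 2 g.  The end is congruent to m t / 2, so the cycle is
invariant under translation by half of the circle. *)
Definition half_turn (k g : nat) : starter :=
  line (2 * g) (2 * k + 1)
    (fun i => if (i < 2 * k)%N then (if odd i then i%:Z + 3 else - i%:Z)
              else if (i < 2 * k + 1)%N then (if odd k then 1 else 8 * k%:Z + 3)
              else 4 * k%:Z + 2).

Lemma half_turnP k g : (0 < g)%N -> (0 < k)%N ->
  is_starter (4 * k + 2) (4 * g) (half_turn k g).
Proof.
move=> g0 k0; apply: (@lineP _ _ _ (4 * k + 2) _ _ 1) => //=; try by ifs; lia.
- by apply/dvdnP; exists 2%N; lia.
- move=> i j ij; have [jk | jk] := ltnP j (2 * k).
    by apply: ndvdz_small; unfold_walk i; unfold_walk j; ifs; lia.
  apply/negP => /dvdzP[q]; unfold_walk i; unfold_walk k; ifs; lia.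
- by rewrite (_ : (4 * k + 2 = 2 * (2 * k + 1))%N) ?mulnK //; lia.
Qed.

Lemma half_turn_has_even k g a : (2 <= a <= 2 * k)%N ->
  has_step (half_turn k g) ((2 * g)%:Z * (2 * a)%N%:Z).
Proof.
move=> ha; have [i hi] : exists i, (i + 2 = a)%N by exists a.-2; lia.
apply: (@line_has _ _ _ i); first by lia.
by unfold_walk i; [left | right]; ifs; lia.
Qed.

Lemma half_turn_has_close k g : (0 < k)%N ->
  has_step (half_turn k g) ((2 * g)%:Z * (1 + 4 * k%:Z)).
Proof.
move=> k0; apply: (@line_has _ _ _ (2 * k)); first by lia.
by case: (boolP (odd k)) => ok; [left | right]; rewrite ?(negbTE ok); ifs; lia.
Qed.

Lemma half_turn_has_turn k g : (0 < k)%N ->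
  has_step (half_turn k g) ((2 * g)%:Z * (if odd k then - (2 * k%:Z) - 1 else 6 * k%:Z + 1)).
Proof.
move=> k0; apply: (@line_has _ _ _ (2 * k - 1)%N); first by lia.
by left; ifs; lia.
Qed.

(** * Paths for the multiples of t and of t/2 *)

(** A path of m / 4 vertices, m = 8 h + 4: the even multiples 2 t a of t, and the
closing step t.  Four copies form the cycle. *)
Definition quarter_turn (h t : nat) : starter :=
  line t (2 * h + 1)
    (fun i => if (i < 2 * h + 1)%N then 2 * zig i else - (2 * h%:Z + 1)).

Lemma quarter_turnP h t : (0 < t)%N -> is_starter (8 * h + 4) t (quarter_turn h t).
Proof.
move=> t0; apply: (@lineP _ _ _ (2 * h + 1) _ _ (- 1)) => //=; try by rewrite /zig; ifs; lia.
- by apply/dvdnP; exists 4%N; lia.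
- move=> i j ij; rewrite (_ : (i < _)%N); last by lia.
  rewrite (_ : (j < _)%N); last by lia.
  by rewrite -mulrBr zig_ndvd // coprimezE coprime2n; lia.
- by rewrite (_ : (8 * h + 4 = 4 * (2 * h + 1))%N) ?mulnK //; lia.
Qed.

Lemma quarter_turn_has_even h t a : (0 < a <= 2 * h)%N ->
  has_step (quarter_turn h t) (t%:Z * (2 * a)%N%:Z).
Proof.
move=> ha; have [i hi] : exists i, (i + 1 = a)%N by exists a.-1; lia.
apply: (@line_has _ _ _ i); first by lia.
by rewrite /zig; unfold_walk i; [left | right]; ifs; lia.
Qed.

Lemma quarter_turn_has_unit h t : has_step (quarter_turn h t) (t%:Z * 1).
Proof.
apply: (@line_has _ _ _ (2 * h)); first by lia.
by rewrite /zig; right; ifs; lia.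
Qed.

(** The odd multiples of d = t / 2, for m = 8 h + 4: up to sign there are m / 2
of them, and two copies of this path form the cycle. *)
Definition odd_half_turn (h d : nat) : starter :=
  line d (4 * h + 2)
    (fun i => if (i < 4 * h + 2)%N then
                (if odd i then (if (i < 2 * h + 1)%N then i%:Z else i%:Z + 2) else - i%:Z)
              else 8 * h%:Z + 4).

Lemma odd_half_turnP h d : (0 < d)%N -> is_starter (8 * h + 4) (2 * d) (odd_half_turn h d).
Proof.
move=> d0; apply: (@lineP _ _ _ (8 * h + 4) _ _ 1) => //=; try by ifs; lia.
- by apply/dvdnP; exists 2%N; lia.
- move=> i j ij; apply: ndvdz_small; unfold_walk i; unfold_walk j; ifs; lia.
- by rewrite (_ : (8 * h + 4 = 2 * (4 * h + 2))%N) ?mulnK //; lia.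
Qed.

Lemma odd_half_turn_has h d l : (l < 4 * h + 2)%N ->
  has_step (odd_half_turn h d) (d%:Z * (2 * l + 1)%N%:Z).
Proof.
move=> hl; have [h1 | h1] := ltnP l (2 * h).
  apply: (@line_has _ _ _ l); first by lia.
  by unfold_walk l; [left | right]; ifs; lia.
have [h2 | h2] := ltnP l (2 * h).+1.
  apply: (@line_has _ _ _ (4 * h + 1)%N); first by lia.
  by left; ifs; lia.
have [i hi] : exists i, (i + 1 = l)%N by exists l.-1; lia.
apply: (@line_has _ _ _ i); first by lia.
by unfold_walk i; [left | right]; ifs; lia.
Qed.

(** For m = 8 j and t = 2 d: the multiples 2 d a of t with 2 <= a < 4 j, and then
the odd multiples l d and (4 j + 2 - l) d of d.  The free odd parameter l is
chosen so that the other odd multiples of d fall into pairs. *)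
Definition even_half_turn (j l d : nat) : starter :=
  line d (4 * j)
    (fun i => if (i < 4 * j - 1)%N then (if odd i then i%:Z + 3 else - i%:Z)
              else if (i < 4 * j)%N then 2 - 4 * j%:Z - l%:Z else - (8 * j%:Z)).

Lemma even_half_turnP j l d : (0 < d)%N -> (0 < j)%N -> odd l ->
  is_starter (8 * j) (2 * d) (even_half_turn j l d).
Proof.
move=> d0 j0 ol; apply: (@lineP _ _ _ (8 * j) _ _ (- 1)) => //=; try by ifs; lia.
- by apply/dvdnP; exists 2%N; lia.
- move=> i i' ij; have [jk | jk] := ltnP i' (4 * j - 1).
    by apply: ndvdz_small; unfold_walk i; unfold_walk i'; ifs; lia.
  by apply/negP => /dvdzP[q]; unfold_walk i; ifs; lia.
- by rewrite (_ : (8 * j = 2 * (4 * j))%N) ?mulnK //; lia.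
Qed.

Lemma even_half_turn_has_even j l d a : (2 <= a < 4 * j)%N ->
  has_step (even_half_turn j l d) (d%:Z * (2 * a)%N%:Z).
Proof.
move=> ha; have [i hi] : exists i, (i + 2 = a)%N by exists a.-2; lia.
apply: (@line_has _ _ _ i); first by lia.
by unfold_walk i; [left | right]; ifs; lia.
Qed.

Lemma even_half_turn_has_turn j l d : (0 < j)%N ->
  has_step (even_half_turn j l d) (d%:Z * l%:Z).
Proof.
move=> j0; apply: (@line_has _ _ _ (4 * j - 2)%N); first by lia.
by right; ifs; lia.
Qed.

Lemma even_half_turn_has_close j l d : (0 < j)%N ->
  has_step (even_half_turn j l d) (d%:Z * (4 * j%:Z + 2 - l%:Z)).
Proof.
move=> j0; apply: (@line_has _ _ _ (4 * j - 1)%N); first by lia.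
by right; ifs; lia.
Qed.

(** * Paths for n = 2 p q *)

Lemma starter1P (m r : nat) (v : nat -> int) (u : int) :
  (0 < r)%N -> (r %| m)%N -> v 0%N = 0 ->
  (forall i j, (i < j < r)%N -> ~~ (r%:Z %| v j - v i)%Z) ->
  v r = u * r%:Z -> coprimez u (m %/ r)%N%:Z -> is_starter m 1 (r, v).
Proof. by move=> r0 rm v0 d e c; split=> //=; rewrite ?mul1n //; exists u. Qed.

Lemma uses_in n s fam x : List.In s fam -> uses n [:: s] x -> uses n fam x.
Proof. by move=> ins [s' [d [[<-|//] hd dv]]]; exists s, d. Qed.

Lemma uses_step n (s : starter) i x (w : int) : (i < s.1)%N ->
  step s i = x + w * n%:Z \/ step s i = - x + w * n%:Z -> uses n [:: s] x.
Proof.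
move=> ir h; case: h => h.
  exists s, (step s i); split; [by left | by exists i => //; left |].
  by apply/dvdzP; exists w; rewrite h; ring.
exists s, (- step s i); split; [by left | by exists i => //; right; rewrite opprK |].
by apply/dvdzP; exists (- w); rewrite h; ring.
Qed.

(** Here t = 1 and n = m = 2 p q with p < q odd and coprime.  Up to sign the
differences are the even numbers 2 e and the odd numbers p q + 2 e with
0 < e <= (p q - 1) / 2 = q P + Q.  The range of e is cut into the blocks
q k < e < q (k + 1) for k < P, half a block for k = P, and the multiples of q. *)
Section TwoFactors.

Variables P Q : nat.
Let p := (2 * P + 1)%N.
Let q := (2 * Q + 1)%N.

(** The even and odd differences with index e. *)
Definition ev (e : int) : int := 2 * e.
Definition od (e : int) : int := (p * q)%N%:Z + 2 * e.

(** All 2 P differences whose index e is a multiple of q, in a path of p vertices: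
the zigzag with steps 2 q a for a <= P; in its second half the steps 2 q (p - a) are
changed by p q into p q + 2 q a, up to sign and mod 2 p q.  The
vertices are distinct mod p because 2 q is a unit and p q vanishes there. *)
Definition p_turn : starter :=
  (p, fun i => if (i < p)%N then
        (2 * q)%N%:Z * zig i + (if (P < i)%N && odd (i - P) then (p * q)%N%:Z else 0)
      else p%:Z).

Lemma p_turnP : coprime p q -> is_starter (p * q * 2) 1 p_turn.
Proof.
move=> cpq; apply: (@starter1P _ _ _ 1) => //=; try by rewrite /zig /p; ifs; lia.
- by rewrite -mulnA dvdn_mulr.
- move=> i j ij; rewrite (_ : (i < p)%N); last by lia.
  rewrite (_ : (j < p)%N); last by lia.
  set A := if _ then _ else _; set B := if _ then _ else _.
  have dA : (p%:Z %| A)%Z by rewrite /A; ifs; rewrite ?dvdz0 // PoszM dvdz_mulr.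
  have dB : (p%:Z %| B)%Z by rewrite /B; ifs; rewrite ?dvdz0 // PoszM dvdz_mulr.
  have c : coprimez (2 * q)%N p.
    by rewrite coprimezE /= coprimeMl coprime2n (coprime_sym q) cpq andbT /p; lia.
  rewrite (_ : _ - _ = (2 * q)%N%:Z * (zig j - zig i) + (A - B)); last by ring.
  by rewrite rpredDr ?zig_ndvd // rpredB.
- by rewrite coprimezE /= coprime1n.
Qed.

Lemma p_turn_ev a : (0 < a <= P)%N -> uses (p * q * 2) [:: p_turn] (ev (q * a)%N).
Proof.
move=> ha; have [i hi] : exists i, (i + 1 = a)%N by exists a.-1; lia.
apply: (@uses_step _ _ i _ 0); first by rewrite /= /p; lia.
rewrite /step /= /ev /p.
have -> : (i.+1 < 2 * P + 1)%N by lia.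
have -> : (i < 2 * P + 1)%N by lia.
have -> : (P < i.+1)%N = false by lia.
have -> : (P < i)%N = false by lia.
rewrite /= !addr0 -mulrBr zig_step; subst a.
by ifs; [right | left]; lia.
Qed.

Lemma p_turn_od a : (0 < a <= P)%N -> uses (p * q * 2) [:: p_turn] (od (q * a)%N).
Proof.
move=> ha; have [i hi] : exists i, (i + a = 2 * P)%N by exists (2 * P - a)%N; lia.
have [b hb] : exists b, (i = P + b)%N by exists (i - P)%N; lia.
have zs := zig_step i.
have : step p_turn i = (2 * q)%N%:Z * (zig i.+1 - zig i) +
   (if odd b then - (p * q)%N%:Z else (p * q)%N%:Z).
  rewrite /step /= /p.
  have -> : (i.+1 < 2 * P + 1)%N by lia.
  have -> : (i < 2 * P + 1)%N by lia.
  have -> : (P < i.+1)%N by lia.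
  have -> : (i.+1 - P = b.+1)%N by lia.
  have -> : (i - P = b)%N by lia.
  have [b0|b0] := posnP b; last first.
    have -> : (P < i)%N by lia.
    by rewrite /=; case: (odd b) => /=; ring.
  have -> : (P < i)%N = false by lia.
  by rewrite b0 /=; ring.
rewrite zs => st.
have lt : (i < p_turn.1)%N by rewrite /= /p; lia.
have hp : p = (i + a + 1)%N by rewrite /p; lia.
move: st; rewrite /od hp; ifs => st.
- by apply: (@uses_step _ _ i _ (-2)) lt _; left; rewrite st; lia.
- by apply: (@uses_step _ _ i _ (-1)) lt _; left; rewrite st; lia.
- by apply: (@uses_step _ _ i _ 1) lt _; right; rewrite st; lia.
- by apply: (@uses_step _ _ i _ 2) lt _; right; rewrite st; lia.
Qed.

Lemma p_turn_close : uses (p * q * 2) [:: p_turn]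
  (if odd P then ev (P%:Z - Q%:Z) else od (P%:Z - Q%:Z)).
Proof.
apply: (@uses_step _ _ (2 * P) _ 0); first by rewrite /= /p; lia.
left; rewrite /step /= /ev /od /p.
rewrite (_ : (2 * P).+1 < _ = false)%N; last by lia.
rewrite (_ : 2 * P < _)%N; last by lia.
rewrite (_ : zig (2 * P) = - P%:Z); last by rewrite /zig; ifs; lia.
rewrite (_ : (2 * P - P = P)%N); last by lia.
have [-> | P0] := posnP P; first by rewrite /q /=; lia.
rewrite (_ : (P < _)%N); last by lia.
by rewrite /q /=; case: (odd P); lia.
Qed.

(** A path of q vertices that is twice the zigzag mod q, so that its vertices are
distinct whatever f is; f serves to move each step to the wanted block. *)
Definition q_turn (f : nat -> int) (u : int) : starter :=
  (q, fun i => if (i < q)%N then 2 * zig i + q%:Z * f i else u * q%:Z).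

Lemma q_turnP (f : nat -> int) (u : int) : f 0%N = 0 -> coprimez u (p * 2)%N ->
  is_starter (p * q * 2) 1 (q_turn f u).
Proof.
move=> f0 cu; apply: (@starter1P _ _ _ u) => //=; try by rewrite /q; lia.
- by rewrite mulnAC dvdn_mull.
- by rewrite f0 /zig /=; ifs; lia.
- move=> i j ij; rewrite (_ : (i < q)%N); last by lia.
  rewrite (_ : (j < q)%N) /=; last by lia.
  rewrite (_ : _ - _ = 2 * (zig j - zig i) + q%:Z * (f j - f i)); last by ring.
  rewrite rpredDr ?zig_ndvd ?dvdz_mulr // coprimezE coprime2n /q; lia.
- by ifs; lia.
- by rewrite mulnAC mulnK // /q addn1.
Qed.

Lemma q_turn_step (f : nat -> int) (u : int) i (d : int) : (i.+1 < q)%N -> f i.+1 - f i = d ->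
  step (q_turn f u) i = (if odd i then - 2 * i.+1%:Z else 2 * i.+1%:Z) + q%:Z * d.
Proof.
move=> iq <-; have := zig_step i; rewrite /step /= iq (ltnW iq) => zs.
rewrite (_ : _ - _ = 2 * (zig i.+1 - zig i) + q%:Z * (f i.+1 - f i)); last by ring.
by rewrite zs; case: (odd i); ring.
Qed.

Lemma q_turn_close (f : nat -> int) (u : int) :
  step (q_turn f u) (2 * Q) = u * q%:Z + 2 * Q%:Z - q%:Z * f (2 * Q)%N.
Proof.
rewrite /step /= /q.
rewrite (_ : (2 * Q).+1 < _ = false)%N; last by lia.
rewrite (_ : 2 * Q < _)%N; last by lia.
rewrite (_ : zig (2 * Q) = - Q%:Z); last by rewrite /zig; ifs; lia.
ring.
Qed.

(** The last half block, k = P, in both parities.  As in [p_turn], the second half of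
the zigzag is turned into odd differences by the term p q; the summand 2 q P on
odd vertices moves the steps to block P.  The closing step is an odd difference
of block 0. *)
Definition half_turn_even : starter :=
  q_turn (fun i => (if odd i then 2 * P%:Z else 0) +
                   (if (Q < i)%N && odd (i - Q) then p%:Z else 0)) (p%:Z - 2).

Lemma half_turn_evenP : is_starter (p * q * 2) 1 half_turn_even.
Proof.
apply: q_turnP => //; rewrite PoszM coprimezMr; apply/andP; split; apply/coprimezP.
  by exists (P%:Z, 1 - P%:Z); rewrite /p /=; lia.
by exists (1, 1 - P%:Z); rewrite /p /=; lia.
Qed.

Lemma half_turn_even_ev a : (0 < a <= Q)%N ->
  uses (p * q * 2) [:: half_turn_even] (ev (q * P + a)%N).
Proof.
move=> ha; have [i hi] : exists i, (i + 1 = a)%N by exists a.-1; lia.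
apply: (@uses_step _ _ i _ 0); first by rewrite /= /q; lia.
rewrite (@q_turn_step _ _ _ (if odd i then - (2 * P%:Z) else 2 * P%:Z)).
- by rewrite /ev -hi; case: (odd i); [right | left]; lia.
- by rewrite /q; lia.
have -> : (Q < i.+1)%N = false by lia.
have -> : (Q < i)%N = false by lia.
by rewrite /=; case: (odd i) => /=; ring.
Qed.

Lemma half_turn_even_od a : (0 < a <= Q)%N ->
  uses (p * q * 2) [:: half_turn_even] (od (q * P + a)%N).
Proof.
move=> ha; have [i hi] : exists i, (i + 1 + a = q)%N by exists (2 * Q - a)%N; rewrite /q; lia.
have [b hb] : exists b, (i = Q + b)%N by exists (i - Q)%N; rewrite /q in hi; lia.
have := @q_turn_step (fun i => (if odd i then 2 * P%:Z else 0) +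
                   (if (Q < i)%N && odd (i - Q) then p%:Z else 0)) (p%:Z - 2) i
  ((if odd i then - (2 * P%:Z) else 2 * P%:Z) + (if odd b then - p%:Z else p%:Z)).
rewrite -/half_turn_even => st.
have {}st : step half_turn_even i = (if odd i then - 2 * i.+1%:Z else 2 * i.+1%:Z) +
   q%:Z * ((if odd i then - (2 * P%:Z) else 2 * P%:Z) + (if odd b then - p%:Z else p%:Z)).
  apply: st; first by lia.
  have -> : (Q < i.+1)%N by lia.
  have -> : (i.+1 - Q = b.+1)%N by lia.
  have -> : (i - Q = b)%N by lia.
  have [b0|b0] := posnP b; last first.
    have -> : (Q < i)%N by lia.
    by rewrite /=; case: (odd i); case: (odd b) => /=; ring.
  have -> : (Q < i)%N = false by lia.
  by rewrite b0 /=; case: (odd i) => /=; ring.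
have lt : (i < half_turn_even.1)%N by rewrite /= -hi; lia.
have hp : p = (2 * P + 1)%N by [].
move: st; rewrite /od -hi; move: hp; move: (p) => p' ->; ifs => st.
- by apply: (@uses_step _ _ i _ (-2)) lt _; left; rewrite st; lia.
- by apply: (@uses_step _ _ i _ (-1)) lt _; left; rewrite st; lia.
- by apply: (@uses_step _ _ i _ 1) lt _; right; rewrite st; lia.
- by apply: (@uses_step _ _ i _ 2) lt _; right; rewrite st; lia.
Qed.

Lemma half_turn_even_close : ~~ odd Q ->
  uses (p * q * 2) [:: half_turn_even] (od (- (Q%:Z + 1))).
Proof.
move=> oQ; apply: (@uses_step _ _ (2 * Q) _ 0); first by rewrite /= /q; lia.
left; rewrite q_turn_close (_ : (2 * Q - Q = Q)%N); last by lia.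
rewrite (negbTE oQ) andbF (_ : odd (2 * Q) = false); last by lia.
by rewrite /od /q; lia.
Qed.

(** For odd Q the closing step of [half_turn_even] would be even.  A jump at the
middle vertex Q makes it odd; this costs one even difference of the last half
block and gains an odd one of block 0. *)
Definition half_turn_odd : starter :=
  q_turn (fun i => (if odd i then 2 * P%:Z else 0) +
                   (if (Q < i)%N then 2 * (P%:Z + 1) else 0) +
                   (if (Q <= i)%N && ~~ odd (i - Q) then p%:Z else 0)) (4 * P%:Z + 1).

Lemma half_turn_oddP : (0 < Q)%N -> is_starter (p * q * 2) 1 half_turn_odd.
Proof.
move=> Q0; apply: q_turnP; first by rewrite /= leqNgt Q0.
by apply/coprimezP; exists (- 1, 1); rewrite /p /=; lia.
Qed.

Lemma half_turn_odd_ev a : (0 < a < Q)%N ->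
  uses (p * q * 2) [:: half_turn_odd] (ev (q * P + a)%N).
Proof.
move=> ha; have [i hi] : exists i, (i + 1 = a)%N by exists a.-1; lia.
apply: (@uses_step _ _ i _ 0); first by rewrite /= /q; lia.
rewrite (@q_turn_step _ _ _ (if odd i then - (2 * P%:Z) else 2 * P%:Z)).
- by rewrite /ev -hi; case: (odd i); [right | left]; lia.
- by rewrite /q; lia.
have -> : (Q < i.+1)%N = false by lia.
have -> : (Q < i)%N = false by lia.
have -> : (Q <= i)%N = false by lia.
have -> : (Q <= i.+1)%N = false by lia.
by rewrite /=; case: (odd i) => /=; ring.
Qed.

Lemma half_turn_odd_step i b : odd Q -> (i = Q + b)%N -> (i.+1 < q)%N ->
  step half_turn_odd i = (if odd i then - 2 * i.+1%:Z else 2 * i.+1%:Z) +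
   q%:Z * ((if odd i then - (2 * P%:Z) else 2 * P%:Z) +
           (if b == 0%N then 2 * (P%:Z + 1) else 0) + (if odd b then p%:Z else - p%:Z)).
Proof.
move=> oQ hb iq; apply: q_turn_step => //.
have -> : (Q < i.+1)%N by lia.
have -> : (Q <= i.+1)%N by lia.
have -> : (Q <= i)%N by lia.
have -> : (i.+1 - Q = b.+1)%N by lia.
have -> : (i - Q = b)%N by lia.
have [b0|b0] := posnP b; last first.
  have -> : (Q < i)%N by lia.
  by rewrite /=; case: (odd i); case: (odd b) => /=; ring.
have -> : (Q < i)%N = false by lia.
by rewrite b0 /=; case: (odd i) => /=; ring.
Qed.

Lemma half_turn_odd_od a : odd Q -> (0 < a < Q)%N ->
  uses (p * q * 2) [:: half_turn_odd] (od (q * P + a)%N).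
Proof.
move=> oQ ha; have [i hi] : exists i, (i + 1 + a = q)%N by exists (2 * Q - a)%N; rewrite /q; lia.
have [b hb] : exists b, (i = Q + b)%N by exists (i - Q)%N; rewrite /q in hi; lia.
have st := @half_turn_odd_step i b oQ hb ltac:(rewrite -hi; lia).
have b0 : (b == 0)%N = false by rewrite /q in hi; lia.
have lt : (i < half_turn_odd.1)%N by rewrite /= -hi; lia.
have hp : p = (2 * P + 1)%N by [].
move: st; rewrite /od b0 -hi; move: hp; move: (p) => p' ->; ifs => st.
- by apply: (@uses_step _ _ i _ (-1)) lt _; left; rewrite st; lia.
- by apply: (@uses_step _ _ i _ (-2)) lt _; left; rewrite st; lia.
- by apply: (@uses_step _ _ i _ 2) lt _; right; rewrite st; lia.
- by apply: (@uses_step _ _ i _ 1) lt _; right; rewrite st; lia.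
Qed.

Lemma half_turn_odd_mid1 : odd Q ->
  uses (p * q * 2) [:: half_turn_odd] (od (q * P + Q)%N).
Proof.
move=> oQ; have [i hi] : exists i, (i + 1 = Q)%N by exists Q.-1; lia.
apply: (@uses_step _ _ i _ 0); first by rewrite /= /q; lia.
left; rewrite (@q_turn_step _ _ _ (2 * P%:Z + p%:Z)).
- have -> : odd i = false by lia.
  by rewrite /od -hi; lia.
- by rewrite /q; lia.
have -> : (Q < i.+1)%N = false by lia.
have -> : (Q < i)%N = false by lia.
have -> : (Q <= i)%N = false by lia.
have -> : (Q <= i.+1)%N by lia.
have -> : odd i = false by lia.
have -> : odd i.+1 by lia.
have -> : (i.+1 - Q = 0)%N by lia.
by rewrite /=; ring.
Qed.

Lemma half_turn_odd_mid2 : odd Q -> uses (p * q * 2) [:: half_turn_odd] (od Q%:Z).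
Proof.
move=> oQ; apply: (@uses_step _ _ Q _ (-1)); first by rewrite /= /q; lia.
left; rewrite (@half_turn_odd_step Q 0) //; [|by lia|by rewrite /q; lia].
by rewrite oQ /= /od /q; lia.
Qed.

Lemma half_turn_odd_close : odd Q ->
  uses (p * q * 2) [:: half_turn_odd] (od (- (Q%:Z + 1))).
Proof.
move=> oQ; apply: (@uses_step _ _ (2 * Q) _ 0); first by rewrite /= /q; lia.
left; rewrite q_turn_close (_ : (2 * Q - Q = Q)%N); last by lia.
rewrite oQ andbF (_ : odd (2 * Q) = false); last by lia.
have -> : (Q < 2 * Q)%N by lia.
by rewrite /od /p /q; lia.
Qed.

(** Block 0 of the even differences; the step at Q - P is replaced by its odd
counterpart, as the even one is the closing step of [p_turn] for odd P.  It
closes with the even difference that [half_turn_odd] leaves out. *)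
Definition block_turn : starter :=
  q_turn (fun i => if (Q <= i + P)%N then p%:Z else 0) (4 * P%:Z + 1).

Lemma block_turnP : (P < Q)%N -> is_starter (p * q * 2) 1 block_turn.
Proof.
move=> PQ; apply: q_turnP; first by rewrite /= add0n leqNgt PQ.
by apply/coprimezP; exists (- 1, 1); rewrite /p /=; lia.
Qed.

Lemma block_turn_ev a : (0 < a <= 2 * Q)%N -> (a + P != Q)%N ->
  uses (p * q * 2) [:: block_turn] (ev a).
Proof.
move=> ha na; have [i hi] : exists i, (i + 1 = a)%N by exists a.-1; lia.
apply: (@uses_step _ _ i _ 0); first by rewrite /= /q; lia.
rewrite (@q_turn_step _ _ _ 0).
- by rewrite /ev -hi; case: (odd i); [right | left]; lia.
- by rewrite /q; lia.
have -> : (Q <= i.+1 + P)%N = (Q <= i + P)%N by lia.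
by rewrite subrr.
Qed.

Lemma block_turn_od a : (0 < a)%N -> (a + P = Q)%N -> odd a = false ->
  uses (p * q * 2) [:: block_turn] (od a).
Proof.
move=> a0 ha ea; have [i hi] : exists i, (i + 1 = a)%N by exists a.-1; lia.
apply: (@uses_step _ _ i _ 1); first by rewrite /= /q; lia.
right; rewrite (@q_turn_step _ _ _ p%:Z).
- have -> : odd i by lia.
  by rewrite /od -hi; lia.
- by rewrite /q; lia.
have -> : (Q <= i.+1 + P)%N by lia.
have -> : (Q <= i + P)%N = false by lia.
by rewrite subr0.
Qed.

Lemma block_turn_close : uses (p * q * 2) [:: block_turn] (ev (q * P + Q)%N).
Proof.
apply: (@uses_step _ _ (2 * Q) _ 0); first by rewrite /= /q; lia.
left; rewrite q_turn_close.
have -> : (Q <= 2 * Q + P)%N by lia.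
by rewrite /ev /p /q; lia.
Qed.

(** A path of 2 q vertices for the even differences of the blocks k and k + 1: two
copies of the zigzag, the first on even and the second on odd numbers, joined
and closed by two consecutive odd differences. *)
Definition block_pair (k : nat) : starter :=
  ((2 * q)%N, fun i =>
     if (i < q)%N then 2 * zig i + 2 * (q%:Z * (if odd i then k%:Z else 0))
     else if (i < 2 * q)%N then
       (p * q)%N%:Z + 2 * q%:Z * k.+1%:Z + 2 - 2 * Q%:Z + 2 * zig (i - q)
         + 2 * (q%:Z * (if odd (i - q) then k.+1%:Z else 0))
     else - (2 * q%:Z)).

Lemma block_pairP k : is_starter (p * q * 2) 1 (block_pair k).
Proof.
apply: (@starter1P _ _ _ (- 1)) => //=; try by rewrite /q; lia.
- by rewrite -mulnA (mulnC q) dvdn_mull.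
- have -> : (0 < q)%N by rewrite /q; lia.
  by rewrite /zig /=; lia.
- move=> i j ij.
  have key i' j' (x : int) : (i' < j' < q)%N ->
      ~~ ((2 * q)%N%:Z %| 2 * (zig j' - zig i') + 2 * (q%:Z * x))%Z.
    move=> ij'; rewrite -mulrDr PoszM dvdz_mul2l // rpredDr ?dvdz_mulr //.
    by rewrite -[zig _ - _]mul1r zig_ndvd // coprimezE /= coprime1n.
  have [jq | qj] := ltnP j q.
    have -> : (i < q)%N by lia.
    rewrite [X in ~~ (_ %| X)%Z](_ : _ = 2 * (zig j - zig i) +
      2 * (q%:Z * ((if odd j then k%:Z else 0) - (if odd i then k%:Z else 0)))); last by ring.
    by apply: key; lia.
  have -> : (j < 2 * q)%N by lia.
  have [iq | qi] := ltnP i q.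
    apply/negP => /dvdzP[w].
    have -> : (p * q)%N%:Z = 1 + 2 * (2 * P * Q + P + Q)%N%:Z by rewrite /p /q; lia.
    rewrite (PoszM 2 q).
    move: (q%:Z * (if odd (j - q) then _ else _)) (q%:Z * (if odd i then _ else _)) => A B.
    have -> : w * (2%:Z * q%:Z) = 2 * (w * q%:Z) by ring.
    rewrite -mulrA; move: (w * q%:Z) (q%:Z * k.+1%:Z) => C D; lia.
  have -> : (i < 2 * q)%N by lia.
  rewrite [X in ~~ (_ %| X)%Z](_ : _ = 2 * (zig (j - q) - zig (i - q)) +
      2 * (q%:Z * ((if odd (j - q) then k.+1%:Z else 0) - (if odd (i - q) then k.+1%:Z else 0))));
    last by ring.
  apply: key; lia.
- by ifs; rewrite ?PoszM; lia.
- by rewrite coprimeNz coprimezE /= coprime1n.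
Qed.

Lemma block_pair_ev1 k a : (0 < a <= 2 * Q)%N ->
  uses (p * q * 2) [:: block_pair k] (ev (q * k + a)%N).
Proof.
move=> ha; have [i hi] : exists i, (i + 1 = a)%N by exists a.-1; lia.
apply: (@uses_step _ _ i _ 0); first by rewrite /= /q; lia.
have := zig_step i; rewrite /step /= /ev.
have -> : (i.+1 < q)%N by rewrite /q; lia.
have -> : (i < q)%N by rewrite /q; lia.
by rewrite -hi /=; case: (odd i) => /= zs; [right | left]; lia.
Qed.

Lemma block_pair_ev2 k a : (0 < a <= 2 * Q)%N ->
  uses (p * q * 2) [:: block_pair k] (ev (q * k.+1 + a)%N).
Proof.
move=> ha; have [i hi] : exists i, (i + 1 = a)%N by exists a.-1; lia.
apply: (@uses_step _ _ (q + i) _ 0); first by rewrite /= /q; lia.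
have := zig_step i; rewrite /step /= /ev.
have -> : ((q + i).+1 < q)%N = false by lia.
have -> : ((q + i) < q)%N = false by lia.
have -> : ((q + i).+1 < 2 * q)%N by rewrite /q; lia.
have -> : (q + i < 2 * q)%N by rewrite /q; lia.
have -> : ((q + i).+1 - q = i.+1)%N by lia.
have -> : ((q + i) - q = i)%N by lia.
by rewrite -hi /=; case: (odd i) => /= zs; [right | left]; lia.
Qed.

Lemma block_pair_od1 k : uses (p * q * 2) [:: block_pair k] (od (q * k.+1 + 1)%N).
Proof.
apply: (@uses_step _ _ (2 * Q) _ 0); first by rewrite /= /q; lia.
left; rewrite /step /= /od.
rewrite (_ : (2 * Q).+1 < q = false)%N; last by rewrite /q; lia.
rewrite (_ : 2 * Q < q)%N; last by rewrite /q; lia.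
rewrite (_ : (2 * Q).+1 < 2 * q)%N; last by rewrite /q; lia.
rewrite (_ : zig (2 * Q) = - Q%:Z); last by rewrite /zig; ifs; lia.
rewrite (_ : (2 * Q).+1 - q = 0)%N; last by rewrite /q; lia.
rewrite (_ : odd (2 * Q) = false); last by lia.
by rewrite /zig /=; lia.
Qed.

Lemma block_pair_od2 k : uses (p * q * 2) [:: block_pair k] (od (q * k.+1 + 2)%N).
Proof.
apply: (@uses_step _ _ (q + 2 * Q) _ 0); first by rewrite /= /q; lia.
right; rewrite /step /= /od.
rewrite (_ : (q + 2 * Q).+1 < q = false)%N; last by rewrite /q; lia.
rewrite (_ : q + 2 * Q < q = false)%N; last by rewrite /q; lia.
rewrite (_ : (q + 2 * Q).+1 < 2 * q = false)%N; last by rewrite /q; lia.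
rewrite (_ : q + 2 * Q < 2 * q)%N; last by rewrite /q; lia.
rewrite (_ : q + 2 * Q - q = 2 * Q)%N; last by rewrite /q; lia.
rewrite (_ : zig (2 * Q) = - Q%:Z); last by rewrite /zig; ifs; lia.
rewrite (_ : odd (2 * Q) = false); last by lia.
by rewrite /q; lia.
Qed.

End TwoFactors.

(** * Systems for m = 4 and m = 0 mod 8 *)

(** Up to sign, the residue of a difference mod t is 0, or less than t / 2, or equal
to t / 2. *)
Lemma cover_by_classes m t fam : (0 < t)%N -> (0 < m)%N -> ~~ odd m ->
  (forall c l : nat, (0 < c)%N -> (2 * c < t)%N -> (l < m)%N ->
     uses (m * t) fam (c%:Z + t%:Z * l%:Z)) ->
  (forall a : nat, (0 < a < m./2)%N -> uses (m * t) fam (t%:Z * a%:Z)) ->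
  (forall d a : nat, t = (2 * d)%N -> (a < m./2)%N ->
     uses (m * t) fam (d%:Z * (2 * a + 1)%N%:Z)) ->
  forall x : nat, (0 < x < (m * t)./2)%N -> uses (m * t) fam x.
Proof.
move=> t0 m0 me Hc H0 Hd x hx.
have e2 : ((m * t)./2 = m./2 * t)%N.
  by rewrite -{1}(even_halfK me) -muln2 mulnAC muln2 doubleK.
have [E lt] := (divn_eq x t, ltn_pmod x t0).
have at2 : (x %/ t < m./2)%N by rewrite ltn_divLR // -e2; case/andP: hx.
set a := (x %/ t)%N in E at2; set c := (x %% t)%N in E lt.
have [c0 | c0] := posnP c.
  have -> : x%:Z = t%:Z * a%:Z by rewrite E c0 addn0 PoszM mulrC.
  by apply: H0; rewrite at2 andbT; case: a E {at2} => // ; rewrite c0; lia.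
have [h | h | h] := ltngtP (2 * c)%N t.
- apply: (@uses_class _ _ _ c) => //; last by move=> l; apply: Hc.
  by apply/dvdzP; exists a%:Z; rewrite E PoszD PoszM; ring.
- apply: usesN; apply: (@uses_class _ _ _ (t - c)%N) => //.
    by apply/dvdzP; exists (- a%:Z - 1); rewrite E -subzn ?(ltnW lt) // PoszD PoszM; ring.
  by move=> l lm; apply: Hc => //; lia.
have -> : x%:Z = c%:Z * (2 * a + 1)%N%:Z by rewrite E -h; lia.
exact: Hd.
Qed.

(** Neighbours in a progression with difference 2 t are lengths that a starter with
two edges can cover, so such a progression is covered from a on by pairs. *)
Definition pair_run (t : nat) (e0 : int) (a K : nat) : seq starter :=
  [seq spair (e0 + (a + 2 * i)%N%:Z * (t * 2)%N%:Z)
             (e0 + (a + 2 * i)%N%:Z * (t * 2)%N%:Z + 1 * (t * 2)%N%:Z) | i <- iota 0 K].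

Lemma pair_runP m t e0 a K : ~~ odd m -> (0 < t)%N -> ~~ ((t * 2)%N%:Z %| e0)%Z -> starters m t (pair_run t e0 a K).
Proof.
move=> me t0 h; apply: starters_seq => k _; apply: spairP => //; last by rewrite coprimezE /= coprime1n.
by rewrite rpredDr // dvdz_mull.
Qed.

Lemma uses_run m t (e0 : int) a K (l : nat) x :
  (a <= l < a + 2 * K)%N -> x = e0 + l%:Z * (t * 2)%N%:Z ->
  uses (m * t) (pair_run t e0 a K) x.
Proof.
move=> hl ->; have [i [iK hi]] : exists i, (i < K)%N /\ (l = a + 2 * i \/ l = a + 2 * i + 1)%N.
  by exists ((l - a)./2); lia.
apply: (@uses_seq _ _ _ _ i); first by [].
case: hi => ->; first exact: spair_l.
have -> : e0 + (a + 2 * i + 1)%N%:Z * (t * 2)%N%:Z =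
  e0 + (a + 2 * i)%N%:Z * (t * 2)%N%:Z + 1 * (t * 2)%N%:Z by lia.
exact: spair_r.
Qed.

Lemma pair_run_weight t e0 a K : weight (pair_run t e0 a K) = (2 * K)%N.
Proof. by rewrite /pair_run (@weight_seq _ _ _ 2) // mulnC. Qed.

(** The zigzags take all classes but 0 and t / 2.  The multiples of t are covered
by the even multiples and 1 in [quarter_turn] and by the pairs 3, 5; 7, 9; and
so on. *)
Definition family_4_mod_8 (h t : nat) : seq starter :=
  [seq zigzag_class (2 * h + 1) t c | c <- iota 1 (t.-1)./2] ++
  quarter_turn h t :: pair_run t t 1 h ++
  (if odd t then [::] else [:: odd_half_turn h t./2]).

Lemma cyclic_system_4_mod_8 h t : (0 < t)%N ->
  exists C : {set {set {set 'Z_((8 * h + 4) * t)}}},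
    cyclic_cycle_system (@complete_minus_I ((8 * h + 4) * t)) (8 * h + 4) C.
Proof.
move=> t0; have me : ~~ odd (8 * h + 4) by lia.
have m4 : (8 * h + 4 = 4 * (2 * h + 1))%N by lia.
apply: (@cyclic_system_of_family _ _ (family_4_mod_8 h t)) => //; first by lia.
- apply: starters_cat.
    apply: starters_seq => c hc; rewrite {1}m4; apply: zigzag_classP => //; first by lia.
    by apply: ndvdz_small; lia.
  apply: starters_cons; first exact: quarter_turnP.
  apply: starters_cat; first by apply: pair_runP => //; apply: ndvdz_small; lia.
  case: (boolP (odd t)) => // ot; apply: starters_cons => //.
  rewrite {1}(_ : t = 2 * t./2)%N; last by lia.
  by apply: odd_half_turnP; lia.
- rewrite /family_4_mod_8 weight_cat weight_cons weight_cat pair_run_weight.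
  rewrite (@weight_seq _ _ _ (4 * (2 * h + 1))) //=.
  case: (boolP (odd t)) => ot.
    have [s hs] : exists s, t = (2 * s + 1)%N by exists t./2; lia.
    rewrite (_ : (t.-1)./2 = s)%N; last by lia.
    by rewrite /weight /=; lia.
  have [s hs] : exists s, t = (2 * s + 2)%N by exists (t./2).-1; lia.
  rewrite (_ : (t.-1)./2 = s)%N; last by lia.
  by rewrite /weight /=; lia.
- apply: cover_by_classes => //; first by lia.
  + move=> c l c0 ct lm; apply: uses_catl; apply: (@uses_seq _ _ _ _ c); first by lia.
    by apply: zigzag_class_has; lia.
  + move=> a ha; apply: uses_catr; have [b [ab|ab]] := double_or_doubleS a.
      by apply: uses_head; rewrite ab -mul2n; apply: quarter_turn_has_even; lia.
    case: b ab => [|b] ab; first by apply: uses_head; rewrite ab; apply: quarter_turn_has_unit.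
    by apply: uses_cons; apply: uses_catl; apply: (@uses_run _ _ _ _ _ b.+1); lia.
  move=> d a et am; apply: uses_catr; apply: uses_cons; apply: uses_catr.
  rewrite et (_ : odd (2 * d) = false); last by lia.
  rewrite (_ : (2 * d)./2 = d); last by lia.
  by apply: uses_head; apply: odd_half_turn_has; lia.
Qed.

(** Now m / 4 is even and class t / 2 is coupled with class 0: [even_half_turn]
takes two odd multiples l d and (4 j + 2 - l) d of d = t / 2.  The other odd
multiples are split by their residue mod 4, and the progression with two missing
terms is cut there into runs of even length; l = 1 or 3 makes this possible
according to the parity of j. *)
Definition family_0_mod_8 (j d : nat) : seq starter :=
  [seq zigzag_class (2 * j) (2 * d) c | c <- iota 1 d.-1] ++
  ssingle (1 * (2 * d)%N%:Z) :: even_half_turn j (if odd j then 1 else 3) d ::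
  (if odd j then
     pair_run (2 * d) d 1 j./2 ++ pair_run (2 * d) d j.+1 j./2
       ++ pair_run (2 * d) (3 * d)%N 0 j
   else
     pair_run (2 * d) (3 * d)%N 1 (j./2).-1 ++ pair_run (2 * d) (3 * d)%N j j./2
       ++ pair_run (2 * d) d 0 j).

Lemma cyclic_system_0_mod_8 j d : (0 < j)%N -> (0 < d)%N ->
  exists C : {set {set {set 'Z_((8 * j) * (2 * d))}}},
    cyclic_cycle_system (@complete_minus_I ((8 * j) * (2 * d))) (8 * j) C.
Proof.
move=> j0 d0; have me : ~~ odd (8 * j) by lia.
have m4 : (8 * j = 4 * (2 * j))%N by lia.
have nd1 : ~~ ((2 * d * 2)%N%:Z %| d%:Z)%Z by apply: ndvdz_small; lia.
have nd3 : ~~ ((2 * d * 2)%N%:Z %| (3 * d)%N%:Z)%Z by apply: ndvdz_small; lia.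
apply: (@cyclic_system_of_family _ _ (family_0_mod_8 j d)) => //; try by clear nd1 nd3; lia.
- apply: starters_cat.
    apply: starters_seq => c hc; rewrite {1}m4; clear nd1 nd3.
    by apply: zigzag_classP; [| |apply: ndvdz_small]; lia.
  apply: starters_cons; first by apply: ssingleP; rewrite coprimezE /= coprime1n.
  apply: starters_cons; first by apply: even_half_turnP => //; case: ifP.
  have t0 : (0 < 2 * d)%N by clear nd1 nd3; lia.
  by case: ifP => _; do 2 ?apply: starters_cat; apply: pair_runP.
- clear nd1 nd3; rewrite /family_0_mod_8 weight_cat 2!weight_cons (@weight_seq _ _ _ (4 * (2 * j))) //=.
  case: d d0 => // d _; case: (boolP (odd j)) => oj; rewrite !weight_cat !pair_run_weight /=; lia.
- clear nd1 nd3; apply: cover_by_classes => //; try lia.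
  + move=> c l c0 ct lm; apply: uses_catl; apply: (@uses_seq _ _ _ _ c); first by lia.
    by apply: zigzag_class_has; lia.
  + move=> a ha; apply: uses_catr; have [a1 | a1] := ltnP 1 a.
      apply: uses_cons; apply: uses_head.
      rewrite (_ : (2 * d)%N%:Z * a%:Z = d%:Z * (2 * a)%N%:Z); last by lia.
      by apply: even_half_turn_has_even; lia.
    rewrite (_ : (2 * d)%N%:Z * a%:Z = 1 * (2 * d)%N%:Z); last by nia.
    exact/uses_head/ssingle_has.
  move=> d' a e am; have {e} -> : d' = d by lia.
  apply: uses_catr; apply: uses_cons.
  case: (boolP (odd j)) => oj.
    have [b [ab|ab]] := double_or_doubleS a; last first.
      apply: uses_cons; apply: uses_catr; apply: uses_catr; apply: (@uses_run _ _ _ _ _ b); lia.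
    have [b0 | b0] := posnP b.
      apply: uses_head; rewrite (_ : (2 * a + 1)%N = 1%N); last by lia.
      exact: even_half_turn_has_turn.
    have [bj | bj | bj] := ltngtP b j.
    * by apply: uses_cons; apply: uses_catl; apply: (@uses_run _ _ _ _ _ b); lia.
    * apply: uses_cons; apply: uses_catr; apply: uses_catl; apply: (@uses_run _ _ _ _ _ b); lia.
    * apply: uses_head.
      rewrite (_ : (2 * a + 1)%N%:Z = 4 * j%:Z + 2 - 1%N%:Z); last by lia.
      exact: even_half_turn_has_close.
  have [b [ab|ab]] := double_or_doubleS a.
    apply: uses_cons; apply: uses_catr; apply: uses_catr; apply: (@uses_run _ _ _ _ _ b); lia.
  have [b0 | b0] := posnP b.
    apply: uses_head; rewrite (_ : (2 * a + 1)%N = 3%N); last by lia.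
    exact: even_half_turn_has_turn.
  have [bj | bj | bj] := ltngtP b.+1 j.
  + by apply: uses_cons; apply: uses_catl; apply: (@uses_run _ _ _ _ _ b); lia.
  + apply: uses_cons; apply: uses_catr; apply: uses_catl; apply: (@uses_run _ _ _ _ _ b); lia.
  apply: uses_head.
  rewrite (_ : (2 * a + 1)%N%:Z = 4 * j%:Z + 2 - 3%N%:Z); last by lia.
  exact: even_half_turn_has_close.
Qed.

(** * Systems for m = 2 mod 4 *)

(** Two classes exchange two steps each, which repairs the parity in both. *)
Definition class_pair (k t c c2 : nat) : seq starter :=
  [:: cross_class k t c c2; return_class k t c2 c (4 * k + 1)].

Lemma class_pairP k t c c2 : (0 < t)%N -> (0 < k)%N ->
  (0 < c)%N -> (2 * c < t)%N -> (0 < c2)%N -> (2 * c2 < t)%N -> c <> c2 ->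
  starters (4 * k + 2) t (class_pair k t c c2).
Proof.
move=> t0 k0 c0 ct c20 c2t cc.
have h1 : ~~ (t%:Z %| c%:Z)%Z by apply: ndvdz_small; lia.
have h2 : ~~ (t%:Z %| c2%:Z)%Z by clear h1; apply: ndvdz_small; lia.
have h3 : ~~ (t%:Z %| c%:Z - c2%:Z)%Z by clear h1 h2; apply: ndvdz_small; lia.
apply: starters_cons; first exact: cross_classP.
apply: starters_cons => //; apply: return_classP => //.
by left; split; rewrite // -opprB rpredN.
Qed.

Lemma class_pair_uses_l k t c c2 l n : (0 < k)%N -> (l < 4 * k + 2)%N ->
  uses n (class_pair k t c c2) (c%:Z + t%:Z * l%:Z).
Proof.
move=> k0 lk; have [h | h] := ltnP l (4 * k); first exact/uses_head/cross_class_has_c.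
by apply/uses_cons/uses_head/return_class_has_d; lia.
Qed.

Lemma class_pair_uses_r k t c c2 l n : (0 < k)%N -> (l < 4 * k + 2)%N ->
  uses n (class_pair k t c c2) (c2%:Z + t%:Z * l%:Z).
Proof.
move=> k0 lk.
have [h | h] : (l = 4 * k - 1 \/ l = 4 * k + 1)%N \/ ((l < 4 * k - 1)%N \/ l = (4 * k)%N) by lia.
  exact/uses_head/cross_class_has_c2.
exact/uses_cons/uses_head/return_class_has_c.
Qed.

Definition class_pairs (k t K : nat) (c c2 : nat -> nat) : seq starter :=
  [seq cross_class k t (c i) (c2 i) | i <- iota 0 K] ++
  [seq return_class k t (c2 i) (c i) (4 * k + 1) | i <- iota 0 K].

Lemma class_pairsP k t K c c2 : (0 < t)%N -> (0 < k)%N ->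
  (forall i, (i < K)%N -> [/\ (0 < c i)%N, (2 * c i < t)%N, (0 < c2 i)%N,
      (2 * c2 i < t)%N & c i <> c2 i]) ->
  starters (4 * k + 2) t (class_pairs k t K c c2).
Proof.
move=> t0 k0 h.
have S i : (i < K)%N -> starters (4 * k + 2) t (class_pair k t (c i) (c2 i)).
  by case/h => *; apply: class_pairP.
by apply: starters_cat; apply: starters_seq => i /= /S s; apply: s; [left | right; left].
Qed.

Lemma class_pairs_uses n k t K c c2 i x : (i < K)%N ->
  uses n (class_pair k t (c i) (c2 i)) x -> uses n (class_pairs k t K c c2) x.
Proof.
move=> iK [s [d [[|[|//]] <- hd dv]]].
  apply: uses_catl; apply: uses_mod dv _.
  by apply: (@uses_seq _ (fun i => cross_class k t (c i) (c2 i)) 0 K i).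
apply: uses_catr; apply: uses_mod dv _.
by apply: (@uses_seq _ (fun i => return_class k t (c2 i) (c i) (4 * k + 1)) 0 K i).
Qed.

Lemma class_pairs_weight k t K c c2 :
  weight (class_pairs k t K c c2) = (K * (8 * k + 4))%N.
Proof. by rewrite weight_cat !(@weight_seq _ _ _ (4 * k + 2)) //; lia. Qed.

(** The class of 1 and, with at most two exceptions, the multiples of t.  For
b = 1 the number of small even heights is odd; height 4 k, which the path leaves
out, is congruent to -2 and joins them. *)
Definition mixed_family (k e b t : nat) : seq starter :=
  mixed_class k (2 * e + b) b t 1 ::
  pair_run t (1 - (2 * b)%N%:Z * t%:Z) 0 (e + b) ++ pair_run t (1 + t)%N 0 e ++
  pair_run t t 1 (2 * e + b).-1.

Lemma mixed_familyP k e b t : (3 <= t)%N -> (b <= 1)%N -> (0 < 2 * e + b)%N ->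
  (k = 2 * (2 * e + b) \/ k.+1 = 2 * (2 * e + b))%N ->
  starters (4 * k + 2) t (mixed_family k e b t).
Proof.
move=> t3 b1 z0 hk.
have me : ~~ odd (4 * k + 2) by lia.
have t0 : (0 < t)%N by lia.
have nt : ~~ (t%:Z %| 1)%Z by apply: ndvdz_small; lia.
have nt2 (x : int) : ~~ ((t * 2)%N%:Z %| 1 + x * t%:Z)%Z.
  apply: contra nt => h; have -> : 1 = 1 + x * t%:Z - x * t%:Z :> int by ring.
  by apply: rpredB; [apply: dvdz_trans h; rewrite PoszM dvdz_mulr | rewrite dvdz_mull].
apply: starters_cons; first exact: mixed_classP.
apply: starters_cat; first by apply: pair_runP => //; rewrite -mulNr nt2.
apply: starters_cat; first by apply: pair_runP => //; rewrite PoszD -[X in _ + X]mul1r nt2.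
by apply: pair_runP => //; clear nt nt2; apply: ndvdz_small; lia.
Qed.

Lemma mixed_family_weight k e b t :
  (0 < 2 * e + b)%N -> weight (mixed_family k e b t) = (4 * k + 4 * (2 * e + b))%N.
Proof.
by move=> z0; rewrite weight_cons !weight_cat !pair_run_weight /=; lia.
Qed.

Lemma mixed_family_uses_class k e b t l : (3 <= t)%N -> (b <= 1)%N -> (0 < 2 * e + b)%N ->
  (k = 2 * (2 * e + b) \/ k.+1 = 2 * (2 * e + b))%N -> (l < 4 * k + 2)%N ->
  uses ((4 * k + 2) * t) (mixed_family k e b t) (1%N%:Z + t%:Z * l%:Z).
Proof.
move=> t3 b1 z0 hk lk.
have [h | h] := ltnP (l + b) (2 * (2 * e + b)).
  apply: uses_cons; have [a [ea | ea]] := double_or_doubleS l.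
    by apply: uses_catl; apply: (@uses_run _ _ _ _ _ (a + b)%N); lia.
  by apply: uses_catr; apply: uses_catl; apply: (@uses_run _ _ _ _ _ a); lia.
have [h1 | h1] : (b = 1 /\ l = 4 * k)%N \/
    (l < 4 * k \/ l = 4 * k /\ b = 0 \/ l = 4 * k + 1)%N by lia.
  case: h1 => -> ->; apply: uses_cons; apply: uses_catl.
  apply: (@uses_mod _ _ (1 - (2 * 1)%N%:Z * t%:Z)); last by apply: (@uses_run _ _ _ _ _ 0); lia.
  by apply/dvdzP; exists (- 1); lia.
exact/uses_head/mixed_class_has_class.
Qed.

Lemma mixed_family_uses_mul k e b t a : (b <= 1)%N -> (0 < 2 * e + b)%N ->
  (k = 2 * (2 * e + b) \/ k.+1 = 2 * (2 * e + b))%N ->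
  (0 < a < 4 * (2 * e + b) - 1)%N ->
  uses ((4 * k + 2) * t) (mixed_family k e b t) (t%:Z * a%:Z).
Proof.
move=> b1 z0 hk ha; have [l [el | el]] := double_or_doubleS a.
  apply: uses_head; rewrite -[t%:Z * _]add0r el -mul2n.
  by apply: mixed_class_has_even => //; lia.
have [l0 | l0] := posnP l.
  apply: uses_head; rewrite -[t%:Z * _]add0r el l0.
  exact: mixed_class_has_unit.
by apply: uses_cons; apply: uses_catr; apply: uses_catr; apply: (@uses_run _ _ _ _ _ l); lia.
Qed.

(** For k = 2 z - 1 the mixed family takes all multiples of t.  An even number of
classes 2, ..., 2 T + 1 remains. *)
Definition family_6_mod_8 (k e b T : nat) : seq starter :=
  mixed_family k e b (4 * T + 3) ++
  class_pairs k (4 * T + 3) T (fun i => (2 * i + 2)%N) (fun i => (2 * i + 3)%N).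

Lemma cyclic_system_6_mod_8 e b T : (b <= 1)%N -> (0 < 2 * e + b)%N ->
  let k := (2 * (2 * e + b)).-1 in
  exists C : {set {set {set 'Z_((4 * k + 2) * (4 * T + 3))}}},
    cyclic_cycle_system (@complete_minus_I ((4 * k + 2) * (4 * T + 3))) (4 * k + 2) C.
Proof.
move=> b1 z0 k; have hk : k.+1 = (2 * (2 * e + b))%N by rewrite /k; lia.
move: hk; move: (k) => {}k hk.
have me : ~~ odd (4 * k + 2) by lia.
apply: (@cyclic_system_of_family _ _ (family_6_mod_8 k e b T)) => //; try lia.
- apply: starters_cat; first by apply: mixed_familyP => //; [lia | right].
  by apply: class_pairsP => //; [lia | lia | move=> i iT; split; lia].
- rewrite weight_cat class_pairs_weight mixed_family_weight //.
  rewrite (_ : ((4 * k + 2) * (4 * T + 3))./2 = (2 * k + 1) * (4 * T + 3))%N; last by lia.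
  lia.
apply: cover_by_classes => //; try lia.
- move=> c l c0 ct lk; have [c1 | c1] := ltnP 1 c.
    apply: uses_catr; have [i [ei | ei]] := double_or_doubleS c.
      apply: (@class_pairs_uses _ _ _ _ _ _ i.-1); first by lia.
      rewrite (_ : c = (2 * i.-1 + 2)%N); last by lia.
      by apply: class_pair_uses_l; lia.
    apply: (@class_pairs_uses _ _ _ _ _ _ i.-1); first by lia.
    rewrite (_ : c = (2 * i.-1 + 3)%N); last by lia.
    by apply: class_pair_uses_r; lia.
  have -> : c = 1%N by lia.
  by apply: uses_catl; apply: mixed_family_uses_class => //; [lia | right].
- by move=> a ha; apply: uses_catl; apply: mixed_family_uses_mul => //; [right | lia].
Qed.

(** For k = 2 z the mixed family leaves the multiples 2 k - 1 and 2 k of t.  The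
return path of class 2 takes them and leaves in turn two elements of its
class, at distance 2 t. *)
Definition family_2_mod_8 (k e b T : nat) : seq starter :=
  mixed_family k e b (4 * T + 5) ++
  return_class k (4 * T + 5) 2 0 (2 * k) ::
  pair_run (4 * T + 5) (2 + (4 * T + 5) * (4 * k - 1))%N 0 1 ++
  class_pairs k (4 * T + 5) T (fun i => (2 * i + 3)%N) (fun i => (2 * i + 4)%N).

Lemma cyclic_system_2_mod_8 e b T : (b <= 1)%N -> (0 < 2 * e + b)%N ->
  let k := (2 * (2 * e + b))%N in
  exists C : {set {set {set 'Z_((4 * k + 2) * (4 * T + 5))}}},
    cyclic_cycle_system (@complete_minus_I ((4 * k + 2) * (4 * T + 5))) (4 * k + 2) C.
Proof.
move=> b1 z0 k; have hk : k = (2 * (2 * e + b))%N by [].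
move: hk; move: (k) => {}k hk.
have me : ~~ odd (4 * k + 2) by lia.
apply: (@cyclic_system_of_family _ _ (family_2_mod_8 k e b T)) => //; try lia.
- apply: starters_cat; first by apply: mixed_familyP => //; [lia | left].
  have n2 : ~~ ((4 * T + 5)%N%:Z %| 2%N%:Z)%Z by apply: ndvdz_small; lia.
  apply: starters_cons.
    by apply: return_classP => //; [lia | lia | lia | right].
  apply: starters_cat.
    apply: pair_runP => //; first by lia.
    apply: contra n2 => h.
    have -> : 2%N%:Z = (2 + (4 * T + 5) * (4 * k - 1))%N%:Z
      - ((4 * T + 5) * (4 * k - 1))%N%:Z by rewrite PoszD addrK.
    by apply: rpredB; [apply: dvdz_trans h|]; rewrite PoszM dvdz_mulr.
  by clear n2; apply: class_pairsP => //; [lia | lia | move=> i iT; split; lia].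
- rewrite weight_cat weight_cons weight_cat class_pairs_weight pair_run_weight mixed_family_weight //=.
  rewrite (_ : ((4 * k + 2) * (4 * T + 5))./2 = (2 * k + 1) * (4 * T + 5))%N; last by lia.
  lia.
apply: cover_by_classes => //; try lia.
- move=> c l c0 ct lk; have [c2 | c2] := ltnP 2 c.
    apply: uses_catr; apply: uses_cons; apply: uses_catr.
    have [i [ei | ei]] := double_or_doubleS c.
      apply: (@class_pairs_uses _ _ _ _ _ _ i.-2); first by lia.
      rewrite (_ : c = (2 * i.-2 + 4)%N); last by lia.
      by apply: class_pair_uses_r; lia.
    apply: (@class_pairs_uses _ _ _ _ _ _ i.-1); first by lia.
    rewrite (_ : c = (2 * i.-1 + 3)%N); last by lia.
    by apply: class_pair_uses_l; lia.
  have [c1 | c1] := ltnP 1 c; last first.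
    have -> : c = 1%N by lia.
    by apply: uses_catl; apply: mixed_family_uses_class => //; [lia | left].
  have -> : c = 2%N by lia.
  apply: uses_catr.
  have [h | h] : (l = 4 * k - 1 \/ l = 4 * k + 1)%N \/ ((l < 4 * k - 1)%N \/ l = (4 * k)%N) by lia.
    apply: uses_cons; apply: uses_catl; case: h => h.
      by apply: (@uses_run _ _ _ _ _ 0); lia.
    by apply: (@uses_run _ _ _ _ _ 1); nia.
  by apply/uses_head/return_class_has_c => //; lia.
- move=> a ha; have [a2 | a2] := ltnP a (2 * k - 1).
    by apply: uses_catl; apply: mixed_family_uses_mul => //; [left | lia].
  apply: uses_catr; apply: uses_head; rewrite -[_ * a%:Z]add0r.
  by apply: return_class_has_d; lia.
Qed.

(** For t = 4 g and m = 4 k + 2.  Up to sign the odd multiples of 2 g are the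
2 k + 1 numbers 2 g + 8 g l, l mod 2 k + 1.  Three of them, at l = k - 1, k and
k + z, are steps of the long paths; the others are paired consecutively, and for
even z one pair has to jump over the term k + z. *)
Definition family_t4 (k z g : nat) : seq starter :=
  class_pairs k (4 * g) g.-1 (fun i => i.+1) (fun i => (2 * g - i.+1)%N) ++
  quarter_class k g :: half_turn k g ::
  pair_run (4 * g) (g + 4 * g * (4 * k - 2))%N 0 1 ++
  (if odd z then
     pair_run (4 * g) (2 * g)%N k.+1 z./2 ++
     pair_run (4 * g) (2 * g)%N (k + z).+1 (2 * k - z)./2
   else
     pair_run (4 * g) (2 * g)%N k.+1 (z./2).-1 ++
     spair ((2 * g)%N%:Z + (k + z - 1)%N%:Z * (4 * g * 2)%N%:Z)
           ((2 * g)%N%:Z + (k + z - 1)%N%:Z * (4 * g * 2)%N%:Z + 2 * (4 * g * 2)%N%:Z) ::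
     pair_run (4 * g) (2 * g)%N (k + z).+2 ((2 * k - z)./2).-1).

Lemma cyclic_system_2_mod_4 k z g : (0 < g)%N -> (0 < z)%N -> (k = 2 * z \/ k.+1 = 2 * z)%N ->
  exists C : {set {set {set 'Z_((4 * k + 2) * (4 * g))}}},
    cyclic_cycle_system (@complete_minus_I ((4 * k + 2) * (4 * g))) (4 * k + 2) C.
Proof.
move=> g0 z0 hk; have me : ~~ odd (4 * k + 2) by lia.
have k0 : (0 < k)%N by lia.
have t0 : (0 < 4 * g)%N by lia.
apply: (@cyclic_system_of_family _ _ (family_t4 k z g)) => //; try lia.
- apply: starters_cat; first by apply: class_pairsP => // i ig; split; lia.
  apply: starters_cons; first exact: quarter_classP.
  apply: starters_cons; first exact: half_turnP.
  have n1 : ~~ ((4 * g * 2)%N%:Z %| (g + 4 * g * (4 * k - 2))%N%:Z)%Z.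
    apply/negP => /dvdzP[w]; rewrite (_ : (g + 4 * g * (4 * k - 2))%N%:Z =
      g%:Z * (1 + 4 * (4 * k%:Z - 2))); last by lia.
    have -> : w * (4 * g * 2)%N%:Z = g%:Z * (8 * w) by lia.
    by move/mulfI => /(_ ltac:(lia)); lia.
  have n2 : ~~ ((4 * g * 2)%N%:Z %| (2 * g)%N%:Z)%Z by clear n1; apply: ndvdz_small; lia.
  apply: starters_cat; first exact: pair_runP.
  case: ifP => _; first by apply: starters_cat; apply: pair_runP.
  apply: starters_cat; first exact: pair_runP.
  apply: starters_cons; last exact: pair_runP.
  apply: spairP => //; first by rewrite rpredDr // dvdz_mull.
  by clear n1 n2; rewrite coprimezE coprime2n; lia.
- rewrite /family_t4 weight_cat class_pairs_weight 2!weight_cons weight_cat pair_run_weight /=.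
  rewrite (_ : ((4 * k + 2) * (4 * g))./2 = (2 * k + 1) * (4 * g))%N; last by lia.
  case: g g0 {t0} => // g _; case: (boolP (odd z)) => oz.
    by rewrite weight_cat !pair_run_weight /=; lia.
  by rewrite weight_cat weight_cons !pair_run_weight /=; lia.
apply: cover_by_classes => //; try lia.
- move=> c l c0 ct lk; have [cg | cg | cg] := ltngtP c g.
  + apply: uses_catl; apply: (@class_pairs_uses _ _ _ _ _ _ c.-1); first by lia.
    have -> : c.-1.+1 = c by lia.
    exact: class_pair_uses_l.
  + apply: uses_catl; apply: (@class_pairs_uses _ _ _ _ _ _ (2 * g - c).-1); first by lia.
    have -> : (2 * g - (2 * g - c).-1.+1)%N = c by lia.
    exact: class_pair_uses_r.
  rewrite cg; apply: uses_catr; have [h | h] := ltnP l (4 * k - 2).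
    exact/uses_head/quarter_class_has_low.
  have [h4 | [h4 | h4]] : (l = 4 * k - 1 \/ l = 4 * k + 1 \/ (l = 4 * k - 2 \/ l = 4 * k))%N by lia.
  + apply: (@uses_mod _ _ (g%:Z + (4 * g)%:Z * (- 3))).
      by apply/dvdzP; exists (- 1); rewrite h4; lia.
    by apply: uses_head; apply: quarter_class_has_neg => //; right.
  + apply: (@uses_mod _ _ (g%:Z + (4 * g)%:Z * (- 1))).
      by apply/dvdzP; exists (- 1); rewrite h4; lia.
    by apply: uses_head; apply: quarter_class_has_neg => //; left.
  apply: uses_cons; apply: uses_cons; apply: uses_catl; case: h4 => h4.
    by apply: (@uses_run _ _ _ _ _ 0); rewrite ?h4; lia.
  by apply: (@uses_run _ _ _ _ _ 1); rewrite ?h4; lia.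
- move=> a ha; apply: uses_catr; have [a1 | a1] := ltnP 1 a.
    apply: uses_cons; apply: uses_head.
    rewrite (_ : (4 * g)%N%:Z * a%:Z = (2 * g)%N%:Z * (2 * a)%N%:Z); last by lia.
    by apply: half_turn_has_even; lia.
  apply: uses_head; have -> : a = 1%N by lia.
  by rewrite -[_ * _]add0r; apply: quarter_class_has_unit.
move=> d a e am; have {e} -> : d = (2 * g)%N by lia.
have key (l : nat) : (l < 2 * k + 1)%N ->
    uses ((4 * k + 2) * (4 * g)) (family_t4 k z g)
      ((2 * g)%N%:Z + (k%:Z - 1) * (8 * g)%N%:Z + (8 * g)%N%:Z * l%:Z).
  move=> lk; apply: uses_catr; have [l1 | l1] := ltnP 1 l; last first.
    have [-> | ->] : l = 0%N \/ l = 1%N by lia.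
      apply: (@uses_mod _ _ (2 * g%:Z + (4 * g)%:Z * (- (2 * k%:Z) - 4))).
        by apply/dvdzP; exists (- 1); lia.
      exact/uses_head/quarter_class_has_half.
    apply: uses_cons; apply: uses_head.
    rewrite (_ : _ + _ = (2 * g)%N%:Z * (1 + 4 * k%:Z)); last by lia.
    exact: half_turn_has_close.
  have [lz | lz] := eqVneq l z.+1.
    apply: uses_cons.
    apply: (@uses_mod _ _ ((2 * g)%:Z * (if odd k then - (2 * k%:Z) - 1 else 6 * k%:Z + 1))).
      apply/dvdzP; rewrite lz; case: hk => hk.
        by exists 0; rewrite (_ : odd k = false); nia.
      by exists (- 1); rewrite (_ : odd k = true); nia.
    exact/uses_head/half_turn_has_turn.
  have X : (2 * g)%N%:Z + (k%:Z - 1) * (8 * g)%N%:Z + (8 * g)%N%:Z * l%:Z =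
     (2 * g)%N%:Z + (k + l - 1)%N%:Z * (4 * g * 2)%N%:Z by lia.
  rewrite X {X}; apply: uses_cons; apply: uses_cons; apply: uses_catr.
  case: (boolP (odd z)) => oz.
    have [h | h] := ltnP l z.+1.
      by apply: uses_catl; apply: (@uses_run _ _ _ _ _ (k + l - 1)%N); lia.
    by apply: uses_catr; apply: (@uses_run _ _ _ _ _ (k + l - 1)%N); lia.
  have [h | h] := ltnP l z.
    by apply: uses_catl; apply: (@uses_run _ _ _ _ _ (k + l - 1)%N); lia.
  apply: uses_catr; have [h1 | h1] := ltnP z.+2 l.
    by apply: uses_cons; apply: (@uses_run _ _ _ _ _ (k + l - 1)%N); lia.
  apply: uses_head; have [el | el] : l = z \/ l = z.+2 by lia.
    rewrite el; exact: spair_l.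
  have -> : (2 * g)%N%:Z + (k + l - 1)%N%:Z * (4 * g * 2)%N%:Z =
    (2 * g)%N%:Z + (k + z - 1)%N%:Z * (4 * g * 2)%N%:Z + 2 * (4 * g * 2)%N%:Z.
    by rewrite el (_ : (k + z.+2 - 1 = (k + z - 1) + 2)%N) ?PoszD; [ring | lia].
  exact: spair_r.
have en : ((4 * k + 2) * (4 * g) = (2 * k + 1) * (8 * g))%N by lia.
rewrite en in key *; have [b [eb | eb]] := double_or_doubleS a.
  apply: (@uses_class _ _ _ ((2 * g)%N%:Z + (k%:Z - 1) * (8 * g)%N%:Z)); [lia | | exact: key].
  by apply/dvdzP; exists (b%:Z - k%:Z + 1); lia.
apply: usesN; apply: (@uses_class _ _ _ ((2 * g)%N%:Z + (k%:Z - 1) * (8 * g)%N%:Z)); [lia | | exact: key].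
by apply/dvdzP; exists (- b%:Z - k%:Z); lia.
Qed.

(** * Hamiltonian systems for n = 2 p q *)

Lemma starters_flatten m t (F : nat -> seq starter) a K :
  (forall k, starters m t (F k)) -> starters m t (flatten [seq F k | k <- iota a K]).
Proof. by move=> h; elim: (iota a K) => //= b l IH; apply: starters_cat. Qed.

Lemma uses_flatten n (F : nat -> seq starter) a K k x :
  (a <= k < a + K)%N -> uses n (F k) x -> uses n (flatten [seq F k | k <- iota a K]) x.
Proof.
rewrite -mem_iota; elim: (iota a K) => //= b l IH; rewrite inE => /orP[/eqP <- | kl] u.
  exact: uses_catl.
by apply: uses_catr; apply: IH.
Qed.

Lemma weight_flatten (F : nat -> seq starter) a K r : (forall k, weight (F k) = r) ->
  weight (flatten [seq F k | k <- iota a K]) = (K * r)%N.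
Proof.
move=> h; rewrite -[in RHS](size_iota a K).
by elim: (iota a K) => //= b l IH; rewrite weight_cat h IH.
Qed.

Section TwoFactorFamilies.

Variables P Q : nat.
Let p := (2 * P + 1)%N.
Let q := (2 * Q + 1)%N.
Hypotheses (cpq : coprime p q) (P0 : (0 < P)%N) (PQ : (P + 2 <= Q)%N).

(** Division of the index by q. *)
Lemma cover_blocks (U : nat -> Prop) :
  (forall k, (0 < k <= P)%N -> U (q * k)%N) ->
  (forall a, (0 < a <= Q)%N -> U (q * P + a)%N) ->
  (forall k a, (k < P)%N -> (0 < a <= 2 * Q)%N -> U (q * k + a)%N) ->
  forall e, (0 < e <= q * P + Q)%N -> U e.
Proof.
move=> h0 hP h e he.
have q0 : (0 < q)%N by rewrite /q addn1.
have [E lt] := (divn_eq e q, ltn_pmod e q0); move: E lt.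
move: (e %/ q)%N (e %% q)%N => k a E; rewrite {1}/q => lt.
have kP : (k <= P)%N.
  rewrite leqNgt; apply/negP => Pk; move: (leq_mul (leqnn q) Pk) he; rewrite E /q; lia.
rewrite E mulnC; have [a0 | a0] := posnP a.
  by rewrite a0 addn0; apply: h0; rewrite kP; case: k E {kP} => //; rewrite a0; lia.
have [e1 | e1] := eqVneq k P; first by rewrite e1; apply: hP; move: he; rewrite E e1; lia.
by apply: h; lia.
Qed.

(** As p q is odd, an odd number x is - (p q + 2 e) mod 2 p q for some
e = (p q - x) / 2 in the same range. *)
Lemma cover_even_odd fam :
  (forall e, (0 < e <= q * P + Q)%N -> uses (p * q * 2) fam (ev e)) ->
  (forall e, (0 < e <= q * P + Q)%N -> uses (p * q * 2) fam (od P Q e)) ->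
  forall x : nat, (0 < x < (p * q * 2 * 1)./2)%N -> uses (p * q * 2 * 1) fam x.
Proof.
rewrite muln1 muln2 doubleK -muln2 => he ho x hx.
have pq : (p * q = 2 * (q * P + Q) + 1)%N by rewrite /p /q; lia.
have [a [xa | xa]] := double_or_doubleS x.
  have -> : x%:Z = ev a by rewrite /ev; lia.
  by apply: he; lia.
have ha : (0 < q * P + Q - a <= q * P + Q)%N by lia.
apply: usesN; apply: uses_mod (ho _ ha).
apply/dvdzP; exists 1; rewrite /od -/p -/q pq -subzn; lia.
Qed.

(** Odd differences with consecutive indices differ by 2 = 2 t, so pairs of them
are starters. *)
Definition od_run (a K : nat) : seq starter := pair_run 1 (p * q)%N a K.

(** A pair of odd differences with indices a and a + 2, to jump over an index in
use. *)
Definition od_bridge (a : nat) : starter := spair (od P Q a) (od P Q a + 2 * (1 * 2)%N%:Z).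

Let me : ~~ odd (p * q * 2). Proof. by rewrite oddM andbF. Qed.

Let opq : odd (p * q). Proof. by rewrite oddM /p /q; lia. Qed.

Let od_ndvd a : ~~ ((1 * 2)%N%:Z %| od P Q a)%Z.
Proof. by apply/negP => /dvdzP[w]; move: opq; rewrite /od -/p -/q; lia. Qed.

Lemma od_runP a K : starters (p * q * 2) 1 (od_run a K).
Proof. by apply: pair_runP => //; have := od_ndvd 0; rewrite /od mulr0 addr0. Qed.

Lemma od_bridgeP a : is_starter (p * q * 2) 1 (od_bridge a).
Proof.
apply: spairP => //; rewrite ?od_ndvd // coprimezE coprime2n /= muln2 doubleK.
exact: opq.
Qed.

Lemma od_run_uses a K (e : nat) : (a <= e < a + 2 * K)%N ->
  uses (p * q * 2) (od_run a K) (od P Q e).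
Proof.
move=> h; have := @uses_run (p * q * 2) 1 (p * q)%N a K e (od P Q e) h; rewrite muln1.
by apply; rewrite /od -/p -/q; lia.
Qed.

Lemma od_bridge_l a : has_step (od_bridge a) (od P Q a).
Proof. exact: spair_l. Qed.

Lemma od_bridge_r a e : e = a + 2 -> has_step (od_bridge a) (od P Q e).
Proof.
move=> ->; rewrite (_ : od P Q (a + 2) = od P Q a + 2 * (1 * 2)%N%:Z).
  exact: spair_r.
by rewrite /od; lia.
Qed.

Lemma uses_odN fam (x y : int) : y = - x ->
  uses (p * q * 2) fam (od P Q x) -> uses (p * q * 2) fam (od P Q y).
Proof.
move=> -> h; apply: usesN; apply: uses_mod h.
by apply/dvdzP; exists 1; rewrite /od -/p -/q; lia.
Qed.

Lemma uses_seq1 n (F : nat -> starter) a K k x : (a <= k < a + K)%N ->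
  uses n [:: F k] x -> uses n [seq F k | k <- iota a K] x.
Proof.
by move=> kK [s [d [[<-|//] hd dv]]]; apply: uses_mod dv _; exact: (@uses_seq n F a K k d kK hd).
Qed.

(** The long paths use the odd differences with index in the last half block, the
multiples of q, two in every block 2 h + 1, and Q - P and Q + 1 in block 0.  The
rest is made of pairs, and two of them jump over Q - P and Q + 1. *)
Definition two_factor_even : seq starter :=
  p_turn P Q :: half_turn_even P Q :: [seq block_pair P Q (2 * h) | h <- iota 0 P./2] ++
  flatten [seq od_run (q * (2 * h + 1) + 3) Q.-1 | h <- iota 0 P./2] ++
  flatten [seq od_run (q * (2 * h + 2) + 1) Q | h <- iota 0 (P./2).-1] ++
  od_run 1 ((Q - P)./2).-1 ++ od_bridge (Q - P).-1 ::
  od_run (Q - P).+2 (P./2).-1 ++ od_bridge Q :: od_run (Q + 3) (Q./2).-1.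

Lemma hamiltonian_two_factors_even : ~~ odd P -> ~~ odd Q ->
  exists C : {set {set {set 'Z_(p * q * 2 * 1)}}},
    cyclic_cycle_system (@complete_minus_I (p * q * 2 * 1)) (p * q * 2) C.
Proof.
move=> oP oQ; have m3 : (3 <= p * q * 2)%N by rewrite /p /q; nia.
apply: (@cyclic_system_of_family _ _ two_factor_even) => //.
- apply: starters_cons; first exact: p_turnP.
  apply: starters_cons; first exact: half_turn_evenP.
  apply: starters_cat; first by apply: starters_seq => h _; apply: block_pairP.
  apply: starters_cat; first by apply: starters_flatten => h; apply: od_runP.
  apply: starters_cat; first by apply: starters_flatten => h; apply: od_runP.
  apply: starters_cat; first exact: od_runP.
  apply: starters_cons; first exact: od_bridgeP.
  apply: starters_cat; first exact: od_runP.
  by apply: starters_cons; [exact: od_bridgeP | exact: od_runP].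
- have wr a K : weight (od_run a K) = (2 * K)%N by apply: pair_run_weight.
  rewrite /two_factor_even 2!weight_cons !weight_cat !weight_cons.
  rewrite weight_cat weight_cons !wr (@weight_seq _ _ _ (2 * q)) //.
  rewrite (@weight_flatten _ _ _ (2 * Q.-1)) // (@weight_flatten _ _ _ (2 * Q)) //.
  rewrite muln1 muln2 doubleK /= /p /q.
  have [[a ea] [b eb]] : (exists a, P = 2 * a + 2)%N /\ (exists b, Q = P + 2 + 2 * b)%N.
    by split; [exists (P./2).-1 | exists ((Q - P)./2).-1]; lia.
  have [h1 h2 h3] : [/\ P./2 = a.+1, (Q - P)./2 = b.+1 & Q./2 = (a + b).+2] by split; lia.
  by rewrite h1 h2 h3 eb ea; lia.
- apply: cover_even_odd; apply: cover_blocks.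
  + by move=> k hk; apply: uses_in (p_turn_ev Q hk); left.
  + by move=> a ha; apply: uses_in (half_turn_even_ev P ha); right; left.
  + move=> k a kP ha; do 2 apply: uses_cons; apply: uses_catl.
    have [h [eh | eh]] := double_or_doubleS k; rewrite eh -mul2n.
      by apply: (@uses_seq1 _ _ _ _ h); [lia | apply: block_pair_ev1].
    by apply: (@uses_seq1 _ _ _ _ h); [lia | apply: block_pair_ev2].
  + by move=> k hk; apply: uses_in (p_turn_od Q hk); left.
  + by move=> a ha; apply: uses_in (half_turn_even_od P ha); right; left.
  move=> k a kP ha; have [k0 | k0] := posnP k.
    rewrite k0 muln0 add0n.
    have [e1 | e1] := eqVneq a (Q - P)%N.
      apply: (@uses_odN _ (P%:Z - Q%:Z)); first by lia.
      by have := p_turn_close P Q; rewrite (negbTE oP); apply: uses_in; left.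
    have [e2 | e2] := eqVneq a Q.+1.
      apply: (@uses_odN _ (- (Q%:Z + 1))); first by lia.
      by apply: uses_in (half_turn_even_close P oQ); right; left.
    do 2 apply: uses_cons; do 3 apply: uses_catr.
    have [h1 | h1] := ltnP a (Q - P).-1; first by apply: uses_catl; apply: od_run_uses; lia.
    apply: uses_catr; have [h2 | h2] := ltnP a (Q - P).+2.
      have [-> | e3] : a = (Q - P).-1 \/ a = (Q - P).+1 by lia.
        exact/uses_head/od_bridge_l.
      by apply: uses_head; apply: od_bridge_r; lia.
    apply: uses_cons; have [h3 | h3] := ltnP a Q.
      by apply: uses_catl; apply: od_run_uses; lia.
    apply: uses_catr; have [h4 | h4] := ltnP a (Q + 3).
      have [-> | e3] : a = Q \/ a = Q.+2 by lia.
        exact/uses_head/od_bridge_l.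
      by apply: uses_head; apply: od_bridge_r; lia.
    by apply: uses_cons; apply: od_run_uses; lia.
  do 2 apply: uses_cons; have [h [eh | eh]] := double_or_doubleS k.
    do 2 apply: uses_catr; apply: uses_catl; apply: (@uses_flatten _ _ _ _ h.-1); first by lia.
    by rewrite (_ : k = 2 * h.-1 + 2)%N; [apply: od_run_uses; lia | lia].
  rewrite (_ : k = 2 * h + 1)%N; last by lia.
  have [a2 | a2] := ltnP 2 a.
    apply: uses_catr; apply: uses_catl; apply: (@uses_flatten _ _ _ _ h); first by lia.
    by apply: od_run_uses; lia.
  apply: uses_catl; apply: (@uses_seq1 _ _ _ _ h); first by lia.
  rewrite (_ : 2 * h + 1 = (2 * h).+1)%N; last by lia.
  have [-> | ->] : a = 1%N \/ a = 2%N by lia.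
    exact: block_pair_od1.
  exact: block_pair_od2.
Qed.

(** In block 0 the odd differences with index 1, Q - P, Q and Q + 1 are used, the
first one by the cycle of multiples of the unit p q + 2.  The gaps between
them have even length. *)
Definition two_factor_odd : seq starter :=
  p_turn P Q :: half_turn_odd P Q :: block_turn P Q ::
  ssingle ((p * q + 2)%N%:Z * 1%:Z) ::
  [seq block_pair P Q (2 * h + 1) | h <- iota 0 P./2] ++
  flatten [seq od_run (q * (2 * h + 1) + 1) Q | h <- iota 0 P./2] ++
  flatten [seq od_run (q * (2 * h + 2) + 3) Q.-1 | h <- iota 0 P./2] ++
  od_run 2 ((Q - P)./2).-1 ++ od_run (Q - P).+1 P./2 ++ od_run Q.+2 Q./2.

Lemma hamiltonian_two_factors_odd : odd P -> odd Q ->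
  exists C : {set {set {set 'Z_(p * q * 2 * 1)}}},
    cyclic_cycle_system (@complete_minus_I (p * q * 2 * 1)) (p * q * 2) C.
Proof.
move=> oP oQ; have m3 : (3 <= p * q * 2)%N by rewrite /p /q; nia.
apply: (@cyclic_system_of_family _ _ two_factor_odd) => //.
- apply: starters_cons; first exact: p_turnP.
  apply: starters_cons; first by apply: half_turn_oddP; lia.
  apply: starters_cons; first by apply: block_turnP; lia.
  apply: starters_cons.
    apply: (@ssingleP _ 1); rewrite coprimezE /= coprimeMr coprimen2 oddD opq /= andbT.
    by rewrite coprime_sym /coprime gcdnDl -/(coprime _ 2) coprimen2 opq.
  apply: starters_cat; first by apply: starters_seq => h _; apply: block_pairP.
  apply: starters_cat; first by apply: starters_flatten => h; apply: od_runP.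
  apply: starters_cat; first by apply: starters_flatten => h; apply: od_runP.
  apply: starters_cat; first exact: od_runP.
  by apply: starters_cat; apply: od_runP.
- have wr a K : weight (od_run a K) = (2 * K)%N by apply: pair_run_weight.
  rewrite /two_factor_odd 4!weight_cons !weight_cat !wr (@weight_seq _ _ _ (2 * q)) //.
  rewrite (@weight_flatten _ _ _ (2 * Q)) // (@weight_flatten _ _ _ (2 * Q.-1)) //.
  rewrite muln1 muln2 doubleK /= /p /q.
  have [[a ea] [b eb]] : (exists a, P = 2 * a + 1)%N /\ (exists b, Q = P + 2 + 2 * b)%N.
    by split; [exists P./2 | exists ((Q - P)./2).-1]; lia.
  have [h1 h2 h3] : [/\ P./2 = a, (Q - P)./2 = b.+1 & Q./2 = (a + b).+1] by split; lia.
  by rewrite h1 h2 h3 eb ea; lia.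
- apply: cover_even_odd; apply: cover_blocks.
  + by move=> k hk; apply: uses_in (p_turn_ev Q hk); left.
  + move=> a ha; have [aQ | aQ] := ltnP a Q.
      by apply: uses_in (@half_turn_odd_ev P Q a _); [right; left | lia].
    have -> : a = Q by lia.
    by apply: uses_in (block_turn_close P Q); do 2 right; left.
  + move=> k a kP ha; have [k0 | k0] := posnP k.
      rewrite k0 muln0 add0n; have [e1 | e1] := eqVneq a (Q - P)%N.
        apply: usesN; rewrite (_ : - ev a = ev (P%:Z - Q%:Z)); last by rewrite /ev; lia.
        by have := p_turn_close P Q; rewrite oP; apply: uses_in; left.
      by apply: uses_in (@block_turn_ev P Q a _ _) => //; [do 2 right; left | lia].
    do 4 apply: uses_cons; apply: uses_catl.
    have [h [eh | eh]] := double_or_doubleS k.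
      rewrite (_ : k = (2 * h.-1 + 1).+1)%N; last by lia.
      by apply: (@uses_seq1 _ _ _ _ h.-1); [lia | apply: block_pair_ev2].
    rewrite (_ : k = (2 * h + 1))%N; last by lia.
    by apply: (@uses_seq1 _ _ _ _ h); [lia | apply: block_pair_ev1].
  + by move=> k hk; apply: uses_in (p_turn_od Q hk); left.
  + move=> a ha; have [aQ | aQ] := ltnP a Q.
      by apply: uses_in (@half_turn_odd_od P Q a oQ _); [right; left | lia].
    have -> : a = Q by lia.
    by apply: uses_in (half_turn_odd_mid1 P oQ); right; left.
  move=> k a kP ha; have [k0 | k0] := posnP k.
    rewrite k0 muln0 add0n.
    have [e1 | e1] := eqVneq a (Q - P)%N.
      by apply: uses_in (@block_turn_od P Q a _ _ _); [do 2 right; left | lia | lia | lia].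
    have [e2 | e2] := eqVneq a Q.+1.
      apply: (@uses_odN _ (- (Q%:Z + 1))); first by lia.
      by apply: uses_in (half_turn_odd_close P oQ); right; left.
    have [e3 | e3] := eqVneq a Q.
      by rewrite e3; apply: uses_in (half_turn_odd_mid2 P oQ); right; left.
    have [e4 | e4] := eqVneq a 1%N.
      do 3 apply: uses_cons; apply: uses_head.
      by rewrite e4 (_ : od P Q 1%N = (p * q + 2)%N%:Z * 1%:Z); [exact: ssingle_has | rewrite /od -/p -/q; lia].
    do 4 apply: uses_cons; do 3 apply: uses_catr.
    have [h1 | h1] := ltnP a (Q - P); first by apply: uses_catl; apply: od_run_uses; lia.
    apply: uses_catr; have [h3 | h3] := ltnP a Q; last first.
      by apply: uses_catr; apply: od_run_uses; lia.
    by apply: uses_catl; apply: od_run_uses; lia.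
  do 4 apply: uses_cons; have [h [eh | eh]] := double_or_doubleS k; last first.
    rewrite (_ : k = 2 * h + 1)%N; last by lia.
    apply: uses_catr; apply: uses_catl; apply: (@uses_flatten _ _ _ _ h); first by lia.
    by apply: od_run_uses; lia.
  rewrite (_ : k = 2 * h.-1 + 2)%N; last by lia.
  have [a2 | a2] := ltnP 2 a.
    do 2 apply: uses_catr; apply: uses_catl; apply: (@uses_flatten _ _ _ _ h.-1); first by lia.
    by apply: od_run_uses; lia.
  apply: uses_catl; apply: (@uses_seq1 _ _ _ _ h.-1); first by lia.
  rewrite (_ : 2 * h.-1 + 2 = (2 * h.-1 + 1).+1)%N; last by lia.
  have [-> | ->] : a = 1%N \/ a = 2%N by lia.
    exact: block_pair_od1.
  exact: block_pair_od2.
Qed.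

End TwoFactorFamilies.

Local Open Scope nat_scope.

(** * Existence *)

(** The part of n at its smallest prime factor and the complementary part. *)
Lemma two_factors (n : nat) : 1 < n -> ~ (exists p a, [/\ prime p, 1 <= a & n = p ^ a]) ->
  exists p q, [/\ n = p * q, coprime p q, 1 < p & p < q].
Proof.
move=> n1 npp; have n0 : 0 < n by apply: ltnW.
have pr := pdiv_prime n1; set r := pdiv n in pr.
have dr : r %| n by apply: pdiv_dvd.
have E := partnC r n0.
have c : coprime n`_r n`_r^' by apply: coprime_partC.
have p1 : 1 < n`_r.
  by rewrite p_part -(exp1n (logn r n)) ltn_exp2r ?prime_gt1 // logn_gt0 mem_primes pr n0 dr.
have q1 : 1 < n`_r^'.
  rewrite ltn_neqAle part_gt0 andbT; apply/eqP => q1; apply: npp.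
  exists r, (logn r n); split=> //; first by rewrite logn_gt0 mem_primes pr n0 dr.
  by rewrite -p_part -[LHS]E -q1 muln1.
have [h | h | h] := ltngtP n`_r n`_r^'.
- by exists n`_r, n`_r^'.
- by exists n`_r^', n`_r; rewrite mulnC coprime_sym.
by move: c; rewrite h /coprime gcdnn => /eqP e; rewrite e in q1.
Qed.

(** As p q = 4 i + 1, the halves P and Q of p and q have the same parity. *)
Lemma hamiltonian_existence (i : nat) : 0 < i ->
  ~ (exists p a, [/\ prime p, 1 <= a & 4 * i + 1 = p ^ a]) ->
  exists C : {set {set {set 'Z_((8 * i + 2) * 1)}}},
    cyclic_cycle_system (@complete_minus_I ((8 * i + 2) * 1)) (8 * i + 2) C.
Proof.
move=> i0 npp; have [|p [q [E c p1 pq]]] := two_factors _ npp; first by lia.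
have [[P hP] [Q hQ]] : (exists P, p = 2 * P + 1) /\ (exists Q, q = 2 * Q + 1).
  have : odd (p * q) by rewrite -E; lia.
  by rewrite oddM => /andP[op oq]; split; [exists p./2 | exists q./2]; lia.
have hPQ : odd P = odd Q.
  have [a [ea | ea]] := double_or_doubleS P; have [b [eb | eb]] := double_or_doubleS Q; try lia.
have -> : 8 * i + 2 = (2 * P + 1) * (2 * Q + 1) * 2 by rewrite -hP -hQ; lia.
rewrite hP hQ in c; have P0 : 0 < P by lia.
have lPQ : P + 2 <= Q by lia.
case: (boolP (odd P)) => oP.
  by apply: hamiltonian_two_factors_odd => //; rewrite -hPQ.
by apply: hamiltonian_two_factors_even => //; rewrite -hPQ.
Qed.

Theorem existence (m t : nat) : 4 <= m -> ~~ odd m -> 0 < t ->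
  [/\ m = 0 %[mod 8] -> t = 0 %[mod 4] \/ t = 2 %[mod 4],
      m = 2 %[mod 8] ->
        (t = 0 %[mod 4] \/ t = 1 %[mod 4]) /\
        ((exists p a : nat, [/\ prime p, 1 <= a & m = 2 * p ^ a]) -> 1 < t),
      m = 4 %[mod 8] -> 1 <= t
    & m = 6 %[mod 8] -> t = 0 %[mod 4] \/ t = 3 %[mod 4]] ->
  exists C : {set {set {set 'Z_(m * t)}}},
    cyclic_cycle_system (@complete_minus_I (m * t)) m C.
Proof.
move=> m4 me t0 [h0 h2 _ h6].
have [i [e|[e|[e|e]]]] :
  exists i, m = 8 * i \/ m = 8 * i + 2 \/ m = 8 * i + 4 \/ m = 8 * i + 6.
  by exists (m %/ 8); lia.
- have -> : t = 2 * t./2 by have := h0; rewrite e; lia.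
  by rewrite e; apply: cyclic_system_0_mod_8; lia.
- have {h2} [ht hpp] := h2 ltac:(lia).
  have [s [es | es]] : exists s, t = 4 * s \/ t = 4 * s + 1 by exists (t %/ 4); lia.
    rewrite (_ : m = 4 * (2 * i) + 2) ?es; last by lia.
    by apply: (@cyclic_system_2_mod_4 _ i); [lia | lia | left].
  have [s0 | s0] := posnP s.
    rewrite es s0 e; apply: hamiltonian_existence; first by lia.
    case=> p [a [pp a1 ea]]; have : 1 < t by apply: hpp; exists p, a; split => //; lia.
    by lia.
  have -> : t = 4 * s.-1 + 5 by lia.
  rewrite (_ : m = 4 * (2 * (2 * i./2 + odd i)) + 2); last by lia.
  by apply: cyclic_system_2_mod_8; lia.
- by rewrite e; apply: cyclic_system_4_mod_8.
have {h6} ht := h6 ltac:(lia).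
have [s [es | es]] : exists s, t = 4 * s \/ t = 4 * s + 3 by exists (t %/ 4); lia.
  rewrite (_ : m = 4 * (2 * i + 1) + 2) ?es; last by lia.
  by apply: (@cyclic_system_2_mod_4 _ i.+1); [lia | lia | right; lia].
rewrite es (_ : m = 4 * (2 * (2 * i.+1./2 + odd i.+1)).-1 + 2); last by lia.
by apply: cyclic_system_6_mod_8; lia.
Qed.

(** * Counting over partitions and orbits *)

(** Every edge comes from two ordered pairs. *)
Lemma card_edge_set (T : finType) (e : rel T) :
  symmetric e -> irreflexive e -> #|[set p | e p.1 p.2]| = 2 * #|edge_set e|.
Proof.
move=> sym irr; rewrite mulnC -sum1_card.
rewrite (partition_big_imset (fun p : T * T => [set p.1; p.2])) /=.
rewrite -[RHS]sum_nat_const; apply: eq_big => [E|E].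
  by congr (E \in _); apply: eq_imset_mem => p; rewrite !inE.
case/imsetP => [[x y]]; rewrite inE /= => xy ->.
rewrite sum1dep_card (_ : [set p | _] = [set (x, y); (y, x)]).
  rewrite cards2; case: eqP => // [[exy _]]; by rewrite exy irr in xy.
apply/setP => [[a b]]; rewrite !inE /=; apply/andP/orP.
  by case=> _ /eqP /set2_eqP[[-> ->]|[-> ->]]; [left | right].
by case=> /eqP[-> ->]; split; rewrite // ?xy 1?sym ?xy // setUC.
Qed.

Lemma sum_card_partition (T : finType) (P : {set {set T}}) (D F : {set T}) :
  partition P D -> F \subset D -> \sum_(A in P) #|A :&: F| = #|F|.
Proof.
move=> pP FD; rewrite -sum1_card (bigID [in D]) /= [X in _ + X]big1 ?addn0; last first.
  by move=> x /andP[xF xD]; rewrite (subsetP FD) in xD.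
rewrite -(eq_bigl _ _ (fun x => andbC _ _)) /= (set_partition_big_cond _ pP) /=.
apply: eq_bigr => A _; rewrite -sum1_card; apply: eq_bigl => x.
by rewrite inE.
Qed.

(** The sum is taken orbit by orbit, and f is constant on orbits. *)
Lemma dvdn_sum_porbit (X : finType) (s : {perm X}) (A : {set X}) (f : X -> nat) N :
  (forall x, x \in A -> s x \in A) -> (forall x, x \in A -> f (s x) = f x) ->
  (forall x, x \in A -> N %| #|porbit s x| * f x) -> N %| \sum_(x in A) f x.
Proof.
move: {2}#|A|.+1 (ltnSn #|A|) => k; elim: k => // k IH in A *.
rewrite ltnS => Ak Acl fs hN.
have [->|[x xA]] := set_0Vmem A; first by rewrite big_set0.
have sA i y : y \in A -> (s ^+ i)%g y \in A /\ f ((s ^+ i)%g y) = f y.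
  elim: i => [|i IHi] yA; first by rewrite expg0 perm1.
  by have [h1 h2] := IHi yA; rewrite expgSr permM; split; [apply: Acl | rewrite fs].
have subA : porbit s x \subset A.
  by apply/subsetP => y /porbitP[i ->]; case: (sA i x xA).
rewrite (big_setID (porbit s x)) /= (setIidPr subA) dvdn_addr.
  apply: IH.
  - apply: leq_trans Ak; rewrite -(cardsID (porbit s x) A) (setIidPr subA).
    by rewrite -[X in X < _]add0n ltn_add2r lt0n card_porbit_neq0.
  - move=> y /setDP[yA yx]; rewrite inE Acl // andbT.
    by apply: contra yx => yx; rewrite -eq_porbit_mem -(porbit_perm s 1) eq_porbit_mem expg1.
  - by move=> y /setDP[yA _]; apply: fs.
  by move=> y /setDP[yA _]; apply: hN.
rewrite (eq_bigr (fun=> f x)); first by rewrite sum_nat_const; apply: hN.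
by move=> y /porbitP[i ->]; case: (sA i x xA).
Qed.

Lemma iter_porbit_dvd (X : finType) (s : {perm X}) x k :
  (s ^+ k)%g x = x -> #|porbit s x| %| k.
Proof.
move=> h; set a := #|porbit s x|.
have a0 : 0 < a by rewrite lt0n card_porbit_neq0.
have ha : (s ^+ a)%g x = x by rewrite permX iter_porbit.
have hm : (s ^+ (k %% a))%g x = x.
  rewrite {1}(divn_eq k a) expgD permM mulnC expgM in h.
  suff e : ((s ^+ a) ^+ (k %/ a))%g x = x by rewrite e in h.
  by elim: (k %/ a) => [|j IH]; rewrite ?expg0 ?perm1 // expgSr permM IH.
have := uniq_traject_porbit s x; rewrite -/a => /uniqP - /(_ x).
move=> /(_ 0 (k %% a)); rewrite !inE size_traject a0 ltn_pmod // => /(_ isT isT).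
by rewrite !nth_traject ?ltn_pmod // -!permX hm expg0 perm1 => /(_ erefl) e; rewrite /dvdn -e.
Qed.

(** * Cycles invariant under a translation *)

Definition translate (n : nat) (a : 'Z_n) (E : {set {set 'Z_n}}) : {set {set 'Z_n}} :=
  [set [set (x + a)%R | x in A] | A : {set 'Z_n} in E].

Lemma translate_pair n (a x y : 'Z_n) :
  [set (z + a)%R | z in [set x; y]] = [set (x + a)%R; (y + a)%R].
Proof. by rewrite imsetU1 imset_set1. Qed.

Lemma translate_inj n (a : 'Z_n) : injective (translate a).
Proof. by apply: imset_inj; apply: imset_inj; apply: addIr. Qed.

Lemma translateD n (a b : 'Z_n) E : translate (a + b)%R E = translate b (translate a E).
Proof.
rewrite /translate -imset_comp; apply: eq_imset => A /=.
by rewrite -imset_comp; apply: eq_imset => x /=; rewrite addrA.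
Qed.

Lemma translate0 n E : translate (0%R : 'Z_n) E = E.
Proof.
rewrite -[RHS]imset_id; apply: eq_imset => A.
by rewrite -[RHS]imset_id; apply: eq_imset => x; rewrite addr0.
Qed.

Section Rotation.

Variables (n m : nat) (f : nat -> 'Z_n).
Hypotheses (n1 : 1 < n) (ne : ~~ odd n) (m3 : 3 <= m).
Hypothesis f_mod : forall i j, f i = f j <-> i = j %[mod m].
Hypothesis f_adj : forall i, complete_minus_I (f i) (f i.+1).

Let E := [set [set f k; f k.+1] | k : 'I_m].

Let m0 : 0 < m. Proof. exact: leq_trans m3. Qed.

Let fE i j k l : i + k * m = j + l * m -> f i = f j.
Proof. by move=> h; apply/f_mod; rewrite -(modnMDl k) addnC h addnC modnMDl. Qed.

Let in_E i : [set f i; f i.+1] \in E.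
Proof.
apply/imsetP; exists (Ordinal (ltn_pmod i m0)) => //=; congr [set _; _]; apply/f_mod.
  by rewrite modn_mod.
by rewrite -[in LHS]addn1 -[in RHS]addn1 modnDml.
Qed.

Let neighbour i y : [set f i; y] \in E -> y = f i.+1 \/ y = f (i + m.-1).
Proof.
case/imsetP => k _ /set2_eqP[[/f_mod ik ->] | [/f_mod ik ->]]; [left | right]; apply/f_mod.
  by rewrite -[in LHS]addn1 -[in RHS]addn1 -modnDml -ik modnDml.
by rewrite -modnDml ik modnDml addSnnS prednK // modnDr.
Qed.

Let vertex_E x y : [set x; y] \in E -> exists i, x = f i.
Proof. by case/imsetP => k _ /set2_eqP[[-> _] | [-> _]]; [exists k | exists k.+1]. Qed.

Let f_small i : (f i == f i.+2) = false.
Proof.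
apply/negbTE/eqP => /f_mod /eqP; rewrite -[i.+2]addn2 -{1}[i]addn0 eqn_modDl mod0n.
by rewrite modn_small.
Qed.

(** A translation that preserves an m-cycle is a rotation or a reflection of it.  A
reflection fixes a vertex, so that the translation is trivial, or it exchanges the
ends of an edge, which then differ by n / 2; but such pairs are not adjacent. *)
Lemma translate_rotation (a : 'Z_n) : translate a E = E ->
  exists r, forall i, f (i + r) = (f i + a)%R.
Proof.
move=> inv.
have tE i : [set (f i + a)%R; (f i.+1 + a)%R] \in E.
  by rewrite -inv -translate_pair; apply/imset_f/in_E.
have [r hr] := vertex_E (tE 0).
have nx i j : (f i + a)%R = f j -> (f i.+1 + a)%R = f j.+1 \/ (f i.+1 + a)%R = f (j + m.-1).
  by move=> h; apply: neighbour; rewrite -h.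
have m1 : m = m.-1.+1 by rewrite prednK.
have [h1 | h1] := nx 0 r hr.
  exists r => i; suff [] : (f i + a)%R = f (i + r) /\ (f i.+1 + a)%R = f (i.+1 + r) by [].
  elim: i => [|i [IH1 IH2]]; first by rewrite add0n add1n.
  split=> //; have [-> // | h2] := nx _ _ IH2.
  have : f i.+2 = f i.
    by apply: (addIr a); rewrite h2 IH1; apply: (fE (k := 0) (l := 1)); lia.
  by move/esym/eqP; rewrite f_small.
(* The other direction of travel: the reflection i |-> r - i, with m - 1 standing
   for -1. *)
have refl i : (f i + a)%R = f (r + m.-1 * i) /\ (f i.+1 + a)%R = f (r + m.-1 * i.+1).
  elim: i => [|i [IH1 IH2]]; first by rewrite muln0 addn0 muln1.
  split=> //; have [h2 | ->] := nx _ _ IH2; last by congr f; lia.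
  have : f i.+2 = f i.
    by apply: (addIr a); rewrite h2 IH1; apply: (fE (k := 0) (l := 1)); lia.
  by move/esym/eqP; rewrite f_small.
exfalso; have [j [ej | ej]] := double_or_doubleS r.
  have fx : (f j + a)%R = f j.
    by rewrite (refl j).1; apply: (fE (k := 0) (l := j)); lia.
  have a0 : a = 0%R by apply: (addrI (f j)); rewrite fx addr0.
  have h : f 1 = f (r + m.-1) by rewrite -h1 a0 addr0.
  have hr0 : f 0 = f r by rewrite -hr a0 addr0.
  have : f 2 = f 0.
    move/f_mod: h => h'; rewrite hr0; apply/f_mod.
    by rewrite -(addn1 1) -modnDml h' modnDml -addnA addn1 prednK // modnDr.
  by move/esym/eqP; rewrite f_small.
have e1 : (f j + a)%R = f j.+1.
  by rewrite (refl j).1; apply: (fE (k := 0) (l := j)); lia.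
have e2 : (f j.+1 + a)%R = f j.
  by rewrite (refl j.+1).1; apply: (fE (k := 0) (l := j.+1)); lia.
have aa : (a + a = 0)%R by apply: (addrI (f j)); rewrite addrA e1 e2 addr0.
have := f_adj j; rewrite /complete_minus_I -e1.
rewrite -{1}(addr0 (f j)) !(inj_eq (addrI _)) => /andP[a0 an].
have nE := Zp_cast n1; have al := ltn_ord a.
have a0' : (a : nat) != 0 by apply: contraNneq a0 => z; apply/eqP/val_inj; rewrite /= z.
have an' : (a : nat) != n./2 by apply: contraNneq an => <-; rewrite natr_Zp.
have := congr1 (fun z : 'Z_n => z : nat) aa; rewrite /=.
have [h | h] := ltnP (a + a) (Zp_trunc n).+2; first by rewrite modn_small //; lia.
by rewrite -(subnKC h) modnDl modn_small; lia.
Qed.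

Definition odd_steps k := \sum_(i < k) (odd (f i) != odd (f i.+1)).

Lemma odd_steps_parity k : odd (odd_steps k) = odd (f 0) (+) odd (f k).
Proof.
elim: k => [|k IH]; first by rewrite /odd_steps big_ord0 addbb.
rewrite /odd_steps big_ord_recr oddD -/(odd_steps k) IH /=.
by case: (odd (f 0)); case: (odd (f k)); case: (odd (f k.+1)).
Qed.

Lemma odd_steps_period (r k : nat) (a : nat) : (forall i, f (i + r) = (f i + a%:R)%R) ->
  odd_steps (k * r) = k * odd_steps r.
Proof.
move=> per; have per' j i : f (i + j * r) = (f i + (j * a)%:R)%R.
  elim: j => [|j IH]; first by rewrite !mul0n addn0 addr0.
  by rewrite !mulSn addnCA addnC per IH natrD -addrA (addrC a%:R)%R.
elim: k => [|k IH]; first by rewrite /odd_steps big_ord0.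
rewrite mulSn addnC /odd_steps big_split_ord /= -/(odd_steps _) IH mulSn addnC; congr addn.
apply: eq_bigr => i _; congr nat_of_bool.
rewrite -[(k * r + i).+1]addnS ![(k * r + _)]addnC !per' !(odd_addZ n1 ne).
by case: (odd (f i)); case: (odd (f i.+1)); case: (odd (k * a)).
Qed.

(** Let o be the number of odd edges of a cycle invariant under translation by
a = n / s.  The translation is a rotation by r with s r = w m and w coprime to s,
so that w o = s o' where o' counts the odd edges in r steps.  Hence o = s o1 and
w o1 = o', which has the parity of a; and o is even, since parities
return after one turn.  Now o + n = s (o1 + a).  For odd w this gives o1 = a mod 2.
For even w both are even: s is odd and s o1 = o even, and a = w o1 mod 2. *)
Lemma odd_steps_invariant (a s : nat) : a * s = n -> translate a%:R E = E ->
  2 * s %| odd_steps m + n.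
Proof.
move=> an inv; have [r hr] := translate_rotation inv.
have n0 : 0 < n by apply: ltnW.
have [a0 s0] : 0 < a /\ 0 < s by move: n0; rewrite -an muln_gt0 => /andP[].
have per k i : f (i + k * r) = (f i + (k * a)%:R)%R.
  elim: k => [|k IH]; first by rewrite !mul0n addn0 addr0.
  by rewrite !mulSn addnCA addnC hr IH natrD -addrA (addrC a%:R)%R.
have per0 k : (m %| k * r) = (n %| k * a).
  apply/idP/idP => [h | h].
    have := per k 0; rewrite (_ : f (0 + k * r) = f 0); last first.
      by apply/f_mod; rewrite add0n (eqP h) mod0n.
    rewrite -{1}(addr0 (f 0)) => /addrI/esym e0.
    by have := congr1 (fun z : 'Z_n => z : nat) e0; rewrite /= val_Zp_nat // => /eqP.
  have := per k 0; rewrite (_ : (k * a)%:R = 0 :> 'Z_n)%R.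
    by rewrite addr0 => /f_mod; rewrite add0n mod0n => /eqP.
  by apply: val_inj; rewrite /= val_Zp_nat // (eqP h).
have [w hw] : exists w, s * r = w * m.
  by apply/dvdnP; rewrite per0 mulnC an.
have cws : coprime w s.
  rewrite /coprime; set g := gcdn w s.
  have [/dvdnP[w' ew] /dvdnP[s' es]] := (dvdn_gcdl w s, dvdn_gcdr w s).
  have g0 : 0 < g by rewrite gcdn_gt0 s0 orbT.
  have : n %| s' * a.
    rewrite -per0; apply/dvdnP; exists w'; apply/eqP; rewrite -(eqn_pmul2l g0).
    by rewrite mulnA (mulnC g) -es hw {1}ew mulnAC mulnC.
  rewrite -an {1}es (mulnC a) dvdn_pmul2r // => /dvdn_leq.
  have s'0 : 0 < s' by move: s0; rewrite {1}es muln_gt0 => /andP[].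
  move=> /(_ s'0); rewrite -[X in _ <= X]muln1 leq_pmul2l //; lia.
have per_m i : f (i + m) = (f i + 0%:R)%R.
  by rewrite addr0; apply/f_mod; rewrite modnDr.
have E1 : w * odd_steps m = s * odd_steps r.
  by rewrite -(odd_steps_period s hr) -(odd_steps_period w per_m) hw.
have [o eo] : exists o, odd_steps m = o * s.
  by apply/dvdnP; rewrite -(@Gauss_dvdr s w) ?E1 ?dvdn_mulr // coprime_sym.
have E2 : w * o = odd_steps r.
  by apply/eqP; rewrite -(eqn_pmul2l s0) -E1 eo; apply/eqP; lia.
have pm : odd (o * s) = false.
  rewrite -eo odd_steps_parity (_ : f m = f 0) ?addbb //.
  by apply/f_mod; rewrite modnn mod0n.
have pr : odd (w * o) = odd a.
  rewrite E2 odd_steps_parity -[r]add0n hr (odd_addZ n1 ne).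
  by rewrite addKb.
rewrite eo -an -mulnDl dvdn_pmul2r // dvdn2 oddD -pr oddM.
move: pm; rewrite oddM; case: (boolP (odd w)) => [_ |ow] /=; first by rewrite addbb.
have -> : odd s.
  move: cws; case: (boolP (odd s)) => // os.
  have : 2 %| gcdn w s by rewrite dvdn_gcd !dvdn2 ow os.
  by rewrite /coprime => h /eqP h1; rewrite h1 in h.
by rewrite andbT addbF => ->.
Qed.

End Rotation.

(** * Edges joining vertices of different parity *)

Section Counting.

Variable n : nat.
Hypotheses (n1 : 1 < n) (ne : ~~ odd n).

Let e := @complete_minus_I n.

Let half2 : n./2 + n./2 = n.
Proof. by rewrite addnn even_halfK. Qed.

Let cn : #|'Z_n| = n.
Proof. by rewrite card_ord Zp_cast. Qed.

Let e_sym : symmetric e := complete_minus_I_sym n1 ne.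

Lemma complete_minus_I_irr : irreflexive e.
Proof. by move=> x; rewrite /e /complete_minus_I eqxx. Qed.

Definition odd_edge : rel 'Z_n := fun x y => e x y && (odd x != odd y).

Lemma odd_edge_sym : symmetric odd_edge.
Proof. by move=> x y; rewrite /odd_edge e_sym eq_sym. Qed.

Let half_nz : ((n./2)%:R != 0 :> 'Z_n)%R.
Proof.
apply/eqP => h; have := congr1 (fun z : 'Z_n => z : nat) h.
by rewrite /= val_Zp_nat // modn_small; lia.
Qed.

Let pairs_by_vertex (r : rel 'Z_n) k : (forall x, #|[set y | r x y]| = k) ->
  #|[set p | r p.1 p.2]| = n * k.
Proof.
move=> h.
rewrite -[RHS](_ : \sum_(x : 'Z_n) k = _) -?sum1dep_card; last by rewrite sum_nat_const cn.
rewrite (eq_bigl (fun p => true && r p.1 p.2)) // -(pair_big_dep xpredT r (fun _ _ => 1)) /=.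
by apply: eq_bigr => x _; rewrite sum1dep_card h.
Qed.

Lemma card_edges : 2 * #|edge_set e| = n * (n - 2).
Proof.
rewrite -(card_edge_set e_sym complete_minus_I_irr).
apply: pairs_by_vertex => x.
rewrite (_ : [set y | _] = ~: [set x; x + (n./2)%:R]%R).
  rewrite cardsCs setCK cards2 cn (eq_sym x) -subr_eq0 addrAC subrr add0r.
  by rewrite half_nz.
by apply/setP => y; rewrite !inE negb_or /e /complete_minus_I (eq_sym x).
Qed.

Lemma card_parity b : 2 * #|[set y : 'Z_n | odd y == b]| = n.
Proof.
have sh c : #|[set y : 'Z_n | odd y == c]| <= #|[set y : 'Z_n | odd y == ~~ c]|.
  rewrite -(card_imset _ (addIr 1%R)); apply: subset_leq_card.
  apply/subsetP => z /imsetP[y]; rewrite !inE => /eqP <- ->.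
  by have := odd_addZ n1 ne y 1; rewrite /= => ->; rewrite addbT.
have eqc : #|[set y : 'Z_n | odd y == b]| = #|[set y : 'Z_n | odd y == ~~ b]|.
  by apply/eqP; rewrite eqn_leq sh; have := sh (~~ b); rewrite negbK.
rewrite mul2n -addnn {2}eqc (_ : [set y : 'Z_n | odd y == ~~ b] = ~: [set y : 'Z_n | odd y == b]).
  by rewrite cardsC cn.
by clear eqc; apply/setP => y; rewrite !inE; case: (odd y) b => [] [].
Qed.

(** A vertex has n / 2 neighbours of the other parity in the complete graph, and the
edge of the 1-factor at it is one of these exactly if n / 2 is odd. *)
Lemma card_odd_edges : #|edge_set odd_edge| = n * (n %/ 4).
Proof.
have irr : irreflexive odd_edge by move=> x; rewrite /odd_edge eqxx andbF.
have := card_edge_set odd_edge_sym irr.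
rewrite (@pairs_by_vertex _ (2 * (n %/ 4))); first by lia.
move=> x; set S := [set y : 'Z_n | odd y == ~~ odd x].
have hS : 2 * #|S| = n := card_parity (~~ odd x).
have mid := odd_addZ n1 ne x n./2.
have -> : [set y | odd_edge x y] = S :\ (x + (n./2)%:R)%R.
  apply/setP => y; rewrite !inE /odd_edge /e /complete_minus_I.
  have -> : (odd y == ~~ odd x) = (x != y) && (odd x != odd y).
    by case: (eqVneq x y) => [<- | _] /=; case: (odd x) => //; case: (odd y).
  by rewrite andbCA andbA.
have := cardsD1 (x + (n./2)%:R)%R S; rewrite inE mid.
move: hS; move: #|S| #|S :\ _| => k l hk.
by case: (boolP (odd n./2)) => o; case: (odd x) => /=; lia.
Qed.

Variables m : nat.
Hypothesis m3 : 3 <= m.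

Lemma cycle_walk (v : seq 'Z_n) : is_cycle_seq e m v ->
  exists f : nat -> 'Z_n, [/\ forall i j, f i = f j <-> i = j %[mod m],
    forall i, e (f i) (f i.+1) & cycle_graph v = [set [set f k; f k.+1] | k : 'I_m]].
Proof.
case=> _ sv uv cv; pose f i := nth 0%R v (i %% m).
have m0 : 0 < m by apply: leq_trans m3.
have vE : v = mkseq f m by rewrite -{1}(mkseq_nth_mod 0%R v) sv.
have fm : f m = f 0 by rewrite /f modnn mod0n.
have uf : uniq (mkseq f m) by rewrite -vE.
exists f; split.
- move=> i j; split=> h; last by rewrite /f h.
  by apply/eqP; rewrite -(nth_uniq 0%R _ _ uv) ?sv ?ltn_pmod //; apply/eqP.
- move=> i; have hi := ltn_pmod i m0.
  have := (cycle_mkseqP e uf fm).1; rewrite -vE => /(_ cv _ hi).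
  rewrite /f modn_mod -[i.+1]addn1 -[(i %% m).+1]addn1 modnDml //.
by rewrite {1}vE cycle_graph_mkseq.
Qed.

Section Walk.

Variable f : nat -> 'Z_n.
Hypothesis f_mod : forall i j, f i = f j <-> i = j %[mod m].
Hypothesis f_adj : forall i, e (f i) (f i.+1).

Let fE (k : 'I_m) := [set f k; f k.+1].

Let fE_inj : injective fE.
Proof.
move=> k l /set2_eqP[[/f_mod kl _] | [/f_mod h1 /f_mod h2]].
  by apply: val_inj; move: kl; rewrite !modn_small.
have /eqP : l.+2 = l %[mod m].
  by rewrite -h2 -[l.+2]addn1 -[k.+1]addn1 -modnDml -h1 modnDml.
by rewrite -[l.+2]addn2 -{2}[l : nat]addn0 eqn_modDl mod0n modn_small.
Qed.

Lemma card_cycle_graph : #|[set [set f k; f k.+1] | k : 'I_m]| = m.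
Proof. by rewrite (card_imset _ fE_inj) card_ord. Qed.

Lemma card_odd_cycle_graph :
  #|[set [set f k; f k.+1] | k : 'I_m] :&: edge_set odd_edge| = odd_steps f m.
Proof.
have -> : [set [set f k; f k.+1] | k : 'I_m] :&: edge_set odd_edge =
    fE @: [set k : 'I_m | odd (f k) != odd (f k.+1)].
  apply/setP => A; rewrite inE; apply/andP/imsetP.
    case=> /imsetP[k _ ->]; rewrite mem_edge_set; last exact: odd_edge_sym.
    by case/andP => _ h; exists k; rewrite ?inE.
  case=> k; rewrite inE => h ->; split; first exact: imset_f.
  by rewrite mem_edge_set ?/odd_edge ?f_adj //; apply: odd_edge_sym.
by rewrite (card_imset _ fE_inj) -sum1dep_card big_mkcond /odd_steps.
Qed.

End Walk.

End Counting.

(** * Necessity *)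

Lemma parity_arith (m t : nat) : 4 <= m -> ~~ odd m -> 0 < t ->
  ~~ odd ((m * t) %/ 4 + t * ((m * t)./2).-1) ->
  [/\ m = 0 %[mod 8] -> t = 0 %[mod 4] \/ t = 2 %[mod 4],
      m = 2 %[mod 8] -> t = 0 %[mod 4] \/ t = 1 %[mod 4]
    & m = 6 %[mod 8] -> t = 0 %[mod 4] \/ t = 3 %[mod 4]].
Proof.
move=> m4 me t0; rewrite oddD oddM.
have [i [k [em k8]]] : exists i k, m = 8 * i + k /\ k < 8 by exists (m %/ 8), (m %% 8); lia.
have -> : m * t = 8 * (i * t) + k * t by rewrite em; lia.
have mt : 4 <= 8 * (i * t) + k * t.
  by rewrite (_ : _ + _ = m * t) ?(leq_trans m4) ?leq_pmulr // em; lia.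
have [k0 | [k2 | [k4 | k6]]] : k = 0 \/ k = 2 \/ k = 4 \/ k = 6 by lia.
all: subst k; move: (i * t) mt => X mt h; split; lia.
Qed.

Section Necessity.

Variables (m t : nat).
Let n := m * t.
Hypotheses (m4 : 4 <= m) (me : ~~ odd m) (t0 : 0 < t).
Variable C : {set {set {set 'Z_n}}}.
Hypothesis hC : cyclic_cycle_system (@complete_minus_I n) m C.

Let m3 : 3 <= m. Proof. exact: ltnW. Qed.

Let n4 : 4 <= n. Proof. by rewrite /n (leq_trans m4) // leq_pmulr. Qed.

Let n1 : 1 < n. Proof. by apply: leq_trans n4. Qed.

Let ne : ~~ odd n. Proof. by rewrite oddM (negbTE me). Qed.

Let e := @complete_minus_I n.

Let shift_perm := perm (@translate_inj n 1%R).

Let C_partition : partition C (edge_set e). Proof. by case: hC => [[]]. Qed.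

Let C_walk E : E \in C ->
  exists f : nat -> 'Z_n, [/\ forall i j, f i = f j <-> i = j %[mod m],
    forall i, e (f i) (f i.+1) & E = [set [set f k; f k.+1] | k : 'I_m]].
Proof. by case: hC => [[h _] _] /h[v vc ->]; apply: (cycle_walk m3). Qed.

Let C_shift E : E \in C -> shift_perm E \in C.
Proof.
case: hC => [[h _] hr] EC; have [v vc Ev] := h E EC.
have := hr v vc; rewrite -Ev => /(_ EC); rewrite permE Ev.
rewrite cycle_graph_map //; first exact: addIr.
by case: vc.
Qed.

Let shift_permX k E : (shift_perm ^+ k)%g E = translate (k%:R)%R E.
Proof.
elim: k => [|k IH]; first by rewrite expg0 perm1 translate0.
by rewrite expgSr permM IH permE -translateD -natr1.
Qed.

Let orbit_size E : exists2 s, #|porbit shift_perm E| * s = n &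
  translate (#|porbit shift_perm E|%:R)%R E = E.
Proof.
have inv : translate (#|porbit shift_perm E|%:R)%R E = E.
  by rewrite -shift_permX permX iter_porbit.
have : #|porbit shift_perm E| %| n.
  by apply: iter_porbit_dvd; rewrite shift_permX pchar_Zp // translate0.
by case/dvdnP => s hs; exists s; rewrite // mulnC.
Qed.

Lemma card_system : #|C| = t * (n./2).-1.
Proof.
have cE := card_edges n1 ne.
have : #|edge_set e| = #|C| * m.
  apply: card_uniform_partition C_partition => E /C_walk[f [fm fa ->]].
  exact: card_cycle_graph.
move=> h; rewrite h in cE; apply/eqP.
rewrite -(eqn_pmul2r (_ : 0 < 2 * m)) ?muln_gt0 ?(leq_trans _ m4) //; apply/eqP.
rewrite mulnCA cE (_ : n - 2 = 2 * (n./2).-1); last by lia.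
by move: (n./2).-1 => h'; rewrite /n; lia.
Qed.

(** The sum of o(E) + n over the cycles E is n (n / 4) + n |C|, where o(E) is the number
of odd edges of E and n / 4 is rounded down.  A rho-orbit of a elements, s = n / a,
contributes a (o(E) + n), a multiple of 2 n since 2 s divides o(E) + n. *)
Lemma parity_condition : ~~ odd (n %/ 4 + t * (n./2).-1).
Proof.
pose o E := #|E :&: edge_set (@odd_edge n)|.
have sub : edge_set (@odd_edge n) \subset edge_set e.
  apply/subsetP => A /imsetP[[x y]]; rewrite inE /= => /andP[xy _] ->.
  by apply/imsetP; exists (x, y); rewrite ?inE.
have tot : \sum_(E in C) o E = n * (n %/ 4).
  by rewrite (sum_card_partition C_partition sub) card_odd_edges.
have : 2 * n %| \sum_(E in C) (o E + n).
  apply: (@dvdn_sum_porbit _ shift_perm) => //.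
    move=> E EC; congr (_ + _); rewrite /o permE.
    have inj : injective (fun A : {set 'Z_n} => [set (x + 1)%R | x in A]).
      by apply: imset_inj; apply: addIr.
    have Finv : translate 1%R (edge_set (@odd_edge n)) = edge_set (@odd_edge n).
      apply/eqP; rewrite eqEcard; apply/andP; split; last by rewrite /translate (card_imset _ inj).
      apply/subsetP => _ /imsetP[_ /imsetP[[x y] xy ->] ->].
      rewrite translate_pair mem_edge_set; last exact: odd_edge_sym.
      move: xy; rewrite inE /= /odd_edge /e /complete_minus_I addrAC !(inj_eq (addIr _)).
      by rewrite -[1%R]/(1%:R)%R !odd_addZ // !addbT => /andP[-> h]; apply: contra h => /eqP/negb_inj ->.
    rewrite -{1}Finv /translate -imsetI ?(card_imset _ inj) // => A B _ _; exact: inj.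
  move=> E EC; have [s hs inv] := orbit_size E.
  have [f [fm fa Ef]] := C_walk EC.
  have oE : o E = odd_steps f m by rewrite /o Ef card_odd_cycle_graph.
  have key : 2 * s %| odd_steps f m + n.
    by apply: (odd_steps_invariant n1 ne m3 fm fa hs); rewrite -Ef.
  rewrite oE; case/dvdnP: key => w ->; apply/dvdnP; exists w.
  by move: hs; move: #|porbit _ _| => a hs; rewrite -hs; lia.
rewrite big_split /= tot sum_nat_const (mulnC #|C|) -mulnDr (mulnC 2).
by rewrite dvdn_pmul2l ?(ltnW n1) // dvdn2 card_system.
Qed.

Lemma necessary_mod :
  [/\ m = 0 %[mod 8] -> t = 0 %[mod 4] \/ t = 2 %[mod 4],
      m = 2 %[mod 8] -> t = 0 %[mod 4] \/ t = 1 %[mod 4]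
    & m = 6 %[mod 8] -> t = 0 %[mod 4] \/ t = 3 %[mod 4]].
Proof. exact: parity_arith parity_condition. Qed.

(** Here n = 2 p^a.  The cycle E through the edge {0, d}, d = 2 p^(a - 1), has fewer
than n / 2 translates, so its stabiliser has order at least 3 and, dividing
2 p^a, is divisible by p; thus E is invariant under translation by d.
This rotation takes 0 to its neighbour d, so it is the rotation by one
step, and E is the cycle of the p multiples of d; but E has m > p vertices. *)
Lemma no_hamiltonian_prime_power : t = 1 ->
  (exists p a : nat, [/\ prime p, odd p, 1 <= a & m = 2 * p ^ a]) -> False.
Proof.
move=> t1 [p [a [pp op a1 ma]]].
have nm : n = m by rewrite /n t1 muln1.
pose d := 2 * p ^ a.-1.
have pdm : p * d = m by rewrite ma /d mulnCA -expnS prednK.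
have pd : p * d = n by rewrite pdm.
have p3 : 3 <= p by have := prime_gt1 pp; move: op; clear; lia.
have d0 : 0 < d by rewrite muln_gt0 expn_gt0 (prime_gt0 pp).
have d2 : d + d < n by rewrite -pd addnn -mul2n ltn_pmul2r.
have Zinj i j : i < n -> j < n -> (i%:R = j%:R :> 'Z_n)%R -> i = j.
  move=> il jl h; have := congr1 (fun z : 'Z_n => z : nat) h.
  by rewrite /= !val_Zp_nat // !modn_small.
have adj : e 0%R (d%:R)%R.
  have h2 : n = n./2 + n./2 by rewrite addnn even_halfK.
  rewrite /e /complete_minus_I add0r; apply/andP; split; apply/eqP.
    by rewrite -[0%R]/(0%:R)%R => /Zinj; lia.
  by move=> /Zinj; lia.
have edge0 : [set 0%R; (d%:R)%R] \in edge_set e by apply/imsetP; exists (0%R, (d%:R)%R); rewrite ?inE.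
have [E EC dE] : exists2 E, E \in C & [set 0%R; (d%:R)%R] \in E.
  by move: edge0; rewrite -(cover_partition C_partition) => /bigcupP[E]; exists E.
have [s hs inv] := orbit_size E.
have small : #|porbit shift_perm E| < n./2.
  apply: (@leq_ltn_trans #|C|); last by rewrite card_system t1 mul1n; lia.
  apply/subset_leq_card/subsetP => _ /porbitP[k ->].
  by elim: k => [|k IH]; [rewrite expg0 perm1 | rewrite expgSr permM; apply: C_shift].
set b := #|porbit shift_perm E| in hs inv small.
have ps : p %| s.
  have s2 : 2 < s.
    rewrite ltnNge; apply/negP => s2.
    have := leq_mul (leqnn b) s2; rewrite hs; have := even_halfK ne; lia.
  have sd : s %| 2 * p ^ a by rewrite -ma -pdm pd -hs dvdn_mull.
  have [cs|//] := boolP (coprime p s); last by rewrite prime_coprime // negbK.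
  rewrite Gauss_dvdl in sd; last by rewrite coprime_sym coprimeXl.
  by have := dvdn_leq (isT : 0 < 2) sd; rewrite leqNgt s2.
have invd : translate (d%:R)%R E = E.
  case/dvdnP: ps => s1 es; have -> : d = s1 * b.
    by apply/eqP; rewrite -(eqn_pmul2l (prime_gt0 pp)) pd -hs es; apply/eqP; lia.
  elim: s1 {es} => [|s1 IH]; first by rewrite mul0n translate0.
  by rewrite mulSn natrD translateD inv IH.
have [f [fm fa Ef]] := C_walk EC.
rewrite Ef in invd dE.
have [r hr] := translate_rotation n1 ne m3 fm fa invd.
have perp g : (forall i, g i.+1 = (g i + d%:R)%R :> 'Z_n) -> g p = g 0.
  move=> hg; have : forall i, g i = (g 0 + (i * d)%:R)%R.
    elim=> [|i IH]; first by rewrite mul0n addr0.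
    by rewrite hg IH mulSn natrD -addrA (addrC d%:R)%R.
  by move=> ->; rewrite pd pchar_Zp // addr0.
have pm : (f p == f 0) = false.
  apply/negbTE/eqP => /fm; rewrite mod0n modn_small; last by rewrite -nm -pd; nia.
  by lia.
case/imsetP: dE => k _ /set2_eqP[[e0 e1] | [e0 e1]].
  have shift1 i : f i.+1 = (f i + d%:R)%R.
    rewrite -hr; apply/fm; have /fm rk : f (k + r) = f k.+1 by rewrite hr -e0 add0r.
    apply/eqP; rewrite -[i.+1]addn1 eqn_modDl -(eqn_modDl k) addn1 eq_sym.
    exact/eqP.
  by move/eqP: pm; apply; apply: perp.
have shift1 i : f i = (f i.+1 + d%:R)%R.
  rewrite -hr; apply/fm; have /fm rk : f (k.+1 + r) = f k by rewrite hr -e0 add0r.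
  apply/eqP; rewrite -[X in X == _ %[mod m]]addn0 addSnnS eqn_modDl -(eqn_modDl k) addn0 -addSnnS eq_sym.
  exact/eqP.
have : f 0 = f p.
  have : forall i, f 0 = (f i + (i * d)%:R)%R.
    elim=> [|i IH]; first by rewrite mul0n addr0.
    by rewrite IH (shift1 i) mulSn natrD addrA.
  by move=> /(_ p); rewrite pd pchar_Zp // addr0.
by move/esym/eqP; rewrite pm.
Qed.

End Necessity.

Theorem theorem1p1 (m t : nat) (hm : 4 <= m) (hm_even : ~~ odd m) (ht : 0 < t) :
  (exists C : {set {set {set 'Z_(m * t)}}},
      cyclic_cycle_system (@complete_minus_I (m * t)) m C)
  <->
  [/\ m = 0 %[mod 8] -> t = 0 %[mod 4] \/ t = 2 %[mod 4],
      m = 2 %[mod 8] ->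
        (t = 0 %[mod 4] \/ t = 1 %[mod 4]) /\
        ((exists p a : nat, [/\ prime p, 1 <= a & m = 2 * p ^ a]) -> 1 < t),
      m = 4 %[mod 8] -> 1 <= t
    & m = 6 %[mod 8] -> t = 0 %[mod 4] \/ t = 3 %[mod 4]].
Proof.
split; last exact: existence.
case=> C hC; have [h0 h2 h6] := necessary_mod hm hm_even ht hC.
split=> // m2; split; first exact: h2.
(* Here p is odd, as a power of 2 is not 2 mod 8 unless it is 2 itself. *)
case=> p [a [pp a1 ma]]; rewrite ltn_neqAle ht andbT eq_sym.
apply/eqP => t1; apply: (no_hamiltonian_prime_power hm hm_even ht hC t1).
exists p, a; split=> //; case: (even_prime pp) => // p2.
move: m2 hm; rewrite ma p2; case: a a1 {ma} => [//|[//|a]] _; clear.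
by rewrite !expnS; lia.
Qed.
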